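(* Let $1<q\le\infty$. (i) The bounded sets in $\mathcal D'_{L^q}$ and the bounded sets in $\mathcal D'_{L^q,c}$ coincide with the relatively compact sets in $\mathcal D'_{L^q,c}$. (ii) They are characterised by: a set $B\subset\mathcal D'_{L^q}$ is bounded if and only if there exist $m\in\mathbb N_0$ and $C_m>0$ such that $B\subset C_m(L_{-2m}*B_{1,q})$.
   Context: All spaces are on $\mathbb R^n$. Let $p$ be defined by $\frac1p+\frac1q=1$, so $1\le p<\infty$. $\mathcal D_{L^p}=\{f\in C^\infty:\partial^\alpha f\in L^p\ \forall\alpha\in\mathbb N_0^n\}$ with the topology generated by $\sup_{|\alpha|\le m}\|\partial^\alpha f\|_p$, $m\in\mathbb N_0$. $\mathcal D'_{L^q}$ is the dual of $\mathcal D_{L^p}$ with the strong topology $\beta(\mathcal D'_{L^q},\mathcal D_{L^p})$. $\mathcal D'_{L^q,c}$ is the same vector space with the topology $\kappa(\mathcal D'_{L^q},\mathcal D_{L^p})$ of uniform convergence on absolutely convex compact subsets of $\mathcal D_{L^p}$. $L_{-2m}=(1-\Delta_n)^m\delta$ (a Bessel kernel), so $L_{-2m}*f=(1-\Delta_n)^mf$ in the distributional sense, where $\Delta_n$ is the Laplacian on $\mathbb R^n$. $B_{1,q}=\{f\in L^q:\|f\|_q\le1\}$ and $L_{-2m}*B_{1,q}=\{L_{-2m}*f:f\in B_{1,q}\}$. *)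

(* Defs.v *)
From HB Require Import structures.
From mathcomp Require Import all_boot all_order all_algebra.
From mathcomp Require Import all_classical all_reals all_analysis.
From mathcomp Require Import measurable_realfun ess_sup_inf.
From mathcomp.real_closed Require Import complex.

Set Implicit Arguments.
Unset Strict Implicit.
Unset Printing Implicit Defensive.

Import Order.TTheory GRing.Theory Num.Theory.
Import numFieldTopology.Exports numFieldNormedType.Exports.

Local Open Scope classical_set_scope.
Local Open Scope ring_scope.

(* Scalars are an arbitrary numFieldType; below they are R[i].  R[i]^o is R[i]
   seen as a vector space over itself. *)
Section tvs_notions.
Context (K : numFieldType) (E : preTopologicalLmodType K).

Definition tvs_bounded (A : set E) := forall U : set E, nbhs 0 U ->
  exists2 r : K, 0 < r &
    forall t : K, r <= `|t| -> A `<=` [set t *: x | x in U].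

Definition absolutely_convex (A : set E) :=
  forall (a b : K) (x y : E), A x -> A y -> `|a| + `|b| <= 1 ->
    A (a *: x + b *: y).

Definition relatively_compact (A : set E) := compact (closure A).

Definition linear_continuous : {pred E -> K^o} :=
  mem [set u : E -> K^o | linear u /\ continuous u].

Lemma linear_continuous_submod : submod_closed linear_continuous.
Proof.
split.
  rewrite inE; split; first by move=> a x y; rewrite /= scaler0 addr0.
  by move=> x; exact: cvg_cst.
move=> a u v; rewrite !inE => -[lu cu] [lv cv]; split.
  move=> b x y; rewrite !fctE lu lv !scalerDr !scalerA [b * a]mulrC.
  by rewrite addrACA.
move=> x; apply: (@cvgD K K^o); last exact: cv.
by apply: (@cvgZl_tmp K K^o); exact: cu.
Qed.

HB.instance Definition _ :=
  GRing.isSubmodClosed.Build K (E -> K^o) linear_continuous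
    linear_continuous_submod.

Record topological_dual := TopologicalDual {
  dual_fun :> E -> K^o ; _ : dual_fun \in linear_continuous }.

HB.instance Definition _ := [isSub for dual_fun].
HB.instance Definition _ := [Choice of topological_dual by <:].
HB.instance Definition _ := [SubChoice_isSubLmodule of topological_dual by <:].

Section polar_topology.
Variable S : set (set E).

(* The dual with the topology of uniform convergence on the members of S. *)
Definition dual_with_convergence_on : Type :=
  initial_topology
    (fun u : topological_dual => (u : {family S, E -> K^o})).

HB.instance Definition _ := Topological.on dual_with_convergence_on.
HB.instance Definition _ :=
  GRing.Lmodule.copy dual_with_convergence_on topological_dual.
End polar_topology.

Definition strong_dual := dual_with_convergence_on tvs_bounded.
HB.instance Definition _ := PreTopologicalLmodule.on strong_dual.

Definition kappa_dual := dual_with_convergence_on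
  [set A | absolutely_convex A /\ compact A].
HB.instance Definition _ := PreTopologicalLmodule.on kappa_dual.

End tvs_notions.

Arguments topological_dual {K} E.
Arguments strong_dual {K} E.
Arguments kappa_dual {K} E.

Section euclidean_space.
Context {R : realType}.

(* R^n is 'rV[R]_n, with the product sigma-algebra (the Borel sets of R^n). *)
Section measurable_rV.
Variable n : nat.

Let coord (i : 'I_n) (v : 'rV[R]_n) : measurableTypeR R := v ord0 i.

Let measurable_rV0 : g_sigma_preimage coord set0.
Proof. exact: sigma_algebra0. Qed.

Let measurable_rVC A :
  g_sigma_preimage coord A -> g_sigma_preimage coord (~` A).
Proof. exact: sigma_algebraC. Qed.

Let measurable_rV_bigcup (F : (set 'rV[R]_n)^nat) :
  (forall i, g_sigma_preimage coord (F i)) ->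
  g_sigma_preimage coord (\bigcup_i F i).
Proof. exact: sigma_algebra_bigcup. Qed.

HB.instance Definition _ := @isMeasurable.Build default_measure_display
  'rV[R]_n (g_sigma_preimage coord)
  measurable_rV0 measurable_rVC measurable_rV_bigcup.

End measurable_rV.

Definition rV_cons n (x : 'rV[R]_n * measurableTypeR R) : 'rV[R]_n.+1 :=
  \row_i (if unlift ord0 i is Some j then x.1 ord0 j else x.2).

Lemma measurable_coord n (i : 'I_n) :
  measurable_fun setT (fun v : 'rV[R]_n => v ord0 i : measurableTypeR R).
Proof.
move=> _ Y mY; rewrite setTI; apply: sub_sigma_algebra => /=.
rewrite -bigcup_seq/=; exists i => /=; first by rewrite mem_index_enum.
by exists Y => //; rewrite setTI.
Qed.

Lemma measurable_rV_cons n : measurable_fun setT (@rV_cons n).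
Proof.
pose coord m (i : 'I_m) (v : 'rV[R]_m) : measurableTypeR R := v ord0 i.
apply: (@measurability _ _ _ _ _ _ (\big[setU/set0]_(i < n.+1)
  preimage_set_system setT (@coord n.+1 i) measurable)) => //.
rewrite -bigcup_mkord_ord => _ [_ [i /= ilt [A mA <-]] <-].
rewrite !setTI; set j : 'I_n.+1 := inord i.
suff : measurable_fun setT (fun x => @coord n.+1 j (rV_cons x)).
  by move=> /(_ measurableT A mA); rewrite setTI.
rewrite /coord/=; under eq_fun do rewrite mxE.
case: unliftP => [k _|_]; last exact: measurable_snd.
exact: (measurableT_comp (measurable_coord k) measurable_fst).
Qed.

Section product_with_line.
Variables (n : nat) (mu : {measure set 'rV[R]_n -> \bar R}).

Definition rV_cons_measure : set 'rV[R]_n.+1 -> \bar R :=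
  pushforward (mu \x lebesgue_measure)%E (@rV_cons n).

Let rV_cons_measure0 : rV_cons_measure set0 = 0%E.
Proof. by rewrite /rV_cons_measure /pushforward preimage_set0 measure0. Qed.

Let rV_cons_measure_ge0 A : (0 <= rV_cons_measure A)%E.
Proof. by rewrite /rV_cons_measure /pushforward measure_ge0. Qed.

Let rV_cons_measure_sigma_additive : semi_sigma_additive rV_cons_measure.
Proof.
exact: (@measure_semi_sigma_additive _ _ _
  (measure_function_pushforward__canonical__measure_function_Measure
    (mu \x lebesgue_measure)%E (@measurable_rV_cons n))).
Qed.

HB.instance Definition _ := isMeasure.Build _ _ _ rV_cons_measure
  rV_cons_measure0 rV_cons_measure_ge0 rV_cons_measure_sigma_additive.

End product_with_line.

(* Lebesgue measure on R^n, as an iterated product; lebesgue_rV_box below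
   gives its value on boxes. *)
Fixpoint lebesgue_rV n : {measure set 'rV[R]_n -> \bar R} :=
  match n with
  | 0 => dirac (0 : 'rV[R]_0)
  | m.+1 => rV_cons_measure (lebesgue_rV m)
  end.

End euclidean_space.

Lemma measurable_rV_box (R : realType) n (A : 'I_n -> set (measurableTypeR R)) :
  (forall i, measurable (A i)) ->
  measurable [set v : 'rV[R]_n | forall i, A i (v ord0 i)].
Proof.
move=> mA; rewrite (_ : mkset _ = \big[setI/setT]_(i < n)
    ((fun v : 'rV[R]_n => v ord0 i : measurableTypeR R) @^-1` A i)).
  apply: bigsetI_measurable => i _; rewrite -[X in measurable X]setTI.
  exact: measurable_coord.
rewrite -bigcap_seq; apply/seteqP; split => v /= vA i.
  by move=> _; exact: vA.
by apply: vA; rewrite /= mem_index_enum.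
Qed.

Lemma lebesgue_rV_box (R : realType) n (A : 'I_n -> set (measurableTypeR R)) :
  (forall i, measurable (A i)) ->
  lebesgue_rV n [set v : 'rV[R]_n | forall i, A i (v ord0 i)] =
  (\prod_(i < n) lebesgue_measure (A i))%E.
Proof.
elim: n A => [|n IH] A mA.
  by rewrite big_ord0 /= diracE mem_set// => -[].
rewrite big_ord_recl /= /rV_cons_measure /pushforward.
rewrite (_ : _ @^-1` _ =
    [set v : 'rV[R]_n | forall i, A (lift ord0 i) (v ord0 i)] `*` A ord0).
  have mB := measurable_rV_box (fun i => mA (lift ord0 i)).
  rewrite product_measure1E// muleC; congr (_ * _)%E.
  exact: (IH (fun i => A (lift ord0 i))).
apply/seteqP; split => -[v t] /=.
  move=> h; split=> [i|].
    by have := h (lift ord0 i); rewrite mxE liftK.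
  by have := h ord0; rewrite mxE unlift_none.
move=> [hv ht] i; rewrite mxE; case: unliftP => [j|] ->; [exact: hv|exact: ht].
Qed.

Section smooth_functions.
Context {R : realType} {n : nat}.
Implicit Types (g h : 'rV[R]_n -> R) (f : 'rV[R]_n -> R[i]).

Definition partial (i : 'I_n) g : 'rV[R]_n -> R := 'D_(delta_mx ord0 i) g.

Definition partials (s : seq 'I_n) g := foldr partial g s.

(* All partial derivatives, of every order and in every order of the variables,
   exist and are continuous. *)
Definition smooth g := forall s : seq 'I_n,
  continuous (partials s g) /\
  forall i x, derivable (partials s g) x (delta_mx ord0 i).

Definition mpartial (a : {ffun 'I_n -> nat}) g :=
  foldr (fun i => iter (a i) (partial i)) g (enum 'I_n).

(* Complex-valued functions are differentiated componentwise, since R[i] is not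
   registered as a normed space over R. *)
Definition csmooth f :=
  smooth (@complex.Re R \o f) /\ smooth (@complex.Im R \o f).

Definition cmpartial (a : {ffun 'I_n -> nat}) f : 'rV[R]_n -> R[i] :=
  fun x => Complex (mpartial a (@complex.Re R \o f) x)
                   (mpartial a (@complex.Im R \o f) x).

Lemma mpartialE a g :
  mpartial a g = partials (flatten [seq nseq (a i) i | i <- enum 'I_n]) g.
Proof.
rewrite /mpartial; elim: (enum 'I_n) => //= i s ->.
rewrite /partials foldr_cat; by elim: (a i) => //= k ->.
Qed.

Lemma partials_lin (r : R) g h s : smooth g -> smooth h ->
  partials s (fun x => r * g x + h x) =
    (fun x => r * partials s g x + partials s h x).
Proof.
move=> sg sh; elim: s => //= i s ->; apply/funext => x; rewrite /partial.
have -> : (fun x => r * partials s g x + partials s h x) =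
  (r \*: (partials s g : 'rV[R]_n -> R^o)) + partials s h by [].
rewrite deriveD; [|apply: derivableZ; exact: (sg s).2|exact: (sh s).2].
by rewrite deriveZ; last exact: (sg s).2.
Qed.

Lemma smooth_lin (r : R) g h : smooth g -> smooth h ->
  smooth (fun x => r * g x + h x).
Proof.
move=> sg sh s; rewrite partials_lin//; split => [x|i x].
  exact: (cvgD (cvgM (cvg_cst r) ((sg s).1 x)) ((sh s).1 x)).
have -> : (fun x => r * partials s g x + partials s h x) =
  (r \*: (partials s g : 'rV[R]_n -> R^o)) + partials s h by [].
by apply: derivableD; [apply: derivableZ; exact: (sg s).2|exact: (sh s).2].
Qed.

Lemma partials_cst s (r : R) : exists r', partials s (cst r) = cst r'.
Proof.
elim: s => [|i s [r' /= ->]]; first by exists r.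
by exists 0; apply/funext => x; rewrite /partial derive_cst.
Qed.

Lemma smooth_cst (r : R) : smooth (cst r).
Proof.
move=> s; have [r' ->] := partials_cst s r.
split=> [|i x]; first exact: cst_continuous.
exact: derivable_cst.
Qed.

Lemma ReZD (c z w : R[i]) :
  complex.Re (c * z + w) = complex.Re c * complex.Re z +
    (- complex.Im c * complex.Im z + complex.Re w).
Proof. by case: c z w => [? ?] [? ?] [? ?] /=; rewrite mulNr addrA. Qed.

Lemma ImZD (c z w : R[i]) :
  complex.Im (c * z + w) = complex.Re c * complex.Im z +
    (complex.Im c * complex.Re z + complex.Im w).
Proof. by case: c z w => [? ?] [? ?] [? ?] /=; rewrite addrA. Qed.

Lemma csmooth_lin (c : R[i]) f1 f2 : csmooth f1 -> csmooth f2 ->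
  csmooth (fun x => c * f1 x + f2 x).
Proof.
move=> [s1 t1] [s2 t2]; split.
  under [_ \o _]eq_fun do rewrite /= ReZD.
  exact: smooth_lin s1 (smooth_lin _ t1 s2).
under [_ \o _]eq_fun do rewrite /= ImZD.
exact: smooth_lin t1 (smooth_lin _ s1 t2).
Qed.

Lemma cmpartial_lin (c : R[i]) f1 f2 a : csmooth f1 -> csmooth f2 ->
  cmpartial a (fun x => c * f1 x + f2 x) =
  (fun x => c * cmpartial a f1 x + cmpartial a f2 x).
Proof.
move=> [s1 t1] [s2 t2]; apply/funext => x; apply/eqP.
rewrite eq_complex ReZD ImZD /cmpartial /=; apply/andP; split; apply/eqP.
  under [X in mpartial a X]eq_fun do rewrite /= ReZD.
  rewrite !mpartialE (partials_lin _ _ s1 (smooth_lin (- complex.Im c) t1 s2)).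
  by rewrite (partials_lin _ _ t1 s2).
under [X in mpartial a X]eq_fun do rewrite /= ImZD.
rewrite !mpartialE (partials_lin _ _ t1 (smooth_lin (complex.Im c) s1 t2)).
by rewrite (partials_lin _ _ s1 t2).
Qed.

End smooth_functions.

Section Lp_functions.
Context {R : realType} {n : nat} (p : \bar R).
Implicit Types f g : 'rV[R]_n -> R[i].

(* The library norm of R[i] takes its values in R[i]; this one is in R, see
   cmodulusE. *)
Definition cmodulus (z : R[i]) : R := ComplexField.Normc.normc z.

Definition cmeasurable f :=
  measurable_fun setT (@complex.Re R \o f) /\
  measurable_fun setT (@complex.Im R \o f).

Definition cLnorm f : \bar R := 'N[lebesgue_rV n]_p[EFin \o (cmodulus \o f)].

Definition cLfun f := cmeasurable f /\ (cLnorm f < +oo)%E.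

Lemma cmodulusE (z : R[i]) : `|z| = (cmodulus z)%:C%C.
Proof. by []. Qed.

Lemma cmodulus_ge0 z : 0 <= cmodulus z.
Proof. by case: z => a b; exact: sqrtr_ge0. Qed.

Lemma ler_cmodulusD z w : cmodulus (z + w) <= cmodulus z + cmodulus w.
Proof. by have := ler_normD z w; rewrite !cmodulusE -rmorphD lecR. Qed.

Lemma cmodulusM z w : cmodulus (z * w) = cmodulus z * cmodulus w.
Proof. exact: ComplexField.Normc.normcM. Qed.

Lemma cmeasurable_lin (c : R[i]) f g : cmeasurable f -> cmeasurable g ->
  cmeasurable (fun x => c * f x + g x).
Proof.
move=> [f1 f2] [g1 g2]; split.
  under [_ \o _]eq_fun do rewrite /= ReZD.
  apply: measurable_funD; first exact: measurable_funM.
  by apply: measurable_funD => //; exact: measurable_funM.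
under [_ \o _]eq_fun do rewrite /= ImZD.
apply: measurable_funD; first exact: measurable_funM.
by apply: measurable_funD => //; exact: measurable_funM.
Qed.

Lemma measurable_cmodulus f : cmeasurable f ->
  measurable_fun setT (cmodulus \o f).
Proof.
move=> [f1 f2].
rewrite (_ : _ \o _ = Num.sqrt \o
  (((@complex.Re R \o f) \* (@complex.Re R \o f)) \+
   ((@complex.Im R \o f) \* (@complex.Im R \o f)))); last first.
  by apply/funext => x /=; case: (f x) => a b /=; rewrite !expr2.
apply: measurableT_comp.
  by apply: continuous_measurable_fun; exact: sqrt_continuous.
by apply: measurable_funD; exact: measurable_funM.
Qed.

Lemma le_Lnorm (f g : 'rV[R]_n -> R) : (1 <= p)%E ->
  measurable_fun setT f -> measurable_fun setT g ->
  (forall x, 0 <= f x <= g x) ->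
  ('N[lebesgue_rV n]_p[EFin \o f] <= 'N[lebesgue_rV n]_p[EFin \o g])%E.
Proof.
move=> p1 mf mg fg.
have f0 x : 0 <= f x by have /andP[] := fg x.
have fgx x : f x <= g x by have /andP[] := fg x.
have g0 x : 0 <= g x by exact: le_trans (fgx x).
rewrite unlock; case: p p1 => [r r1|_|//].
  have r0 : 0 <= r by rewrite lee_fin in r1; exact: le_trans r1.
  apply: gt0_ler_poweR.
  - by rewrite invr_ge0.
  - rewrite in_itv/= leey andbT; apply: integral_ge0 => x _.
    by rewrite lee_fin powR_ge0.
  - rewrite in_itv/= leey andbT; apply: integral_ge0 => x _.
    by rewrite lee_fin powR_ge0.
  apply: ge0_le_integral => //=.
  - apply/measurable_EFinP.
    apply: (@measurableT_comp _ _ _ _ _ _ (@powR R ^~ r)) => //=.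
    exact: measurableT_comp.
  - apply/measurable_EFinP.
    apply: (@measurableT_comp _ _ _ _ _ _ (@powR R ^~ r)) => //=.
    exact: measurableT_comp.
  - move=> x _; rewrite lee_fin ge0_ler_powR ?nnegrE//.
    by rewrite !ger0_norm.
case: ifPn => // _; apply: le_ess_sup; apply/nearW => x /=.
by rewrite lee_fin !ger0_norm.
Qed.

Lemma cLnormD f g : (1 <= p)%E -> cmeasurable f -> cmeasurable g ->
  (cLnorm (fun x => f x + g x)%R <= cLnorm f + cLnorm g)%E.
Proof.
move=> p1 mf mg; rewrite /cLnorm.
have mf' := measurable_cmodulus mf; have mg' := measurable_cmodulus mg.
apply: le_trans (eminkowski (lebesgue_rV n) mf' mg' p1).
apply: le_Lnorm => //=.
- have := @cmeasurable_lin 1 f g mf mg.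
  under eq_fun do rewrite mul1r.
  exact: measurable_cmodulus.
- exact: measurable_funD.
- by move=> x /=; rewrite cmodulus_ge0 ler_cmodulusD.
Qed.

Lemma cLfun_lin (c : R[i]) f g : (1 <= p)%E -> cLfun f -> cLfun g ->
  cLfun (fun x => c * f x + g x).
Proof.
move=> p1 [mf ff] [mg fg]; split; first exact: cmeasurable_lin.
have m0 : cmeasurable (fun=> 0) by split; exact: measurable_cst.
have mcf : cmeasurable (fun x => c * f x).
  by have := cmeasurable_lin c mf m0; under eq_fun do rewrite addr0.
apply: le_lt_trans (cLnormD p1 mcf mg) _; apply: lte_add_pinfty => //.
have mf' := measurable_cmodulus mf.
have Lf : (cmodulus \o f) \in Lfun (lebesgue_rV n) p.
  by rewrite inE; apply/andP; split; rewrite inE.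
have : cmodulus c *: (cmodulus \o f : 'rV[R]_n -> R^o)
    \in Lfun (lebesgue_rV n) p.
  have [L0 Llin] := Lfun_submod_closed (lebesgue_rV n) p1.
  by have := Llin (cmodulus c) _ _ Lf L0; rewrite addr0.
rewrite inE => /andP[_]; rewrite inE /= /finite_norm /cLnorm.
have -> // : cmodulus \o (fun x => c * f x) =
  cmodulus c *: (cmodulus \o f : 'rV[R]_n -> R^o).
by apply/funext => x /=; rewrite cmodulusM.
Qed.

End Lp_functions.

Definition DLp_pred {R : realType} {n : nat} (p : \bar R) :
    {pred 'rV[R]_n -> R[i]^o} :=
  mem [set f : 'rV[R]_n -> R[i]^o |
    csmooth f /\ forall a, cLfun p (cmpartial a f)].

(* p1 occurs in the type because the vector space structure depends on it. *)
Record DLp {R : realType} (n : nat) (p : \bar R) (p1 : (1 <= p)%E) := MkDLp {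
  DLp_val :> 'rV[R]_n -> R[i]^o ;
  DLp_valP : DLp_val \in DLp_pred p }.

Section DLp_space.
Context {R : realType} {n : nat} {p : \bar R} (p1 : (1 <= p)%E).

HB.instance Definition _ := [isSub for @DLp_val R n p p1].
HB.instance Definition _ := [Choice of DLp n p1 by <:].

Lemma csmooth0 : csmooth (cst 0 : 'rV[R]_n -> R[i]).
Proof. by split; exact: smooth_cst. Qed.

Lemma cmpartial0 a : cmpartial a (cst 0 : 'rV[R]_n -> R[i]) = cst 0.
Proof.
have := cmpartial_lin (-1) a csmooth0 csmooth0.
under [X in cmpartial a X]eq_fun do rewrite mulr0 addr0.
by move=> ->; apply/funext => x; rewrite mulN1r addNr.
Qed.

Lemma cLnorm0 : cLnorm p (cst 0 : 'rV[R]_n -> R[i]) = 0%E.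
Proof.
rewrite /cLnorm (_ : _ \o _ = cst 0%E); last first.
  apply/funext => x /=; congr EFin; exact: ComplexField.Normc.normc0.
by rewrite Lnorm0// gt_eqF// (lt_le_trans _ p1).
Qed.

Lemma DLp_submod : submod_closed (@DLp_pred R n p).
Proof.
split.
  rewrite inE; split => [|a]; first exact: csmooth0.
  rewrite cmpartial0; split; first by split; exact: measurable_cst.
  by rewrite cLnorm0.
move=> c f g; rewrite !inE => -[sf Lf] [sg Lg]; split.
  exact: csmooth_lin.
move=> a.
rewrite (_ : cmpartial a _ = fun x => c * cmpartial a f x + cmpartial a g x).
  exact: cLfun_lin.
exact: cmpartial_lin.
Qed.

HB.instance Definition _ :=
  GRing.isSubmodClosed.Build R[i] ('rV[R]_n -> R[i]^o) (DLp_pred p) DLp_submod.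
HB.instance Definition _ := [SubChoice_isSubLmodule of DLp n p1 by <:].

Definition DLp_seminorm (m : nat) (f : DLp n p1) : \bar R :=
  ereal_sup [set cLnorm p (cmpartial a f) |
    a in [set a : {ffun 'I_n -> nat} | (\sum_i a i <= m)%N]].

Lemma DLp_seminorm0 m : DLp_seminorm m 0 = 0%E.
Proof.
rewrite /DLp_seminorm (_ : [set _ | _ in _] = [set 0%E]) ?ereal_sup1//.
apply/seteqP; split => [_ [a _ <-]|_ ->] /=.
  by rewrite cmpartial0 cLnorm0.
exists [ffun=> 0%N]; last by rewrite cmpartial0 cLnorm0.
by rewrite /= big1// => i _; rewrite ffunE.
Qed.

Lemma DLp_seminormD m (f g : DLp n p1) :
  (DLp_seminorm m (f + g)%R <= DLp_seminorm m f + DLp_seminorm m g)%E.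
Proof.
apply: ge_ereal_sup => _ [a am <-].
have [sf Lf] : csmooth f /\ forall a, cLfun p (cmpartial a f).
  by have := DLp_valP f; rewrite inE.
have [sg Lg] : csmooth g /\ forall a, cLfun p (cmpartial a g).
  by have := DLp_valP g; rewrite inE.
have -> : cmpartial a (f + g : DLp n p1) =
    fun x => (cmpartial a f x + cmpartial a g x)%R.
  have := cmpartial_lin 1 a sf sg.
  under eq_fun do rewrite mul1r.
  by move=> ->; apply/funext => x; rewrite mul1r.
apply: le_trans (cLnormD p1 (Lf a).1 (Lg a).1) _.
by apply: leeD; apply: ereal_sup_ubound; exists a.
Qed.

Lemma DLp_seminorm_mono m m' (f : DLp n p1) : (m <= m')%N ->
  (DLp_seminorm m f <= DLp_seminorm m' f)%E.
Proof.
move=> mm'; apply: ge_ereal_sup => _ [a am <-].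
by apply: ereal_sup_ubound; exists a => //=; exact: leq_trans mm'.
Qed.

Definition DLp_ball (f : DLp n p1) (me : nat * R) : set (DLp n p1) :=
  [set g | (DLp_seminorm me.1 (g - f)%R < me.2%:E)%E].

(* The seminorms increase with m, so the balls of the single seminorms form a
   neighbourhood base. *)
Definition DLp_nbhs (f : DLp n p1) : set_system (DLp n p1) :=
  filter_from [set me : nat * R | 0 < me.2] (DLp_ball f).

HB.instance Definition _ := hasNbhs.Build (DLp n p1) DLp_nbhs.

Let DLp_ball_center (f : DLp n p1) me : 0 < me.2 -> DLp_ball f me f.
Proof. by move=> e0; rewrite /DLp_ball /= subrr DLp_seminorm0 lte_fin. Qed.

Let DLp_nbhs_filter (f : DLp n p1) : ProperFilter (nbhs f).
Proof.
apply: filter_from_proper; last by move=> me /(DLp_ball_center f) fme; exists f.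
apply: filter_from_filter; first by exists (0%N, 1); exact: ltr01.
move=> [m e] [m' e'] /= e0 e0'; exists (maxn m m', Num.min e e').
  by rewrite /= lt_min e0 e0'.
move=> g; rewrite /DLp_ball /= EFin_min lt_min => /andP[ge ge'].
split; rewrite /DLp_ball /=.
  by apply: le_lt_trans ge; apply: DLp_seminorm_mono; exact: leq_maxl.
by apply: le_lt_trans ge'; apply: DLp_seminorm_mono; exact: leq_maxr.
Qed.

Let DLp_nbhs_singleton (f : DLp n p1) A : nbhs f A -> A f.
Proof. by move=> [me e0]; apply; exact: DLp_ball_center. Qed.

Let DLp_nbhs_nbhs (f : DLp n p1) A : nbhs f A -> nbhs f (nbhs^~ A).
Proof.
move=> [[m e] /= e0 feA]; exists (m, e / 2); first by rewrite /= divr_gt0.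
move=> g; rewrite /DLp_ball /= => fg.
exists (m, e / 2); first by rewrite /= divr_gt0.
move=> h; rewrite /DLp_ball /= => gh; apply: feA; rewrite /DLp_ball /=.
rewrite -(subrK g h) -addrA (splitr e) EFinD.
by apply: le_lt_trans (DLp_seminormD _ _ _) _; exact: lteD.
Qed.

HB.instance Definition _ := Nbhs_isNbhsTopological.Build (DLp n p1)
  DLp_nbhs_filter DLp_nbhs_singleton DLp_nbhs_nbhs.

End DLp_space.

Section bessel.
Context {R : realType} {n : nat}.

Definition one_sub_laplacian (g : 'rV[R]_n -> R) : 'rV[R]_n -> R :=
  fun x => g x - \sum_(i < n) partial i (partial i g) x.

(* (1 - Delta)^m *)
Definition bessel_operator (m : nat) (f : 'rV[R]_n -> R[i]) :
    'rV[R]_n -> R[i] :=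
  fun x => Complex (iter m one_sub_laplacian (@complex.Re R \o f) x)
                   (iter m one_sub_laplacian (@complex.Im R \o f) x).

Definition cintegral (f : 'rV[R]_n -> R[i]) : R[i] :=
  Complex (\int[lebesgue_rV n]_x complex.Re (f x))
          (\int[lebesgue_rV n]_x complex.Im (f x)).

Definition Lq_unit_ball (q : \bar R) : set ('rV[R]_n -> R[i]) :=
  [set f | cmeasurable f /\ (cLnorm q f <= 1)%E].

(* L_{-2m} * f = (1 - Delta)^m f in the distributional sense: (1 - Delta)^m is
   moved onto the argument phi of the functional (it is its own transpose for
   the bilinear pairing <f, phi> = int f phi).  For f in L^q with
   1/p + 1/q = 1 the integrand is in L^1. *)
Definition bessel_conv {p : \bar R} {p1 : (1 <= p)%E} (m : nat)
    (f : 'rV[R]_n -> R[i]) : DLp n p1 -> R[i]^o :=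
  fun phi => cintegral (fun x => f x * bessel_operator m phi x).

(* L_{-2m} * B_{1,q} *)
Definition bessel_conv_ball {p : \bar R} {p1 : (1 <= p)%E} (m : nat)
    (q : \bar R) : set (topological_dual (DLp n p1)) :=
  [set u | exists2 f, Lq_unit_ball q f & u = bessel_conv m f :> (_ -> _)].

End bessel.

(* Main.v *)
From HB Require Import structures.
Require Import Defs.
From mathcomp Require Import all_boot all_order all_algebra.
From mathcomp Require Import all_classical all_reals all_analysis.
From mathcomp Require Import measurable_realfun ess_sup_inf.
From mathcomp.real_closed Require Import complex.
From mathcomp Require Import ring lra.

Set Implicit Arguments.
Unset Strict Implicit.
Unset Printing Implicit Defensive.

Import Order.TTheory GRing.Theory Num.Theory.
Import numFieldTopology.Exports numFieldNormedType.Exports.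

Local Open Scope classical_set_scope.
Local Open Scope ring_scope.

(** Write [D] for the space of smooth functions with all derivatives in L^p, and call a set B
of functionals equicontinuous if |u phi| <= C N_m(phi) for all u in B and phi in [D], with one
C and one of the defining norms N_m. All the conditions of the theorem are equivalent to
equicontinuity.

A set of functionals is bounded for a topology of uniform convergence on a class of sets iff it
is uniformly bounded on each set of the class ([dual_bounded]). Bounded sets and compact discs of
[D] are bounded for every N_m, so equicontinuity gives boundedness in both topologies. For the
converse it is enough to be bounded on compact discs: if B is not equicontinuous, there are u_k
in B and phi_k with N_k(phi_k) <= 2^-k and |u_k(phi_k)| = k. Since [D] is complete
([DLp_complete]), all the sums of the a_k phi_k with |a_k| <= 1 exist; they form an absolutely
convex compact set ([disc_hull_compact]), on which B is unbounded
([bounded_on_discs_equicontinuous]). Compactness is the argument of Alaoglu and Bourbaki: an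
ultrafilter on an equicontinuous set converges pointwise, the limit satisfies the same bound, and
on compact sets the convergence is uniform ([equicontinuous_relatively_compact]). Conversely a
relatively compact set is bounded on each disc, by a covering argument
([relatively_compact_bounded_on]).

There remains the description by (1 - Delta)^m. If u = (1 - Delta)^m f with f in the unit ball of
L^q, Hoelder's inequality bounds |u phi| by the L^p norm of (1 - Delta)^m phi
([bessel_ball_bounded]). For the converse the norms N_m have to be bounded by those L^p norms,
that is, 1 - Delta has to gain one derivative in L^p for every p in [1, +oo[ ([sobn_resolvent]).
This follows from an explicit formula. With the weight w(z) = exp(-2 |z|^2), of integral c, set
  m(r) = exp(-2 r^2) * integral of w(z) g(x + 4 r z) dz.
Integrating by parts in z, m'(r) = -4 r exp(-2 r^2) * integral of w(z) (g - Delta g)(x + 4 r z) dz,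
so m(0) - m(oo) = c g(x) is a positive mean of translates of (1 - Delta) g
([resolvent_formula]); one more integration by parts does the same for the first derivatives of g.
Jensen's inequality and translation invariance then give the bounds in L^p
([translates_mean_powR], [resolvent_lpn]). Once |u phi| <= K |(1 - Delta)^m phi|_p, the functional
u factors through phi |-> (1 - Delta)^m phi; it extends to L^p by the theorem of Hahn and Banach
([hahn_banach]) and is represented there by a function of L^q ([riesz_representation]).

Differentiation, integration and duality are carried out for real functions, and complex functions
are treated through their real and imaginary parts, at the price of larger constants. *)

(** * Mean values and mixed derivatives of smooth functions *)

Section calculus.
Context {R : realType} {n : nat}.
Implicit Types (g h : 'rV[R]_n -> R).

Lemma derivable_line g (x v : 'rV[R]_n) (t : R) :
  derivable g (x + t *: v) v ->
  is_derive t (1 : R) (fun s : R => g (x + s *: v)) ('D_v g (x + t *: v)).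
Proof.
move=> dg.
have E : (fun h : R => h^-1 *: (((fun s : R => g (x + s *: v)) \o shift t) (h *: (1 : R))
    - g (x + t *: v))) =
   (fun h : R => h^-1 *: ((g \o shift (x + t *: v)) (h *: v) - g (x + t *: v))).
  apply/funext => h /=; congr (_ *: (g _ - _)).
  by rewrite [h *: 1]mulr1 scalerDl addrCA addrC.
by split; rewrite /derivable /derive E.
Qed.

Lemma smooth_partial i g : smooth g -> smooth (partial i g).
Proof.
move=> sg s.
have -> : partials s (partial i g) = partials (rcons s i) g.
  by rewrite /partials -cats1 foldr_cat.
exact: sg.
Qed.

Lemma smooth_partials s g : smooth g -> smooth (partials s g).
Proof.
by move=> sg; elim: s => [|i s IH]; [exact: sg|exact: smooth_partial IH].
Qed.

Lemma smooth_continuous g : smooth g -> continuous g.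
Proof. by move=> /(_ [::])[]. Qed.

Lemma is_derive_line g i x (t : R) : smooth g ->
  is_derive t (1 : R) (fun s : R => g (x + s *: delta_mx ord0 i))
    (partial i g (x + t *: delta_mx ord0 i)).
Proof. by move=> sg; apply: derivable_line; exact: (sg [::]).2. Qed.

Lemma continuous_line g (x v : 'rV[R]_n) : continuous g ->
  continuous (fun s : R => g (x + s *: v)).
Proof.
move=> cg s; apply: (@continuous_comp _ _ _ (fun s : R => x + s *: v) g).
  apply: cvgD; first exact: cvg_cst.
  by apply: cvgZr_tmp; exact: cvg_id.
exact: cg.
Qed.

Lemma MVT_line g i x (a b : R) : smooth g -> a <= b ->
  exists2 c, a <= c <= b & g (x + b *: delta_mx ord0 i) - g (x + a *: delta_mx ord0 i)
    = partial i g (x + c *: delta_mx ord0 i) * (b - a).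
Proof.
move=> sg ab.
have [||c cab ->] := @MVT_segment R (fun s => g (x + s *: delta_mx ord0 i))
  (fun s => partial i g (x + s *: delta_mx ord0 i)) a b ab.
- by move=> t _; exact: is_derive_line.
- by apply: continuous_subspaceT; apply: continuous_line; exact: smooth_continuous.
by exists c => //; move: cab; rewrite in_itv.
Qed.

Lemma smoothD g h : smooth g -> smooth h -> smooth (g \+ h).
Proof.
move=> sg sh; rewrite (_ : _ \+ _ = (fun x => 1 * g x + h x)); first exact: smooth_lin.
by apply/funext => x; rewrite mul1r.
Qed.

Lemma partialsD s g h : smooth g -> smooth h ->
  partials s (g \+ h) = partials s g \+ partials s h.
Proof.
move=> sg sh; rewrite (_ : _ \+ _ = (fun x => 1 * g x + h x)).
  by rewrite partials_lin//; apply/funext => x /=; rewrite mul1r.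
by apply/funext => x; rewrite mul1r.
Qed.

Lemma partials_cst0 s : partials s (cst 0 : 'rV[R]_n -> R) = cst 0.
Proof. by elim: s => //= i s ->; apply/funext => x; rewrite /partial derive_cst. Qed.

Lemma partialsZ s (r : R) g : smooth g ->
  partials s (fun x => r * g x) = (fun x => r * partials s g x).
Proof.
move=> sg; have := partials_lin r s sg (smooth_cst 0).
rewrite partials_cst0; under eq_fun do rewrite addr0.
by move=> ->; apply/funext => x; rewrite addr0.
Qed.

Lemma smoothZ (r : R) g : smooth g -> smooth (fun x => r * g x).
Proof.
move=> sg; have := smooth_lin r sg (smooth_cst 0).
by under eq_fun do rewrite addr0.
Qed.

Lemma smooth_sum I (l : seq I) (F : I -> 'rV[R]_n -> R) :
  (forall i, smooth (F i)) -> smooth (fun x => \sum_(i <- l) F i x).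
Proof.
move=> sF; elim: l => [|i l IH].
  rewrite (_ : (fun _ => _) = cst 0); first exact: smooth_cst.
  by apply/funext => x; rewrite big_nil.
rewrite (_ : (fun _ => _) = F i \+ (fun x => \sum_(i <- l) F i x)).
  exact: smoothD (sF i) IH.
by apply/funext => x; rewrite big_cons.
Qed.

Lemma partials_sum I (l : seq I) (F : I -> 'rV[R]_n -> R) s :
  (forall i, smooth (F i)) ->
  partials s (fun x => \sum_(i <- l) F i x) = (fun x => \sum_(i <- l) partials s (F i) x).
Proof.
move=> sF; elim: l => [|i l IH].
  rewrite (_ : (fun _ => _) = cst 0); last by apply/funext => x; rewrite big_nil.
  by rewrite partials_cst0; apply/funext => x; rewrite big_nil.
rewrite (_ : (fun _ => _) = F i \+ (fun x => \sum_(i <- l) F i x)); last first.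
  by apply/funext => x; rewrite big_cons.
rewrite partialsD//; last exact: smooth_sum.
by rewrite IH; apply/funext => x /=; rewrite big_cons.
Qed.

(** Two applications of the mean value theorem, first to the increment of [g] in the direction
[j] as a function of the displacement in the direction [i]. *)
Lemma second_difference i j g x (t : R) : smooth g -> 0 <= t ->
  exists c d : R, [/\ 0 <= c <= t, 0 <= d <= t &
    g (x + t *: delta_mx ord0 j + t *: delta_mx ord0 i) - g (x + t *: delta_mx ord0 i)
     - (g (x + t *: delta_mx ord0 j) - g x) =
    partial j (partial i g) (x + c *: delta_mx ord0 i + d *: delta_mx ord0 j) * (t * t)].
Proof.
move=> sg t0.
set ei := delta_mx ord0 i; set ej := delta_mx ord0 j.
have dF s : is_derive s (1 : R) (fun s => g (x + t *: ej + s *: ei) - g (x + s *: ei))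
  (partial i g (x + t *: ej + s *: ei) - partial i g (x + s *: ei)).
  by apply: is_deriveB; exact: is_derive_line.
have [|c] := @MVT_segment R _ _ 0 t t0 (fun s _ => dF s).
  apply: continuous_subspaceT => s; apply: (@cvgB _ R^o).
    by apply: continuous_line; exact: smooth_continuous.
  by apply: continuous_line; exact: smooth_continuous.
rewrite in_itv /= => ct; rewrite !scale0r !addr0 subr0 => ->.
have [d dt E] := MVT_line j (x + c *: ei) (smooth_partial i sg) t0.
exists c, d; split => //; rewrite mulrA; congr (_ * _).
by move: E; rewrite subr0 scale0r addr0 => <-; rewrite addrAC.
Qed.

(** Both mixed derivatives are limits of the same second difference quotient. *)
Lemma partialC i j g : smooth g ->
  partial i (partial j g) = partial j (partial i g).
Proof.
move=> sg; apply/funext => x; apply/eqP; rewrite -subr_eq0 -normr_le0.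
apply/ler_addgt0Pl => e e0; rewrite addr0.
pose ei : 'rV[R]_n := delta_mx ord0 i; pose ej : 'rV[R]_n := delta_mx ord0 j.
have c1 := smooth_continuous (smooth_partial i (smooth_partial j sg)).
have c2 := smooth_continuous (smooth_partial j (smooth_partial i sg)).
have e20 : 0 < e / 2 by rewrite divr_gt0.
have := c1 x; move/cvgrPdist_lt => /(_ _ e20) /nbhs_ballP [d1 /= d10 H1].
have := c2 x; move/cvgrPdist_lt => /(_ _ e20) /nbhs_ballP [d2 /= d20 H2].
(* Every point of the square of side [t] is at distance less than [m] of [x]. *)
pose M := `|ei| + `|ej| + 1.
have M0 : 0 < M by rewrite ltr_wpDl// addr_ge0.
have [m [m0 md1 md2]] : exists m : R, [/\ 0 < m, m <= d1 & m <= d2].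
  by exists (Num.min d1 d2); rewrite lt_min d10 d20 !ge_min !lexx orbT.
pose t : R := m / (M + 1).
have t0 : 0 < t by rewrite divr_gt0// addr_gt0.
have near_x c d : 0 <= c <= t -> 0 <= d <= t ->
    `|x - (x + c *: ei + d *: ej)| < m.
  move=> /andP[c0 ct] /andP[dd0 dt].
  rewrite -addrA opprD addrA subrr sub0r normrN.
  apply: le_lt_trans (ler_normD _ _) _; rewrite !normrZ !ger0_norm//.
  apply: (@le_lt_trans _ _ (t * M)).
    rewrite /M !mulrDr mulr1 ler_wpDr ?(ltW t0)//.
    by rewrite lerD// ler_wpM2r.
  have M10 : 0 < M + 1 by rewrite addr_gt0.
  rewrite /t mulrAC ltr_pdivrMr //.
  by rewrite ltr_pM2l ?ltrDl.
have [c [d [ct dt E1]]] := second_difference i j x sg (ltW t0).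
have [c' [d' [ct' dt' E2]]] := second_difference j i x sg (ltW t0).
have E : partial j (partial i g) (x + c *: ei + d *: ej) =
         partial i (partial j g) (x + c' *: ej + d' *: ei).
  have tt : t * t != 0 by rewrite mulf_neq0// gt_eqF.
  apply: (mulIf tt); apply: etrans (esym E1) _; apply: etrans _ E2.
  rewrite -/ei -/ej [x + t *: ei + t *: ej]addrAC.
  by rewrite -!addrA; congr (_ + _); rewrite !opprD !opprK addrCA.
have n2 := near_x _ _ ct dt.
have n1 := near_x _ _ dt' ct'.
have h2 : `|partial j (partial i g) x
    - partial j (partial i g) (x + c *: ei + d *: ej)| < e / 2.
  by apply: H2; rewrite -ball_normE; exact: lt_le_trans n2 md2.
have h1 : `|partial i (partial j g) x
    - partial i (partial j g) (x + c' *: ej + d' *: ei)| < e / 2.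
  by apply: H1; rewrite -ball_normE /=; rewrite addrAC; exact: lt_le_trans n1 md1.
move: h1 h2; rewrite E.
move: (partial i (partial j g) _) (partial i (partial j g) _) (partial j (partial i g) _) => a b c0.
rewrite !ltr_norml ler_norml => /andP[h1 h2] /andP[h3 h4].
clear -h1 h2 h3 h4.
by apply/andP; split; lra.
Qed.

End calculus.

Section rays.
Context {R : realType} {n : nat}.
Implicit Types (g h : 'rV[R]_n -> R).

Lemma MVT_line0 g i x (b : R) : smooth g ->
  exists2 c, `|c| <= `|b| &
    g (x + b *: delta_mx ord0 i) - g x = partial i g (x + c *: delta_mx ord0 i) * b.
Proof.
move=> sg; have [b0|b0] := leP 0 b.
  have [c /andP[c0 cb]] := MVT_line i x sg b0.
  by rewrite scale0r addr0 subr0 => E; exists c => //; rewrite !ger0_norm.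
have [c /andP[bc c0]] := MVT_line i x sg (ltW b0).
rewrite scale0r addr0 sub0r mulrN => E; exists c.
  by rewrite (ler0_norm c0) (ltr0_norm b0) lerN2.
by rewrite -[LHS]opprB E opprK.
Qed.

(** By the mean value theorem the increment in the direction [i], taken at a moving base point,
is a value of [partial i g] near [y], which is close to the value at [y]. *)
Lemma is_derive_add_coord g i (a : R) (v y : 'rV[R]_n) (d : R) : smooth g ->
  is_derive y v g d ->
  is_derive y (a *: delta_mx ord0 i + v) g (a * partial i g y + d).
Proof.
move=> sg [dg <-]; set ei : 'rV[R]_n := delta_mx ord0 i; set w := a *: ei + v.
suff C : (h^-1 *: ((g \o shift y) (h *: w) - g y)) @[h --> (0:R)^'] -->
    a * partial i g y + 'D_v g y.
  by split; [apply/cvg_ex; exists (a * partial i g y + 'D_v g y); exact: C|exact: cvg_lim C].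
have E : (fun h : R => h^-1 *: ((g \o shift y) (h *: w) - g y)) =
  (fun h : R => h^-1 * (g ((y + h *: v) + (h * a) *: ei) - g (y + h *: v)))
   \+ (fun h : R => h^-1 *: ((g \o shift y) (h *: v) - g y)).
  apply/funext => h /=; rewrite -[_ *: (g _ - g y)]/(_ * _) -mulrDr addrA.
  rewrite [h *: v + y]addrC subrK; congr (_ * (g _ - _)).
  by rewrite /w scalerDr scalerA addrC -[RHS]addrA; congr (_ + _); rewrite addrC.
rewrite E; apply: (@cvgD _ R^o); last exact: dg.
apply/cvgrPdist_le => e e0.
pose e' := e / (`|a| + 1).
have a0 : 0 < `|a| + 1 by rewrite ltr_wpDl.
have e'0 : 0 < e' by rewrite divr_gt0.
have cg := smooth_continuous (smooth_partial i sg); have := cg y.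
move/cvgrPdist_lt => /(_ _ e'0) /nbhs_ballP[dl /= dl0 H].
pose M := `|v| + `|a| * `|ei| + 1.
have M0 : 0 < M by rewrite ltr_wpDl// addr_ge0// mulr_ge0.
exists (dl / M); first by rewrite /= divr_gt0.
move=> h; rewrite /ball_ /= sub0r normrN => hd h0.
have [c cb ->] := MVT_line0 i (y + h *: v) (h * a) sg.
have P : `|partial i g y - partial i g (y + h *: v + c *: ei)| < e'.
  apply: H; rewrite -ball_normE /= -addrA opprD addrA subrr sub0r normrN.
  apply: le_lt_trans (ler_normD _ _) _; rewrite !normrZ.
  apply: (@le_lt_trans _ _ (`|h| * M)).
    rewrite /M !mulrDr mulr1 -addrA lerD2l.
    apply: ler_wpDr => //; rewrite mulrA -normrM; exact: ler_wpM2r.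
  by rewrite -ltr_pdivlMr.
rewrite -/ei; move: P; move: (partial i g (_ + _)) (partial i g y) => q p P.
have -> : h^-1 * (q * (h * a)) = q * a by rewrite mulrCA mulKf.
rewrite [a * p]mulrC -mulrBl normrM.
apply: (@le_trans _ _ (e' * (`|a| + 1))); last by rewrite /e' divfK// gt_eqF.
by apply: ler_pM => //; [exact: ltW|rewrite lerDl].
Qed.

(** Only the partial derivatives are assumed to be continuous, so the chain rule is obtained by
adding one coordinate of the direction at a time. *)
Lemma derive_smooth g (x z : 'rV[R]_n) : smooth g ->
  is_derive x z g (\sum_i z ord0 i * partial i g x).
Proof.
move=> sg; rewrite [X in is_derive _ X](row_sum_delta z).
elim: (index_enum _) => [|i l IH].
  rewrite !big_nil.
  have E0 : (fun h : R => h^-1 *: ((g \o shift x) (h *: (0 : 'rV[R]_n)) - g x)) = cst 0.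
    by apply/funext => h /=; rewrite scaler0 add0r subrr scaler0.
  split; rewrite /derivable /derive E0; [exact: is_cvg_cst|exact: lim_cst].
by rewrite !big_cons; exact: is_derive_add_coord.
Qed.

Lemma is_derive_ray g (x z : 'rV[R]_n) (r : R) : smooth g ->
  is_derive r (1 : R) (fun r => g (x + r *: z))
    (\sum_i z ord0 i * partial i g (x + r *: z)).
Proof.
move=> sg; have [dg dE] := derive_smooth (x + r *: z) z sg.
by rewrite -dE; exact: derivable_line.
Qed.

End rays.

(** * Uniform limits of smooth functions *)

Section uniform_limits.
Context {R : realType} {n : nat}.
Implicit Types (g h : 'rV[R]_n -> R) (F : nat -> 'rV[R]_n -> R).

Definition unif_lim F g := forall e : R, 0 < e ->
  exists N, forall k x, (N <= k)%N -> `|F k x - g x| <= e.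

Lemma unif_lim_continuous F g : unif_lim F g -> (forall k, continuous (F k)) ->
  continuous g.
Proof.
move=> Fg cF x; apply/(@cvgrPdist_lt R R^o _ (nbhs x)) => e e0.
have e40 : 0 < e / 4 by rewrite divr_gt0.
have [N FN] := Fg _ e40.
have := cF N x; move/cvgrPdist_lt => /(_ _ e40).
apply: filterS => y /=.
have := FN N x (leqnn N); have := FN N y (leqnn N).
move: (F N x) (F N y) (g x) (g y) => a b c d; clear -e0.
rewrite !ler_norml !ltr_norml => /andP[? ?] /andP[? ?] /andP[? ?].
by apply/andP; split; lra.
Qed.

(** The mean value theorem bounds the difference quotients of the functions of the sequence by
values of their derivatives nearby, uniformly in the index. *)
Lemma unif_lim_derive F (g h : 'rV[R]_n -> R) i : (forall k, smooth (F k)) ->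
  unif_lim F g -> unif_lim (fun k => partial i (F k)) h ->
  forall x, is_derive x (delta_mx ord0 i) g (h x).
Proof.
move=> sF Fg Fh x; set ei : 'rV[R]_n := delta_mx ord0 i.
have ch : continuous h.
  by apply: (unif_lim_continuous Fh) => k; exact: smooth_continuous (smooth_partial i (sF k)).
suff C : (t^-1 *: ((g \o shift x) (t *: ei) - g x)) @[t --> (0:R)^'] --> h x.
  by split; [apply/cvg_ex; exists (h x); exact: C|exact: cvg_lim C].
apply/cvgrPdist_le => e e0.
have e20 : 0 < e / 2 by rewrite divr_gt0.
have := ch x; move/cvgrPdist_lt => /(_ _ e20) /nbhs_ballP[dl /= dl0 H].
exists (dl / (`|ei| + 1)); first by rewrite /= divr_gt0// ltr_wpDl.
move=> t; rewrite /ball_ /= sub0r normrN => td t0.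
have tN : 0 < `|t| by rewrite normr_gt0.
have Q : forall d : R, 0 < d -> `|g (x + t *: ei) - g x - t * h x| <= `|t| * e + d.
  move=> d d0.
  have d30 : 0 < d / 3 by rewrite divr_gt0.
  have [N1 FN1] := Fg _ d30; have [N2 FN2] := Fh _ e20.
  pose N := maxn N1 N2.
  have [c ct E] := MVT_line0 i x t (sF N).
  have A1 := FN1 N (x + t *: ei) (leq_maxl _ _).
  have A2 := FN1 N x (leq_maxl _ _).
  have A3 := FN2 N (x + c *: ei) (leq_maxr _ _).
  have A4 : `|h x - h (x + c *: ei)| < e / 2.
    apply: H; rewrite -ball_normE /= opprD addrA subrr sub0r normrN normrZ.
    apply: (@le_lt_trans _ _ (`|t| * (`|ei| + 1))).
      by apply: ler_pM => //; rewrite lerDl.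
    by rewrite -ltr_pdivlMr// ltr_wpDl.
  rewrite -/ei in E; move: E A1 A2 A3 A4.
  move: (F N (x + t *: ei)) (F N x) (partial i (F N) (x + c *: ei))
    (h (x + c *: ei)) (g (x + t *: ei)) (g x) (h x) => a b p q u v w.
  move=> E A1 A2 A3 A4.
  have -> : u - v - t * w = - (a - u) + (b - v) + t * ((p - q) - (w - q)).
    have -> : a = b + p * t by rewrite -E addrC subrK.
    by ring.
  apply: le_trans (ler_normD _ _) _.
  have B1 : `|- (a - u) + (b - v)| <= d.
    apply: le_trans (ler_normD _ _) _; rewrite normrN.
    by clear -A1 A2 d0; lra.
  rewrite addrC; apply: lerD => //; rewrite normrM ler_wpM2l//.
  apply: le_trans (ler_normB _ _) _.
  by clear -A3 A4; lra.
have {}Q : `|g (x + t *: ei) - g x - t * h x| <= `|t| * e.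
  by apply/ler_addgt0Pr => d d0; exact: Q.
rewrite /= [t *: ei + x]addrC -/(_ * _) -(ler_pM2l tN) -normrM mulrBr.
rewrite -[t^-1 *: _]/(t^-1 * _) mulVKf// distrC.
exact: Q.
Qed.

(** Termwise differentiation: it suffices that all the sequences of derivatives converge
uniformly. *)
Lemma unif_lim_smooth F (G : seq 'I_n -> 'rV[R]_n -> R) :
  (forall k, smooth (F k)) ->
  (forall s, unif_lim (fun k => partials s (F k)) (G s)) ->
  smooth (G [::]) /\ forall s, partials s (G [::]) = G s.
Proof.
move=> sF FG.
have dG s i x : is_derive x (delta_mx ord0 i) (G s) (G (i :: s) x).
  apply: (unif_lim_derive (fun k => smooth_partials s (sF k)) (FG s)).
  exact: FG (i :: s).
have pG s : partials s (G [::]) = G s.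
  elim: s => [//|i s IH] /=; rewrite IH; apply/funext => x; rewrite /partial.
  by have [_ ->] := dG s i x.
split => // s; rewrite pG; split.
  apply: (unif_lim_continuous (FG s)) => k.
  exact: smooth_continuous (smooth_partials s (sF k)).
by move=> i x; have [] := dG s i x.
Qed.

End uniform_limits.

(** * Differentiation and the operator 1 - Delta *)

Section laplacian.
Context {R : realType} {n : nat}.
Implicit Types (g h : 'rV[R]_n -> R).

(** In this form the operator is a linear combination, to which the lemmas on [partials] of sums
and multiples apply. *)
Lemma one_sub_laplacianE g : one_sub_laplacian g =
  (fun x => 1 * g x + (-1) * \sum_(i <- index_enum 'I_n) partial i (partial i g) x).
Proof. by apply/funext => x; rewrite mul1r mulN1r. Qed.

Lemma smooth_sum_partial2 g : smooth g ->
  smooth (fun x => \sum_(i <- index_enum 'I_n) partial i (partial i g) x).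
Proof.
by move=> sg; apply: smooth_sum => i; apply: smooth_partial; exact: smooth_partial.
Qed.

Lemma smooth_one_sub_laplacian g : smooth g -> smooth (one_sub_laplacian g).
Proof.
move=> sg; rewrite one_sub_laplacianE.
exact: smooth_lin sg (smoothZ _ (smooth_sum_partial2 sg)).
Qed.

Lemma smooth_iter_one_sub_laplacian m g : smooth g ->
  smooth (iter m one_sub_laplacian g).
Proof.
by move=> sg; elim: m => [|m IH]; [exact: sg|exact: smooth_one_sub_laplacian IH].
Qed.

Lemma partials_partial s i g : smooth g ->
  partials s (partial i g) = partial i (partials s g).
Proof.
move=> sg; elim: s => // j s IH.
by rewrite /= IH (partialC _ _ (smooth_partials s sg)).
Qed.

Lemma partials_one_sub_laplacian s g : smooth g ->
  partials s (one_sub_laplacian g) = one_sub_laplacian (partials s g).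
Proof.
move=> sg; rewrite [in LHS]one_sub_laplacianE.
rewrite (partials_lin _ _ sg (smoothZ (-1) (smooth_sum_partial2 sg))).
rewrite partialsZ; last exact: smooth_sum_partial2.
rewrite one_sub_laplacianE partials_sum; last first.
  by move=> i; apply: smooth_partial; exact: smooth_partial.
apply/funext => x; congr (_ + _ * _); apply: eq_bigr => i _.
by rewrite (partials_partial _ _ (smooth_partial i sg)) (partials_partial _ _ sg).
Qed.

Lemma one_sub_laplacian_lin (r : R) g h : smooth g -> smooth h ->
  one_sub_laplacian (fun x => r * g x + h x) =
  (fun x => r * one_sub_laplacian g x + one_sub_laplacian h x).
Proof.
move=> sg sh; rewrite !one_sub_laplacianE; apply/funext => x.
have E i : partial i (partial i (fun y => r * g y + h y)) x =
    r * partial i (partial i g) x + partial i (partial i h) x.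
  exact: (congr1 (fun f => f x) (partials_lin r [:: i; i] sg sh)).
apply: etrans (_ : 1 * (r * g x + h x) + -1 * (r * \sum_(i <- index_enum 'I_n)
  partial i (partial i g) x + \sum_(i <- index_enum 'I_n) partial i (partial i h) x) = _).
  congr (_ + -1 * _); apply: etrans (eq_bigr _ (fun i _ => E i)) _.
  by apply: etrans (big_split _ _ _ _ _) _; congr (_ + _); rewrite mulr_sumr.
have A (a b c d : R) :
    1 * (r * a + b) + -1 * (r * c + d) = r * (1 * a + -1 * c) + (1 * b + -1 * d) by ring.
exact: A.
Qed.

Lemma iter_one_sub_laplacian_lin m (r : R) g h : smooth g -> smooth h ->
  iter m one_sub_laplacian (fun x => r * g x + h x) =
  (fun x => r * iter m one_sub_laplacian g x + iter m one_sub_laplacian h x).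
Proof.
move=> sg sh; elim: m => [//|m IH]; rewrite iterS IH.
exact: one_sub_laplacian_lin (smooth_iter_one_sub_laplacian m sg)
  (smooth_iter_one_sub_laplacian m sh).
Qed.

(** Mixed derivatives depend on the multi-index only; this relates derivatives along words, which
are convenient for induction, to the multi-indices of the seminorms. *)
Lemma perm_partials s t g : smooth g -> perm_eq s t -> partials s g = partials t g.
Proof.
move=> sg; elim: s t => [|i s IH] t st.
  by move: st; rewrite perm_sym => /perm_nilP ->.
have it : i \in t by rewrite -(perm_mem st) inE eqxx.
case/path.splitPr: it st => t1 t2 st.
have E1 : perm_eq s (t1 ++ t2).
  by rewrite -(perm_cons i); apply: perm_trans st _; rewrite perm_catC /= perm_cons perm_catC.
rewrite /= (IH _ E1) /partials !foldr_cat -!/(partials _ _) /=.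
by rewrite -/(partials t1 _) (partials_partial t1 i (smooth_partials t2 sg)).
Qed.

End laplacian.

(** * Lebesgue measure on R^n: iterated integrals, translations, integrals of derivatives *)

Section measurability.
Context {R : realType}.

Lemma measurable_fun_rV n d (T : measurableType d) (f : T -> 'rV[R]_n) :
  (forall i, measurable_fun setT (fun t => f t ord0 i : measurableTypeR R)) ->
  measurable_fun setT f.
Proof.
move=> mf.
pose coord (i : 'I_n) (v : 'rV[R]_n) : measurableTypeR R := v ord0 i.
apply: (@measurability _ _ _ _ _ _ (\big[setU/set0]_(i < n)
  preimage_set_system setT (coord i) measurable)) => //.
move=> A; case=> B; rewrite -bigcup_seq => -[i _ [C mC <-]] <-.
by have := mf i measurableT C mC; rewrite !setTI.
Qed.

Lemma measurable_rVD n d (T : measurableType d) (f g : T -> 'rV[R]_n) :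
  measurable_fun setT f -> measurable_fun setT g ->
  measurable_fun setT (fun t => f t + g t).
Proof.
move=> mf mg; apply: measurable_fun_rV => i.
rewrite (_ : (fun _ => _) = (fun t => f t ord0 i + g t ord0 i)); last first.
  by apply/funext => t; rewrite mxE.
apply: measurable_funD; exact: measurableT_comp (measurable_coord i) _.
Qed.

Lemma measurable_rVZ n d (T : measurableType d) (a : T -> measurableTypeR R)
    (f : T -> 'rV[R]_n) :
  measurable_fun setT a -> measurable_fun setT f ->
  measurable_fun setT (fun t => a t *: f t).
Proof.
move=> ma mf; apply: measurable_fun_rV => i.
rewrite (_ : (fun _ => _) = (fun t => a t * f t ord0 i)); last first.
  by apply/funext => t; rewrite mxE.
apply: measurable_funM => //; exact: measurableT_comp (measurable_coord i) _.
Qed.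

End measurability.

Section lebesgue.
Context {R : realType}.

(** The cubes [-k, k]^n exhaust the space. *)
Lemma lebesgue_rV_sigma_finite n : sigma_finite setT (@lebesgue_rV R n).
Proof.
pose box k : set 'rV[R]_n := [set v | forall i, (`[- k%:R, k%:R]%classic : set R) (v ord0 i)].
exists box.
  apply/seteqP; split => // v _ /=.
  have [k kv] : exists k : nat, forall i, (`|v ord0 i| <= k%:R)%R.
    pose M := (\sum_i `|v ord0 i|)%R.
    exists (Num.truncn M).+1 => i; apply: (@le_trans _ _ M).
      by rewrite /M (bigD1 i)//= lerDl sumr_ge0.
    by apply: ltW; exact: truncnS_gt.
  by exists k => // i; rewrite /= in_itv /= -ler_norml.
move=> k; split.
  by apply: (@measurable_rV_box _ _ (fun=> `[- k%:R, k%:R]%classic : set R)).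
rewrite /box (@lebesgue_rV_box _ _ (fun=> `[- k%:R, k%:R]%classic : set R))//.
set I := (X in lebesgue_measure X); suff : (\prod_(i < n) lebesgue_measure I)%E \is a fin_num.
  by rewrite fin_numElt => /andP[].
elim/big_ind : _ => // [x y|i _]; first exact: fin_numM.
by rewrite /I lebesgue_measure_itv; case: ifP.
Qed.

End lebesgue.

Section sigma_finite_copy.
Context d (T : measurableType d) (R : realType) (m : {measure set T -> \bar R}).
Hypothesis sf : sigma_finite setT m.

Definition sigma_finite_copy of sigma_finite setT m : set T -> \bar R := m.

HB.instance Definition _ := isMeasure.Build _ _ _ (sigma_finite_copy sf)
  (measure0 m) (measure_ge0 m) (@measure_semi_sigma_additive _ _ _ m).
HB.instance Definition _ := @Measure_isSigmaFinite.Build _ _ _ (sigma_finite_copy sf) sf.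

Lemma sigma_finite_copyE : (sigma_finite_copy sf : {measure set T -> \bar R}) = m.
Proof. exact: eq_measure. Qed.

End sigma_finite_copy.

Section leb.
Context {R : realType}.

(** The Lebesgue measure of R^n, packaged as a sigma-finite measure so that the theorems of Fubini
and of Radon and Nikodym apply to it. *)
Definition leb n : {sigma_finite_measure set 'rV[R]_n -> \bar R} :=
  sigma_finite_copy (@lebesgue_rV_sigma_finite R n).

Lemma lebE n : (leb n : {measure set _ -> \bar R}) = @lebesgue_rV R n.
Proof. exact: sigma_finite_copyE. Qed.

Lemma integral_leb n (D : set 'rV[R]_n) f :
  (\int[leb n]_(x in D) f x = \int[lebesgue_rV n]_(x in D) f x)%E.
Proof. exact: eq_measure_integral. Qed.

End leb.

Section translation1.
Context {R : realType}.
Local Open Scope ereal_scope.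
Notation mu1 := (@lebesgue_measure R).

Lemma measurable_addr (s : R) :
  measurable_fun [set: measurableTypeR R] (fun t : measurableTypeR R => t + s : measurableTypeR R)%R.
Proof. by apply: measurable_funD => //; exact: measurable_cst. Qed.

Lemma lebesgue_measure_addr (s : R) (A : set (measurableTypeR R)) : measurable A ->
  mu1 A = mu1 ((fun t => t + s)%R @^-1` A).
Proof.
pose nu := measure_function_pushforward__canonical__measure_function_Measure mu1 (measurable_addr s).
move=> mA; apply: (@lebesgue_measure_unique R nu) => // X [[a b] /= _ <-].
rewrite /nu /= /pushforward.
rewrite (_ : _ @^-1` _ = [set` Interval (BRight (a - s)%R) (BRight (b - s)%R)]); last first.
  by apply/seteqP; split => t /=; rewrite !in_itv /= ltrBlDr lerBrDr.
rewrite !lebesgue_measure_itv /= !lte_fin ltrD2r; case: ifP => // _.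
by rewrite -!EFinD; congr (_%:E); ring.
Qed.

Lemma ge0_integral_addr (s : R) (f : R -> \bar R) :
  measurable_fun [set: measurableTypeR R] f -> (forall t, 0 <= f t) ->
  \int[mu1]_t f (t + s)%R = \int[mu1]_t f t.
Proof.
move=> mf f0; have := @ge0_integral_pushforward _ _ _ _ R _ (measurable_addr s) mu1 setT f.
move=> /(_ measurableT mf (fun t _ => f0 t)); rewrite preimage_setT => <-.
apply: eq_measure_integral; first exact: measurable_addr.
by move=> mphi A mA _; rewrite [RHS](lebesgue_measure_addr s mA).
Qed.

End translation1.

Section tonelli.
Context {R : realType}.
Local Open Scope ereal_scope.
Notation mu1 := (@lebesgue_measure R).

Lemma ge0_integral_rV_cons n (f : 'rV[R]_n.+1 -> \bar R) :
  measurable_fun setT f -> (forall x, 0 <= f x) ->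
  \int[leb n.+1]_x f x = \int[leb n]_x \int[mu1]_t f (rV_cons (x, t)).
Proof.
move=> mf f0.
have mfc := measurableT_comp mf (@measurable_rV_cons R n).
rewrite -(fubini_tonelli1 (f \o @rV_cons R n))//; last by move=> x /=.
have := @ge0_integral_pushforward _ _ _ _ R _ (@measurable_rV_cons R n)
  (leb n \x mu1) setT f measurableT mf (fun t _ => f0 t).
rewrite preimage_setT => <-; apply: eq_measure_integral; first exact: measurable_rV_cons.
move=> mphi A mA _.
by rewrite -[LHS]/((lebesgue_rV n \x mu1) (@rV_cons R n @^-1` A)) -lebE.
Qed.

Lemma ge0_integral_rV_cons_sym n (f : 'rV[R]_n.+1 -> \bar R) :
  measurable_fun setT f -> (forall x, 0 <= f x) ->
  \int[leb n.+1]_x f x = \int[mu1]_t \int[leb n]_x f (rV_cons (x, t)).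
Proof.
move=> mf f0; rewrite ge0_integral_rV_cons//.
have mfc := measurableT_comp mf (@measurable_rV_cons R n).
rewrite (fubini_tonelli (f \o @rV_cons R n))//.
by move=> x; exact: f0.
Qed.

Definition rV_behead n (v : 'rV[R]_n.+1) : 'rV[R]_n := \row_i v ord0 (lift ord0 i).

Lemma rV_consD n (x : 'rV[R]_n) (t : R) (v : 'rV[R]_n.+1) :
  (rV_cons (x, t) + v = rV_cons (x + rV_behead v, t + v ord0 ord0) :> 'rV[R]_n.+1)%R.
Proof.
apply/rowP => i; rewrite !mxE /=; case: unliftP => [j ->|->] //.
by rewrite !mxE.
Qed.

Lemma measurable_rV_shift n (v : 'rV[R]_n) : measurable_fun setT (fun x : 'rV[R]_n => x + v)%R.
Proof. by apply: measurable_rVD => //; exact: measurable_cst. Qed.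

(** By induction on the dimension, integrating the first coordinate out. *)
Lemma ge0_integral_shift n (v : 'rV[R]_n) (f : 'rV[R]_n -> \bar R) :
  measurable_fun setT f -> (forall x, 0 <= f x) ->
  \int[leb n]_x f (x + v)%R = \int[leb n]_x f x.
Proof.
elim: n v f => [|n IH] v f mf f0.
  by apply: eq_integral => x _; congr f; apply/rowP => -[].
have mfv := measurableT_comp mf (measurable_rV_shift v).
rewrite [LHS]ge0_integral_rV_cons//.
under eq_integral => x _ do under eq_integral => t _ do rewrite /= rV_consD.
apply: etrans _ (esym (ge0_integral_rV_cons mf f0)).
pose F (x : 'rV[R]_n) := \int[mu1]_t f (rV_cons (x, t)).
transitivity (\int[leb n]_x F (x + rV_behead v)%R).
  apply: eq_integral => x _.
  apply: (ge0_integral_addr (v ord0 ord0) (f := fun t => f (rV_cons ((x + rV_behead v)%R, t)))) => //.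
  apply: measurableT_comp mf _; apply: measurableT_comp (@measurable_rV_cons R n) _.
  exact: pair1_measurable.
have mfc := measurableT_comp mf (@measurable_rV_cons R n).
apply: IH; last by move=> x; apply: integral_ge0.
by apply: (measurable_fun_fubini_tonelli_F (f \o @rV_cons R n)) => // x; exact: f0.
Qed.

End tonelli.

Section bounded_interval.
Context {R : realType}.
Local Open Scope ereal_scope.
Notation mu1 := (@lebesgue_measure R).

Lemma continuous_measurable (G : R -> R) : continuous G ->
  measurable_fun [set: measurableTypeR R] (G : measurableTypeR R -> measurableTypeR R).
Proof. exact: continuous_measurable_fun. Qed.

Lemma integral_derive_itv (G G' : R -> R) (a b : R) : (a < b)%R ->
  (forall s, is_derive s (1%R : R) G (G' s)) -> continuous G' ->
  \int[mu1]_(s in `[a, b]) (G' s)%:E = (G b - G a)%:E.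
Proof.
move=> ab dG cG'; rewrite EFinB.
have cG : continuous G.
  by move=> s; apply/differentiable_continuous/derivable1_diffP; have [] := dG s.
apply: continuous_FTC2 => //.
- exact: continuous_subspaceT.
- split; [by move=> s _; have [] := dG s|exact/cvg_at_right_filter/cG|].
  exact/cvg_at_left_filter/cG.
- by move=> s _; rewrite derive1E; have [_ ->] := dG s.
Qed.

(** Integrability of [f] on the strip is a uniform bound on the integrals of its slices. *)
Lemma Fubini_itv d (T : measurableType d) (mu : {sigma_finite_measure set T -> \bar R})
    (f : T * measurableTypeR R -> R) (a b M : R) : (a <= b)%R -> measurable_fun setT f ->
  (forall s, (a <= s <= b)%R -> \int[mu]_z `|f (z, s)|%:E <= M%:E) ->
  \int[mu]_z \int[mu1]_(s in `[a, b]) (f (z, s))%:E =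
  \int[mu1]_(s in `[a, b]) \int[mu]_z (f (z, s))%:E.
Proof.
move=> ab mf fM.
pose D : set (measurableTypeR R) := `[a, b]%classic.
have mD : measurable D by exact: measurable_itv.
pose g (zs : T * measurableTypeR R) : \bar R := (f zs * \1_D zs.2)%:E.
have mg : measurable_fun setT g.
  apply/measurable_EFinP; apply: measurable_funM => //.
  exact: measurableT_comp (measurable_indic _) measurable_snd.
have gE z s : g (z, s) = ((fun s => (f (z, s))%:E) \_ D) s.
  by rewrite epatch_indic /= /g EFinM.
have ig : (mu \x mu1).-integrable setT g.
  apply/integrable21ltyP => //.
  apply: (@le_lt_trans _ _ (\int[mu1]_s (((cst M%:E) \_ D) s))).
    apply: ge0_le_integral => //.
    - by move=> s _; exact: integral_ge0.
    - apply: (measurable_fun_fubini_tonelli_G (abse \o g)) => //=.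
      exact: measurableT_comp.
    - by apply/(measurable_restrictT _ mD); exact: measurable_cst.
    - move=> s _; rewrite patchE; case: ifPn => sD.
        rewrite (eq_integral (fun z => `|f (z, s)|%:E)); last first.
          by move=> z _; rewrite gE patchE sD.
        by apply: fM; move: sD; rewrite inE /D /= in_itv.
      rewrite integral0_eq// => z _.
      by rewrite gE patchE (negbTE sD) abse0.
  have muD : mu1 D \is a fin_num.
    by rewrite (@lebesgue_measure_itv R (Interval (BLeft a) (BRight b))); case: ifP.
  have -> : \int[mu1]_s ((cst M%:E) \_ D) s = M%:E * mu1 D.
    by rewrite -integral_mkcond integral_cst.
  by rewrite -(fineK muD) -EFinM ltry.
transitivity (\int[mu]_z \int[mu1]_s g (z, s)).
  apply: eq_integral => z _; rewrite [LHS]integral_mkcond.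
  by apply: eq_integral => s _; rewrite gE.
rewrite (Fubini ig) [RHS]integral_mkcond; apply: eq_integral => s _.
rewrite patchE; case: ifPn => sD.
  by apply: eq_integral => z _; rewrite gE patchE sD.
by rewrite integral0_eq// => z _; rewrite gE patchE (negbTE sD).
Qed.

End bounded_interval.

Section integral_partial.
Context {R : realType} {n : nat}.
Local Open Scope ereal_scope.
Notation mu1 := (@lebesgue_measure R).
Notation mu := (leb n).

Lemma integral_shift (v : 'rV[R]_n) (f : 'rV[R]_n -> \bar R) : measurable_fun setT f ->
  \int[mu]_x f (x + v)%R = \int[mu]_x f x.
Proof.
move=> mf; rewrite integralE [RHS]integralE; congr (_ - _).
  apply: etrans _ (ge0_integral_shift v (measurable_funepos mf) (funepos_ge0 f)).
  by apply: eq_integral => x _; rewrite !funeposE.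
apply: etrans _ (ge0_integral_shift v (measurable_funeneg mf) (funeneg_ge0 f)).
by apply: eq_integral => x _; rewrite !funenegE.
Qed.

Lemma integrable_shift (v : 'rV[R]_n) (f : 'rV[R]_n -> \bar R) : mu.-integrable setT f ->
  mu.-integrable setT (fun x => f (x + v)%R).
Proof.
move=> /integrableP[mf fi]; apply/integrableP; split.
  exact: measurableT_comp mf (measurable_rV_shift v).
rewrite (ge0_integral_shift v (f := fun x => `|f x|))//.
exact: measurableT_comp.
Qed.

(** By translation invariance, F(. + e_i) - F has integral zero; it is also the mean of the
translates of the derivative, which all have the same integral. *)
Lemma integral_partial_eq0 (F F' : 'rV[R]_n -> R) (i : 'I_n) :
  (forall z (s : R), is_derive s (1%R : R) (fun s : R => F (z + s *: delta_mx ord0 i)%R)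
     (F' (z + s *: delta_mx ord0 i)%R)) ->
  (forall z, continuous (fun s : R => F' (z + s *: delta_mx ord0 i)%R)) ->
  mu.-integrable setT (EFin \o F) -> mu.-integrable setT (EFin \o F') ->
  \int[mu]_z (F' z)%:E = 0.
Proof.
move=> dF cF' iF iF'; set ei : 'rV[R]_n := delta_mx ord0 i.
have mF' : measurable_fun setT F'.
  by apply/measurable_EFinP; exact: measurable_int iF'.
have fin : \int[mu]_z (F' z)%:E \is a fin_num by exact: integrable_fin_num iF'.
(* The inner integral is F (z + e_i) - F z. *)
have E1 : \int[mu]_z \int[mu1]_(s in `[0%R, 1%R]) (F' (z + s *: ei)%R)%:E = 0.
  under eq_integral => z _.
    rewrite (integral_derive_itv _ (fun s => dF z s) (cF' z)) ?ltr01//.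
    rewrite scale1r scale0r addr0 EFinB.
    over.
  rewrite integralB//; last exact: (integrable_shift ei iF).
  rewrite (integral_shift ei (f := EFin \o F)); last exact: measurable_int iF.
  by rewrite subee//; exact: integrable_fin_num iF.
pose M := fine (\int[mu]_z `|F' z|%:E).
have iFM : \int[mu]_z `|F' z|%:E = M%:E.
  rewrite fineK//; have /integrable_fin_num := integrable_abse iF'.
  exact.
rewrite (Fubini_itv (f := fun zs : 'rV[R]_n * measurableTypeR R => F' (zs.1 + (zs.2 : R) *: ei)%R) (M := M)) ?ler01// in E1.
- rewrite -E1.
  under [in RHS]eq_integral => s _ do
    rewrite (integral_shift (s *: ei)%R (f := EFin \o F') (measurable_int _ iF')).
  rewrite -(fineK fin) /= integral_cst//.
  rewrite -[LHS]mule1; congr (_ * _).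
  rewrite -[RHS]/(@lebesgue_measure R [set` Interval (BLeft 0%R) (BRight 1%R)]).
  by rewrite lebesgue_measure_itv /= lte_fin ltr01 oppr0 adde0.
- apply: measurableT_comp mF' _; apply: measurable_rVD; first exact: measurable_fst.
  by apply: measurable_rVZ; [exact: measurable_snd|exact: measurable_cst].
- move=> s _; rewrite -iFM /=.
  rewrite (ge0_integral_shift (s *: ei)%R (f := fun x => `|F' x|%:E))//.
  by apply/measurable_EFinP; exact: measurableT_comp.
Qed.

End integral_partial.

Section product_weight.
Context {R : realType}.
Local Open Scope ereal_scope.
Notation mu1 := (@lebesgue_measure R).

Definition prodw (k : R -> R) n (z : 'rV[R]_n) : R := (\prod_(i < n) k (z ord0 i))%R.

Lemma measurable_prodw (k : R -> R) n :
  measurable_fun [set: measurableTypeR R] (k : measurableTypeR R -> measurableTypeR R) ->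
  measurable_fun setT (@prodw k n).
Proof.
move=> mk; apply: measurable_prod => i _.
exact: (measurableT_comp mk (measurable_coord i)).
Qed.

Lemma prodw_ge0 (k : R -> R) n (z : 'rV[R]_n) : (forall t, 0 <= k t)%R -> (0 <= prodw k z)%R.
Proof. by move=> k0; exact: prodr_ge0. Qed.

Lemma integral_prodw (k : R -> R) (I : R) n : 
  measurable_fun [set: measurableTypeR R] (k : measurableTypeR R -> measurableTypeR R) ->
  (forall t, 0 <= k t)%R -> \int[mu1]_t (k t)%:E = I%:E ->
  \int[leb n]_z (prodw k z)%:E = (I ^+ n)%:E.
Proof.
move=> mk k0 kI; elim: n => [|n IH].
  rewrite integral_leb integral_dirac//=.
    by rewrite diracT mul1e /prodw big_ord0.
  by apply/measurable_EFinP; exact: measurable_prodw.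
rewrite ge0_integral_rV_cons//; last 2 first.
  by apply/measurable_EFinP; exact: measurable_prodw.
  by move=> x; rewrite lee_fin prodw_ge0.
have mp : measurable_fun setT (fun x => (@prodw k n x)%:E).
  by apply/measurable_EFinP; exact: measurable_prodw.
under eq_integral => x _.
  under eq_integral => t _.
    rewrite /prodw big_ord_recl mxE unlift_none /=.
    under eq_bigr => i _ do rewrite mxE liftK /=.
    rewrite -/(prodw k x) mulrC EFinM.
    over.
  rewrite ge0_integralZl//; last 3 first.
  - exact/measurable_EFinP.
  - by move=> t _; rewrite lee_fin.
  - by rewrite lee_fin prodw_ge0.
  rewrite kI muleC.
  over.
rewrite ge0_integralZl//; last 2 first.
- by move=> x _; rewrite lee_fin prodw_ge0.
- by rewrite -kI; apply: integral_ge0 => t _; rewrite lee_fin.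
by rewrite IH -EFinM exprS.
Qed.

End product_weight.

(** * Weighted means of translates in L^r *)

Section weighted_means.
Context {R : realType}.
Local Open Scope ereal_scope.

Lemma measurable_powRl d (T : measurableType d) (f : T -> R) (r : R) :
  measurable_fun setT f -> measurable_fun setT (fun x => f x `^ r)%R.
Proof. by move=> mf; apply: (@measurableT_comp _ _ _ _ _ _ (@powR R ^~ r)). Qed.

Lemma in_itv0y (x : \bar R) : 0 <= x -> x \in `[0, +oo%E].
Proof. by move=> x0; rewrite in_itv /= x0 leey. Qed.

(** Hoelder's inequality applied to k^(1/q) and k^(1/r) t, where q is conjugate to r. *)
Lemma jensen_powR d (T : measurableType d) (mu : {measure set T -> \bar R})
    (k t : T -> R) (r c G : R) : (1 <= r)%R ->
  measurable_fun setT k -> measurable_fun setT t ->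
  (forall y, 0 <= k y)%R -> (forall y, 0 <= t y)%R -> (0 <= c)%R ->
  \int[mu]_y (k y)%:E = c%:E -> (0 <= G)%R ->
  G%:E <= \int[mu]_y (k y * t y)%:E ->
  (G `^ r)%:E <= (c `^ (r - 1))%:E * \int[mu]_y (k y * t y `^ r)%:E.
Proof.
move=> r1 mk mt k0 t0 c0 kc G0 Gle; have r0 : (0 < r)%R by exact: lt_le_trans r1.
move: r1; rewrite le_eqVlt => /predU1P[r1|r1].
  rewrite -r1 subrr powRr0 mul1e powRr1//.
  by under eq_integral do rewrite powRr1//.
pose q := (r / (r - 1))%R.
have r10 : (0 < r - 1)%R by rewrite subr_gt0.
have q0 : (0 < q)%R by rewrite divr_gt0.
have qi : (q^-1 = (r - 1) / r)%R by rewrite /q invf_div.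
have pq : (q^-1 + r^-1 = 1)%R by rewrite qi -{2}[r^-1%R]mul1r -mulrDl subrK divff// gt_eqF.
have kp y : (k y = k y `^ q^-1 * k y `^ r^-1)%R.
  rewrite -powRD; last by rewrite pq oner_eq0.
  by rewrite pq powRr1.
have := @hoelder _ _ _ mu (fun y => k y `^ q^-1)%R (fun y => k y `^ r^-1 * t y)%R q r
  (measurable_powRl _ mk) (measurable_funM (measurable_powRl _ mk) mt) q0 r0 pq.
rewrite Lnorm1.
rewrite [X in X <= _](_ : _ = \int[mu]_y (k y * t y)%:E); last first.
  apply: eq_integral => y _ /=.
  by rewrite mulrA -kp ger0_norm// mulr_ge0.
rewrite unlock.
rewrite [X in _ <= X `^ _ * _](_ : _ = c%:E); last first.
  rewrite -kc; apply: eq_integral => y _ /=.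
  by rewrite ger0_norm ?powR_ge0// -powRrM mulVf ?gt_eqF// powRr1.
set B := \int[mu]_y (k y * t y `^ r)%:E.
rewrite [X in _ <= _ * X `^ _](_ : _ = B); last first.
  apply: eq_integral => y _ /=.
  rewrite ger0_norm ?mulr_ge0 ?powR_ge0// powRM ?powR_ge0//.
  by rewrite -powRrM mulVf ?gt_eqF// powRr1.
have B0 : 0 <= B by apply: integral_ge0 => y _; rewrite lee_fin mulr_ge0// powR_ge0.
move=> H; have {}H := le_trans Gle H.
have /(_ (in_itv0y _) (in_itv0y _) H) := @gt0_ler_poweR _ r (ltW r0) G%:E (c%:E `^ q^-1 * B `^ r^-1).
rewrite lee_fin => /(_ G0); rewrite mule_ge0 ?poweR_ge0// => /(_ isT).
rewrite poweRM ?poweR_ge0// -!poweRrM mulVf ?gt_eqF// poweRe1//.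
by rewrite qi divfK ?gt_eqF// !poweR_EFin.
Qed.

(** Jensen's inequality at each point, then integration in x, under which all the translates of h
contribute the same. *)
Lemma translates_mean_powR n m (k : 'rV[R]_m -> R) (v : 'rV[R]_m -> 'rV[R]_n)
    (h G : 'rV[R]_n -> R) (r c : R) : (1 <= r)%R ->
  measurable_fun setT k -> measurable_fun setT v -> measurable_fun setT h ->
  measurable_fun setT G -> (forall y, 0 <= k y)%R -> (0 < c)%R ->
  \int[leb m]_y (k y)%:E = c%:E ->
  (forall x, `|G x|%:E <= \int[leb m]_y (k y * `|h (x + v y)|)%:E) ->
  \int[leb n]_x (`|G x| `^ r)%:E <= (c `^ r)%:E * \int[leb n]_x (`|h x| `^ r)%:E.
Proof.
move=> r1 mk mv mh mG k0 c0 kc HG.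
have mhr : measurable_fun setT (fun x => (`|h x| `^ r)%:E).
  by apply/measurable_EFinP; apply: measurable_powRl; exact: measurableT_comp.
have hv0 x y : 0 <= (k y * `|h (x + v y)| `^ r)%:E by rewrite lee_fin mulr_ge0// powR_ge0.
pose F (xy : 'rV[R]_n * 'rV[R]_m) := (k xy.2 * `|h (xy.1 + v xy.2)| `^ r)%:E.
have mF : measurable_fun setT F.
  apply/measurable_EFinP; apply: measurable_funM.
    exact: measurableT_comp mk measurable_snd.
  apply: measurable_powRl; apply: measurableT_comp => //.
  apply: (measurableT_comp mh); apply: measurable_rVD; first exact: measurable_fst.
  exact: measurableT_comp mv measurable_snd.
have F0 xy : 0 <= F xy by exact: hv0.
pose A := \int[leb n]_x \int[leb m]_y F (x, y).
have cA : (c `^ (r - 1))%:E * A = (c `^ r)%:E * \int[leb n]_x (`|h x| `^ r)%:E.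
  have -> : A = c%:E * \int[leb n]_x (`|h x| `^ r)%:E.
    rewrite /A (fubini_tonelli F mF F0).
    under eq_integral => y _.
      rewrite /F /=; under eq_integral do rewrite EFinM.
      rewrite ge0_integralZl//; last 2 first.
      - exact: measurableT_comp mhr (measurable_rV_shift (v y)).
      - by rewrite lee_fin.
      rewrite (ge0_integral_shift (v y) mhr); last by move=> x; rewrite lee_fin powR_ge0.
      over.
    rewrite ge0_integralZr//; last 3 first.
    - exact/measurable_EFinP.
    - by move=> y _; rewrite lee_fin.
    - by apply: integral_ge0 => x _; rewrite lee_fin powR_ge0.
    by rewrite kc.
  rewrite muleA -EFinM; congr (_%:E * _).
  by rewrite -{2}(powRr1 (ltW c0)) -powRD ?subrK// (gt_eqF c0) implybT.
rewrite -cA -ge0_integralZl//; last 3 first.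
- exact: (measurable_fun_fubini_tonelli_F F mF F0).
- by move=> x _; exact: integral_ge0.
- by rewrite lee_fin powR_ge0.
apply: ge0_le_integral => //.
- by apply/measurable_EFinP; apply: measurable_powRl; exact: measurableT_comp.
- by apply: measurable_funeM; exact: (measurable_fun_fubini_tonelli_F F mF F0).
move=> x _; apply: jensen_powR => //; last 1 first.
- exact: ltW.
apply: measurableT_comp => //; apply: (measurableT_comp mh).
by apply: measurable_rVD => //; exact: measurable_cst.
Qed.

End weighted_means.

(** * The Gaussian formula for the resolvent of the Laplacian *)

Section gaussian_weights.
Context {R : realType}.
Local Open Scope ereal_scope.
Notation mu1 := (@lebesgue_measure R).

(** The weight has the factor 2 so that [gauss_fun] dominates both the weight and its product with
the variable; the same dominating weight then serves for [g] and for its gradient. *)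
Definition gauss2 (t : R) : R := expR (- (2 * t ^+ 2))%R.

Lemma gauss2_ge0 t : (0 <= gauss2 t)%R. Proof. exact: expR_ge0. Qed.

Lemma is_derive_gauss2 (t : R) : is_derive t (1%R : R) gauss2 (- (4 * t) * gauss2 t)%R.
Proof.
rewrite /gauss2; apply: is_derive_eq.
by rewrite /GRing.scale /= !mulr1; ring.
Qed.

Lemma continuous_gauss2 : continuous gauss2.
Proof.
by move=> t; apply/differentiable_continuous/derivable1_diffP; have [] := is_derive_gauss2 t.
Qed.

Lemma gauss2_le (t : R) : (gauss2 t <= gauss_fun t)%R.
Proof. by rewrite ler_expR lerN2 ler_peMl ?sqr_ge0// ler1n. Qed.

Lemma gauss2M_le (t : R) : (`|t| * gauss2 t <= gauss_fun t)%R.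
Proof.
have -> : gauss_fun t = (expR (t ^+ 2) * gauss2 t)%R.
  by rewrite /gauss_fun /gauss2 -expRD; congr expR; ring.
rewrite ler_wpM2r ?gauss2_ge0//; apply: le_trans (expR_ge1Dx _).
rewrite -real_normK ?num_real//; have := sqr_ge0 (`|t| - 1)%R; move: `|t|%R => s.
by have := sqr_ge0 s; nra.
Qed.

Lemma integral_prodw_gauss n :
  \int[leb n]_z (prodw (@gauss_fun R) z)%:E = (Num.sqrt pi ^+ n)%:E.
Proof.
apply: integral_prodw; [exact: measurable_gauss_fun|exact: gauss_fun_ge0|].
exact: integralT_gauss.
Qed.

Lemma prodw_le (k1 k2 : R -> R) n (z : 'rV[R]_n) : (forall t, 0 <= k1 t <= k2 t)%R ->
  (prodw k1 z <= prodw k2 z)%R.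
Proof. by move=> k12; apply: ler_prod => i _. Qed.

Lemma prodw_gauss2_le n (z : 'rV[R]_n) :
  (prodw gauss2 z <= prodw (@gauss_fun R) z)%R.
Proof. by apply: prodw_le => t; rewrite gauss2_ge0 gauss2_le. Qed.

Lemma prodw_gauss2M_le n (z : 'rV[R]_n) i :
  (`|z ord0 i| * prodw gauss2 z <= prodw (@gauss_fun R) z)%R.
Proof.
rewrite /prodw (bigD1 i)//= [leRHS](bigD1 i)//= mulrA.
apply: ler_pM; rewrite ?mulr_ge0 ?gauss2_ge0 ?gauss2M_le//.
  by apply: prodr_ge0 => j _; exact: gauss2_ge0.
by apply: ler_prod => j _; rewrite gauss2_ge0 gauss2_le.
Qed.

Lemma is_derive_prodw_gauss2 n (z : 'rV[R]_n) i (s : R) :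
  is_derive s (1%R : R) (fun s => prodw gauss2 (z + s *: delta_mx ord0 i)%R)
   (- (4 * (z + s *: delta_mx ord0 i)%R ord0 i) *
     prodw gauss2 (z + s *: delta_mx ord0 i))%R.
Proof.
pose c := (\prod_(j < n | j != i) gauss2 (z ord0 j))%R.
have E (t : R) : prodw gauss2 (z + t *: delta_mx ord0 i)%R = (gauss2 (z ord0 i + t) * c)%R.
  rewrite /prodw (bigD1 i)//= !mxE !eqxx mulr1; congr (_ * _)%R.
  by apply: eq_bigr => j ji; rewrite !mxE (negbTE ji) andbF mulr0 addr0.
rewrite E (_ : (fun _ => _) = (fun t => gauss2 (z ord0 i + t) * c)%R); last exact/funext.
rewrite /gauss2; apply: is_derive_eq.
rewrite !mxE !eqxx /GRing.scale /= !mulr1.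
by ring.
Qed.

End gaussian_weights.

Section gaussian_formula.
Context {R : realType}.
Local Open Scope ereal_scope.
Notation mu1 := (@lebesgue_measure R).
Notation gw := (prodw (@gauss2 R)).
Notation hw := (prodw (@gauss_fun R)).

(** Borel measurability for the product sigma-algebra is carried along with smoothness instead
of being derived from continuity. *)
Record msmooth n (g : 'rV[R]_n -> R) : Prop := MSmooth {
  msmooth_smooth : smooth g ;
  msmooth_measurable : forall s, measurable_fun setT (partials s g) }.

Lemma msmooth_meas n (g : 'rV[R]_n -> R) : msmooth g -> measurable_fun setT g.
Proof. by move=> /msmooth_measurable/(_ [::]). Qed.

Lemma partials_partials n s t (g : 'rV[R]_n -> R) :
  partials s (partials t g) = partials (s ++ t) g.
Proof. by rewrite /partials foldr_cat. Qed.

Lemma msmooth_partial n i (g : 'rV[R]_n -> R) : msmooth g -> msmooth (partial i g).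
Proof.
move=> [sg mg]; split; first exact: smooth_partial.
by move=> s; rewrite -[partial i g]/(partials [:: i] g) partials_partials.
Qed.

Lemma measurable_gauss2 : measurable_fun [set: measurableTypeR R]
  (gauss2 : measurableTypeR R -> measurableTypeR R).
Proof. exact: (continuous_measurable (@continuous_gauss2 R)). Qed.

Lemma measurable_gw n : measurable_fun setT (@prodw R gauss2 n).
Proof. exact: measurable_prodw measurable_gauss2. Qed.

Lemma measurable_hw n : measurable_fun setT (@prodw R (@gauss_fun R) n).
Proof. by apply: measurable_prodw; exact: measurable_gauss_fun. Qed.

Lemma gw_ge0 n (z : 'rV[R]_n) : (0 <= gw z)%R.
Proof. by apply: prodw_ge0; exact: gauss2_ge0. Qed.

Lemma hw_ge0 n (z : 'rV[R]_n) : (0 <= hw z)%R.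
Proof. by apply: prodw_ge0; exact: gauss_fun_ge0. Qed.

Lemma gauss_dominated n (f : 'rV[R]_n -> R) (M : R) : measurable_fun setT f ->
  (forall z, `|f z| <= M * hw z)%R ->
  (leb n).-integrable setT (EFin \o f) /\
  \int[leb n]_z `|f z|%:E <= (M * Num.sqrt pi ^+ n)%:E.
Proof.
move=> mf fM.
have M0 : (0 <= M)%R.
  have h0 : (0 < hw (0 : 'rV[R]_n))%R by apply: prodr_gt0 => i _; exact: expR_gt0.
  by rewrite -(pmulr_lge0 _ h0); exact: le_trans (normr_ge0 _) (fM 0%R).
have le : \int[leb n]_z `|f z|%:E <= (M * Num.sqrt pi ^+ n)%:E.
  rewrite EFinM -(integral_prodw_gauss n) -ge0_integralZl//; last 2 first.
  - by apply/measurable_EFinP; exact: measurable_hw.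
  - by move=> z _; rewrite lee_fin hw_ge0.
  apply: ge0_le_integral => //.
  - by apply/measurable_EFinP; exact: measurableT_comp.
  - by apply: measurable_funeM; apply/measurable_EFinP; exact: measurable_hw.
  - by move=> z _; rewrite -EFinM lee_fin.
split => //; apply/integrableP; split; first exact/measurable_EFinP.
exact: le_lt_trans le (ltry _).
Qed.

Lemma measurable_affine n (x : 'rV[R]_n) (l : R) :
  measurable_fun setT (fun z : 'rV[R]_n => x + l *: z)%R.
Proof.
apply: measurable_rVD; first exact: measurable_cst.
by apply: measurable_rVZ => //; exact: measurable_cst.
Qed.

(** The mean of [h] over a Gaussian of width [l] centred at [x], up to normalisation. *)
Definition gmean n (h : 'rV[R]_n -> R) (x : 'rV[R]_n) (l : R) : \bar R :=
  \int[leb n]_z (gw z * h (x + l *: z))%:E.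

Lemma gauss_dominatedM n (w h : 'rV[R]_n -> R) (M : R) x l : measurable_fun setT w ->
  measurable_fun setT h ->
  (forall z, `|w z| <= hw z)%R -> (forall z, `|h z| <= M)%R ->
  (leb n).-integrable setT (fun z => (w z * h (x + l *: z))%:E) /\
  \int[leb n]_z `|w z * h (x + l *: z)|%:E <= (M * Num.sqrt pi ^+ n)%:E.
Proof.
move=> mw mh wh hM; apply: gauss_dominated.
  apply: measurable_funM => //; exact: measurableT_comp mh (measurable_affine x l).
by move=> z; rewrite normrM mulrC ler_pM.
Qed.

Lemma gw_le_hw n (z : 'rV[R]_n) : (`|gw z| <= hw z)%R.
Proof. by rewrite ger0_norm ?gw_ge0// prodw_gauss2_le. Qed.

Lemma zgw_le_hw n (z : 'rV[R]_n) i : (`|z ord0 i * gw z| <= hw z)%R.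
Proof. by rewrite normrM [X in (_ * X)%R]ger0_norm ?gw_ge0// prodw_gauss2M_le. Qed.

Lemma measurable_zgw n i : measurable_fun setT (fun z : 'rV[R]_n => z ord0 i * gw z)%R.
Proof. exact: measurable_funM (measurable_coord i) (@measurable_gw n). Qed.

Lemma is_derive_continuous (f : R -> R) (s d : R) : is_derive s (1%R : R) f d ->
  {for s, continuous f}.
Proof. by move=> [df _]; exact/differentiable_continuous/derivable1_diffP. Qed.

Lemma is_derive_affine_line n (h : 'rV[R]_n -> R) i (x z : 'rV[R]_n) (l s : R) : smooth h ->
  is_derive s (1%R : R) (fun s : R => h (x + l *: (z + s *: delta_mx ord0 i)))%R
   (l * partial i h (x + l *: (z + s *: delta_mx ord0 i)))%R.
Proof.
move=> sh; set ei : 'rV[R]_n := delta_mx ord0 i.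
have E (t : R) : (x + l *: (z + t *: ei) = x + l *: z + t *: (l *: ei))%R.
  by rewrite scalerDr !scalerA addrA mulrC.
rewrite E (_ : (fun _ => _) = (fun t => h (x + l *: z + t *: (l *: ei))))%R; last first.
  by apply/funext => t; rewrite E.
have := is_derive_ray (x + l *: z)%R (l *: ei)%R s sh.
rewrite (bigD1 i)//= big1 ?addr0.
  by rewrite !mxE !eqxx mulr1.
by move=> j ji; rewrite !mxE (negbTE ji) andbF mulr0 mul0r.
Qed.

(** Integration by parts: the integral of d_i (w(z) h(x + l z)) vanishes, and the derivative of the
weight w is -4 z_i w. *)
Lemma gmean_partial n (h : 'rV[R]_n -> R) (M : R) i x l : msmooth h ->
  (forall z, `|h z| <= M)%R -> (forall z, `|partial i h z| <= M)%R ->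
  (4%:E * \int[leb n]_z (z ord0 i * gw z * h (x + l *: z))%:E =
    l%:E * gmean (partial i h) x l).
Proof.
move=> mh hM dhM; have sh := msmooth_smooth mh; have mdh := msmooth_partial i mh.
set ei : 'rV[R]_n := delta_mx ord0 i.
have [I1 _] := gauss_dominatedM x l (@measurable_gw n) (msmooth_meas mh) (@gw_le_hw n) hM.
have [I2 _] := gauss_dominatedM x l (@measurable_zgw n i) (msmooth_meas mh)
  (fun z => zgw_le_hw z i) hM.
have [I3 _] := gauss_dominatedM x l (@measurable_gw n) (msmooth_meas mdh) (@gw_le_hw n) dhM.
pose F (z : 'rV[R]_n) := (gw z * h (x + l *: z))%R.
pose F' (z : 'rV[R]_n) := ((- 4) * (z ord0 i * gw z * h (x + l *: z)) +
  l * (gw z * partial i h (x + l *: z)))%R.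
have iF' : (leb n).-integrable setT (EFin \o F').
  exact: (integrableD measurableT (integrableZl measurableT (- 4)%R I2)
    (integrableZl measurableT l I3)).
have E0 : \int[leb n]_z (F' z)%:E = 0.
  apply: (@integral_partial_eq0 _ n F F' i) => //.
    move=> z s; rewrite /F /F'.
    have d1 := is_derive_prodw_gauss2 z i s.
    have d2 := is_derive_affine_line i x z l s sh.
    apply: is_derive_eq; rewrite -/ei /GRing.scale /=.
    move: (gw _) (h _) (partial i h _) ((z + s *: ei)%R ord0 i) => a b c d.
    by ring.
  move=> z; rewrite /F' => s.
  have c1 := is_derive_continuous (is_derive_prodw_gauss2 z i s).
  have c2 := is_derive_continuous (is_derive_affine_line i x z l s sh).
  have c3 := is_derive_continuous (is_derive_affine_line i x z l s (msmooth_smooth mdh)).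
  have c4 : {for s, continuous (fun s : R => (z + s *: delta_mx ord0 i)%R ord0 i)}.
    rewrite (_ : (fun _ => _) = (fun t => z ord0 i + t)%R).
      by apply: cvgD; [exact: cvg_cst|exact: cvg_id].
    by apply/funext => t; rewrite !mxE !eqxx mulr1.
  apply: cvgD; (apply: cvgM; first exact: cvg_cst).
    exact: cvgM (cvgM c4 c1) c2.
  exact: cvgM c1 c3.
rewrite /gmean; move: E0; rewrite /F'.
under eq_integral do rewrite EFinD EFinM [X in _ + X]EFinM.
rewrite integralD//; last 2 first.
- exact: integrableZl.
- exact: integrableZl.
rewrite integralZl// integralZl//.
have f2 := integrable_fin_num measurableT I2; have f3 := integrable_fin_num measurableT I3.
move: f2 f3; set A := \int[_]_z _; set B := \int[_]_z _ => fA fB.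
rewrite -(fineK fA) -(fineK fB) -!EFinM -EFinD => -[E]; congr (_%:E).
by move: (fine A) (fine B) E => a b E; clear -E; lra.
Qed.

End gaussian_formula.

Section resolvent_bound.
Context {R : realType} {n : nat}.
Local Open Scope ereal_scope.
Notation mu1 := (@lebesgue_measure R).
Notation gw := (prodw (@gauss2 R)).
Notation hw := (prodw (@gauss_fun R)).
Implicit Types (g h : 'rV[R]_n -> R).

Lemma gmean_fin_num h (M : R) x l : measurable_fun setT h -> (forall z, `|h z| <= M)%R ->
  gmean h x l \is a fin_num.
Proof.
move=> mh hM; have [I1 _] := gauss_dominatedM x l (@measurable_gw R n) mh (@gw_le_hw R n) hM.
exact: integrable_fin_num I1.
Qed.

Lemma gmean_one_sub_laplacian g (M : R) x l : msmooth g -> (forall z, `|g z| <= M)%R ->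
  (forall i z, `|partial i (partial i g) z| <= M)%R ->
  gmean (one_sub_laplacian g) x l =
  gmean g x l - \sum_(i < n) gmean (partial i (partial i g)) x l.
Proof.
move=> mg gM ddM.
have [I1 _] := gauss_dominatedM x l (@measurable_gw R n) (msmooth_meas mg) (@gw_le_hw R n) gM.
have I2 i : (leb n).-integrable setT
    (fun z => (gw z * partial i (partial i g) (x + l *: z))%:E).
  have [] := gauss_dominatedM x l (@measurable_gw R n)
    (msmooth_meas (msmooth_partial i (msmooth_partial i mg))) (@gw_le_hw R n) (ddM i).
  by [].
rewrite /gmean -integral_sum//.
rewrite -integralB//; last exact: integrable_sum.
apply: eq_integral => z _ /=.
rewrite /one_sub_laplacian mulrBr EFinB; congr (_ - _).
by rewrite mulr_sumr -sumEFin.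
Qed.

Lemma continuous_sum_at I (s : seq I) (F : I -> R -> R) (r : R) :
  (forall i, {for r, continuous (F i)}) ->
  {for r, continuous (fun t => \sum_(i <- s) F i t)%R}.
Proof.
move=> cF; elim: s => [|i s IH].
  rewrite (_ : (fun _ => _) = cst 0%R); first exact: cvg_cst.
  by apply/funext => t; rewrite big_nil.
rewrite (_ : (fun _ => _) = (fun t => F i t + \sum_(j <- s) F j t)%R).
  exact: cvgD (cF i) IH.
by apply/funext => t; rewrite big_cons.
Qed.

(** The derivative in r of w(z) exp(-2 r^2) g(x + 4 r z), where w is the Gaussian weight. *)
Definition radial_derivative g x (zr : 'rV[R]_n * measurableTypeR R) : R :=
  (gw zr.1 * ((- (4 * zr.2) * gauss2 zr.2) * g (x + (4 * zr.2) *: zr.1) +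
    gauss2 zr.2 * (4 * \sum_i zr.1 ord0 i * partial i g (x + (4 * zr.2) *: zr.1))))%R.

(** The fundamental theorem of calculus along the ray from [x] in the direction [z]. *)
Lemma integral_radial_derivative g x z (T : R) : msmooth g -> (0 < T)%R ->
  \int[mu1]_(r in `[0%R, T]) (radial_derivative g x (z, r))%:E =
  (gw z * (gauss2 T * g (x + (4 * T) *: z) - g x))%:E.
Proof.
move=> mg T0; have sg := msmooth_smooth mg.
pose G (r : R) := (gw z * (gauss2 r * g (x + (4 * r) *: z)))%R.
have dl h (r : R) : smooth h -> is_derive r (1%R : R) (fun r : R => h (x + (4 * r) *: z))%R
    (4 * \sum_i z ord0 i * partial i h (x + (4 * r) *: z))%R.
  move=> sh; have := is_derive_ray x (4 *: z)%R r sh.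
  rewrite (_ : (fun _ => _) = (fun r => h (x + (4 * r) *: z)))%R; last first.
    by apply/funext => t; rewrite scalerA mulrC.
  rewrite scalerA [(r * 4)%R]mulrC mulr_sumr.
  by under eq_bigr do rewrite mxE -mulrA.
have dG r : is_derive r (1%R : R) G (radial_derivative g x (z, r)).
  have d1 := is_derive_gauss2 r; have d2 := dl g r sg.
  rewrite /G /radial_derivative /=; apply: is_derive_eq.
  rewrite /GRing.scale /=.
  by move: (gw z) (gauss2 r) (g _) (\sum_i _)%R => a b c d; ring.
rewrite (integral_derive_itv T0 dG).
  congr (_%:E); rewrite /G mulr0 scale0r addr0 -mulrBr; congr (_ * (_ - _))%R.
  by rewrite /gauss2 expr0n mulr0 oppr0 expR0 mul1r.
rewrite /radial_derivative /= => r.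
have c1 : {for r, continuous (@gauss2 R)} by exact: continuous_gauss2.
have c2 h : smooth h -> {for r, continuous (fun r : R => h (x + (4 * r) *: z))%R}.
  by move=> sh; exact: is_derive_continuous (dl h r sh).
have c3 : {for r, continuous (fun r : R => - (4 * r))%R}.
  by apply: cvgN; apply: cvgM; [exact: cvg_cst|exact: cvg_id].
apply: cvgM; first exact: cvg_cst.
apply: cvgD; first exact: cvgM (cvgM c3 c1) (c2 _ sg).
apply: cvgM; first exact: c1.
apply: cvgM; first exact: cvg_cst.
apply: (@continuous_sum_at _ _ (fun i (r : R) =>
  z ord0 i * partial i g (x + (4 * r) *: z))%R) => i.
apply: cvgM; first exact: cvg_cst.
exact: c2 (smooth_partial i sg).
Qed.

Lemma measurable_ray : measurable_fun setT
  (fun zr : 'rV[R]_n * measurableTypeR R => (4 * (zr.2 : R)) *: zr.1)%R.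
Proof.
apply: measurable_rVZ; last exact: measurable_fst.
by apply: measurable_funM; [exact: measurable_cst|exact: measurable_snd].
Qed.

Lemma measurable_radial_derivative g x : msmooth g ->
  measurable_fun setT (radial_derivative g x).
Proof.
move=> mg.
have m1 h : measurable_fun setT h -> measurable_fun setT
    (fun zr : 'rV[R]_n * measurableTypeR R => h (x + (4 * (zr.2 : R)) *: zr.1))%R.
  move=> mh; apply: (measurableT_comp mh); apply: measurable_rVD measurable_ray.
  exact: measurable_cst.
have mG2 : measurable_fun setT (fun zr : 'rV[R]_n * measurableTypeR R => gauss2 zr.2).
  exact: (measurableT_comp (@measurable_gauss2 R) measurable_snd).
have m2 : measurable_fun setT (fun zr : 'rV[R]_n * measurableTypeR R => (zr.2 : R)).
  exact: measurable_snd.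
apply: measurable_funM; first exact: (measurableT_comp (@measurable_gw R n) measurable_fst).
apply: measurable_funD; apply: measurable_funM.
- apply: measurable_funM => //; apply: measurableT_comp => //.
  by apply: measurable_funM => //; exact: measurable_cst.
- exact: m1 (msmooth_meas mg).
- exact: mG2.
apply: measurable_funM; first exact: measurable_cst.
apply: measurable_sum => i; apply: measurable_funM.
  exact: (measurableT_comp (measurable_coord i) measurable_fst).
exact: m1 (msmooth_meas (msmooth_partial i mg)).
Qed.

End resolvent_bound.

Section resolvent_kernel.
Context {R : realType}.
Local Open Scope ereal_scope.

Lemma measurable_fun_integral1 d1 d2 (T1 : measurableType d1) (T2 : measurableType d2)
    (m1 : {sigma_finite_measure set T1 -> \bar R}) (f : T1 * T2 -> \bar R) :
  measurable_fun setT f -> measurable_fun setT (fun y => \int[m1]_x f (x, y)).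
Proof.
move=> mf; rewrite (_ : (fun _ => _) = (fun y => \int[m1]_x f^\+ (x, y) - \int[m1]_x f^\- (x, y))).
  apply: emeasurable_funB; apply: (measurable_fun_fubini_tonelli_G _).
  - exact: measurable_funepos.
  - exact: funepos_ge0.
  - exact: measurable_funeneg.
  - exact: funeneg_ge0.
apply/funext => y; rewrite integralE; congr (_ - _); apply: eq_integral => x _.
  by rewrite !funeposE.
by rewrite !funenegE.
Qed.

Lemma prodw_rV_cons (k : R -> R) m (z : 'rV[R]_m) (r : R) :
  prodw k (rV_cons (z, r : measurableTypeR R)) = (k r * prodw k z)%R.
Proof.
rewrite /prodw big_ord_recl mxE unlift_none /=; congr (_ * _)%R.
by apply: eq_bigr => i _; rewrite mxE liftK.
Qed.

Lemma gauss2_small (D e : R) : (0 <= D)%R -> (0 < e)%R ->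
  exists2 T, (0 < T)%R & (gauss2 T * D <= e)%R.
Proof.
move=> D0 e0; exists (1 + D / e)%R; first by rewrite ltr_pwDl// divr_ge0// ltW.
set T := (1 + D / e)%R.
have T1 : (1 <= T)%R by rewrite lerDl divr_ge0// ltW.
have DT : (D <= e * T)%R by rewrite /T mulrDr mulr1 mulrCA divff ?gt_eqF// mulr1 lerDr ltW.
rewrite /gauss2 expRN -ler_pdivlMl ?invr_gt0 ?expR_gt0// invrK mulrC.
apply: le_trans DT _; rewrite ler_wpM2l ?(ltW e0)//.
apply: le_trans (expR_ge1Dx _).
by clear -T1; nra.
Qed.

(** The displacement 4 r z of the resolvent formula, as a function of the point (r, z) of R^(1+m). *)
Definition resolvent_shift m (y : 'rV[R]_m.+1) : 'rV[R]_m :=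
  ((4 * y ord0 ord0) *: rV_behead y)%R.

Lemma measurable_resolvent_shift m : measurable_fun setT (@resolvent_shift m).
Proof.
apply: measurable_rVZ.
  by apply: measurable_funM; [exact: measurable_cst|exact: measurable_coord].
apply: measurable_fun_rV => i.
apply: (eq_measurable_fun (fun y : 'rV[R]_m.+1 => y ord0 (lift ord0 i) : measurableTypeR R)).
  by move=> y _; rewrite mxE.
exact: measurable_coord.
Qed.

End resolvent_kernel.

Section resolvent_estimate.
Context {R : realType} {n : nat}.
Local Open Scope ereal_scope.
Notation mu1 := (@lebesgue_measure R).
Notation gw := (prodw (@gauss2 R)).
Notation hw := (prodw (@gauss_fun R)).
Implicit Types (h k : 'rV[R]_n -> R).

Variables (g : 'rV[R]_n -> R) (M : R).
Hypotheses (mg : msmooth g) (gM : forall z, (`|g z| <= M)%R)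
  (dM : forall i z, (`|partial i g z| <= M)%R)
  (ddM : forall i z, (`|partial i (partial i g) z| <= M)%R).

Let mdg i : measurable_fun setT (partial i g).
Proof. exact: msmooth_meas (msmooth_partial i mg). Qed.

(** Integration by parts turns the radial derivative of [g] into its Laplacian; the factor 4 r
that appears combines with the derivative of exp(-2 r^2). *)
Lemma integral_radial_derivative_space x (r : R) :
  \int[leb n]_z (radial_derivative g x (z, r))%:E =
  (- (4 * r * gauss2 r))%:E * gmean (one_sub_laplacian g) x (4 * r).
Proof.
rewrite (gmean_one_sub_laplacian _ _ mg gM ddM).
have [I1 _] := gauss_dominatedM x (4 * r) (@measurable_gw R n) (msmooth_meas mg) (@gw_le_hw R n) gM.
have I2 i : (leb n).-integrable setT
    (fun z => (z ord0 i * gw z * partial i g (x + (4 * r) *: z))%:E).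
  by have [] := gauss_dominatedM x (4 * r) (@measurable_zgw R n i) (@mdg i)
    (fun z => zgw_le_hw z i) (dM i).
have E2 i : gmean (partial i (partial i g)) x (4 * r) \is a fin_num.
  apply: (gmean_fin_num (M := M)); last exact: ddM.
  exact: msmooth_meas (msmooth_partial i (msmooth_partial i mg)).
have E1 : gmean g x (4 * r) \is a fin_num by exact: gmean_fin_num (msmooth_meas mg) gM.
transitivity (\int[leb n]_z ((- (4 * r) * gauss2 r)%:E * (gw z * g (x + (4 * r) *: z))%:E +
   \sum_i (gauss2 r)%:E * (4%:E * (z ord0 i * gw z * partial i g (x + (4 * r) *: z))%:E))).
  apply: eq_integral => z _; rewrite /radial_derivative /= mulrDr EFinD; congr (_ + _).
    by rewrite -EFinM; congr (_%:E); ring.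
  rewrite !mulr_sumr -sumEFin; apply: eq_bigr => i _.
  by rewrite -!EFinM; congr (_%:E); ring.
have I3 i : (leb n).-integrable setT (fun z => (gauss2 r)%:E * (4%:E *
    (z ord0 i * gw z * partial i g (x + (4 * r) *: z))%:E)).
  by apply: integrableZl => //; exact: integrableZl.
rewrite integralD//; last 2 first.
- exact: integrableZl.
- exact: integrable_sum.
rewrite integralZl// integral_sum//.
pose a := fine (gmean g x (4 * r)).
pose b i := fine (gmean (partial i (partial i g)) x (4 * r)).
rewrite (eq_bigr (fun i => (4 * r * gauss2 r * b i)%:E)); last first.
  move=> i _; rewrite integralZl//; last exact: integrableZl.
  rewrite integralZl// (gmean_partial x (4 * r) (msmooth_partial i mg) (dM i) (ddM i)).
  by rewrite -(fineK (E2 i)) -/(b i) -!EFinM; congr (_%:E); ring.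
rewrite -/(gmean g x (4 * r)) -(fineK E1) -/a.
rewrite [X in _ = _ * (_ - X)](eq_bigr (fun i => (b i)%:E)); last first.
  by move=> i _; rewrite /b fineK.
rewrite !sumEFin -EFinB -!EFinM -EFinD -mulr_sumr; congr (_%:E).
by move: (\sum_i _)%R => s; ring.
Qed.

Lemma norm_radial_derivative x (r : R) (z : 'rV[R]_n) :
  (`|radial_derivative g x (z, r)| <= M * (4 + 4 * n%:R) * hw z)%R.
Proof.
have M0 : (0 <= M)%R by exact: le_trans (normr_ge0 _) (gM x).
have g1 (t : R) : (gauss_fun t <= 1)%R by exact: gauss_fun_le1.
have r1 : (`|r| * gauss2 r <= 1)%R by exact: le_trans (gauss2M_le r) (g1 r).
have r2 : (gauss2 r <= 1)%R by exact: le_trans (gauss2_le r) (g1 r).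
have g0 := gauss2_ge0 r.
rewrite /radial_derivative /= mulrDr; apply: le_trans (ler_normD _ _) _.
rewrite mulrDr mulrDl; apply: lerD.
  rewrite normrM [leLHS]mulrC; apply: ler_pM => //; last exact: gw_le_hw.
  rewrite normrM [leLHS]mulrC; apply: ler_pM => //.
  rewrite normrM normrN normrM (ger0_norm g0) ger0_norm// -mulrA.
  by rewrite -[leRHS]mulr1 ler_wpM2l.
rewrite [X in (gw z * X)%R](_ : _ = 4 * gauss2 r * \sum_i z ord0 i * partial i g (x + (4 * r) *: z))%R; last by ring.
rewrite mulrCA normrM.
apply: (@le_trans _ _ (4 * \sum_(i < n) M * hw z)%R).
  apply: ler_pM => //.
    by rewrite normrM ger0_norm// (ger0_norm g0) -[leRHS]mulr1 ler_wpM2l.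
  rewrite mulr_sumr; apply: le_trans (ler_norm_sum _ _ _) _; apply: ler_sum => i _.
  rewrite mulrA [(gw z * _)%R]mulrC normrM [leRHS]mulrC.
  by apply: ler_pM => //; exact: zgw_le_hw.
by rewrite sumr_const card_ord -mulr_natl le_eqVlt; apply/orP; left; apply/eqP; ring.
Qed.

(** Integrate the radial derivative over z and over r in [0, T], in both orders. As T tends to
infinity the first term vanishes, and [g] is recovered from (1 - Delta) g. *)
Lemma resolvent_formula x (T c : R) : (0 < T)%R -> \int[leb n]_z (gw z)%:E = c%:E ->
  (gauss2 T)%:E * gmean g x (4 * T) - (c * g x)%:E =
  \int[mu1]_(r in `[0%R, T]) ((- (4 * r * gauss2 r))%:E * gmean (one_sub_laplacian g) x (4 * r)).
Proof.
move=> T0 cE.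
have mrd := measurable_radial_derivative x mg.
have := Fubini_itv (mu := leb n) (M := (M * (4 + 4 * n%:R) * Num.sqrt pi ^+ n)%R) (ltW T0) mrd.
move=> /(_ _)/wrap[].
  move=> r _.
  have [||_ //] := @gauss_dominated _ _ (fun z => radial_derivative g x (z, r)) (M * (4 + 4 * n%:R))%R.
  - by apply: (measurableT_comp mrd); exact: pair2_measurable.
  - by move=> z; exact: norm_radial_derivative.
under eq_integral => z _ do rewrite (integral_radial_derivative x z mg T0).
under [in X in _ = X -> _]eq_integral => r _ do rewrite integral_radial_derivative_space.
move=> <-.
have [I1 _] := gauss_dominatedM x (4 * T) (@measurable_gw R n) (msmooth_meas mg) (@gw_le_hw R n) gM.
have I2 : (leb n).-integrable setT (fun z => (gw z)%:E).
  have [] // := @gauss_dominated _ n (@prodw R gauss2 n) 1%R.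
    exact: measurable_gw.
  by move=> z; rewrite mul1r gw_le_hw.
rewrite (eq_integral (fun z => (gauss2 T)%:E * (gw z * g (x + (4 * T) *: z))%:E
  - (g x)%:E * (gw z)%:E)); last first.
  by move=> z _; rewrite -!EFinM -EFinB; congr (_%:E); ring.
rewrite integralB//; last 2 first.
- exact: integrableZl.
- exact: integrableZl.
by rewrite integralZl// integralZl// cE -EFinM [(c * _)%R]mulrC.
Qed.

(** The formula for large T, with the integrals over the radius and over R^n merged into one
integral over R^(1+n). The function k is (1 - Delta) g in one application; in the other, g is a
derivative d_i h and k is (1 - Delta) h. *)
Lemma resolvent_bound (k : 'rV[R]_n -> R) (c : R) : measurable_fun setT k -> (0 < c)%R ->
  \int[leb n]_z (gw z)%:E = c%:E ->
  (forall x (r : R), (0 <= r)%R ->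
    `|(- (4 * r * gauss2 r))%:E * gmean (one_sub_laplacian g) x (4 * r)| <=
    \int[leb n]_z (4 * (gauss_fun r * hw z * `|k (x + (4 * r) *: z)|))%:E) ->
  forall x, `|g x|%:E <= \int[leb n.+1]_y (4 / c * hw y * `|k (x + resolvent_shift y)|)%:E.
Proof.
move=> mk c0 cE H x.
have mky : measurable_fun setT (fun y : 'rV[R]_n.+1 => k (x + resolvent_shift y))%R.
  apply: (measurableT_comp mk); apply: measurable_rVD; first exact: measurable_cst.
  exact: measurable_resolvent_shift.
pose F (y : 'rV[R]_n.+1) := (4 * (hw y * `|k (x + resolvent_shift y)|))%R.
have mF : measurable_fun setT (EFin \o F).
  apply/measurable_EFinP; apply: measurable_funM; first exact: measurable_cst.
  apply: measurable_funM; first exact: measurable_hw.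
  exact: measurableT_comp.
have F0 y : 0 <= (F y)%:E by rewrite lee_fin !mulr_ge0// hw_ge0.
pose K := \int[leb n.+1]_y (F y)%:E.
suff : (c * `|g x|)%:E <= K.
  move=> cK; rewrite (eq_integral (fun y => (c^-1)%:E * (F y)%:E)); last first.
    by move=> y _; rewrite -EFinM; congr (_%:E); rewrite /F; ring.
  rewrite ge0_integralZl//; last by rewrite lee_fin invr_ge0 ltW.
  rewrite -[leLHS]mul1e -[1]/(1%R%:E) -(mulVf (lt0r_neq0 c0)) -EFinM -mulrA EFinM.
  by apply: lee_wpmul2l => //; rewrite lee_fin invr_ge0 ltW.
apply/lee_addgt0Pr => e e0.
have M0 : (0 <= M)%R by exact: le_trans (normr_ge0 _) (gM x).
(* The boundary term at T is at most [e]. *)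
have [T T0 Te] := gauss2_small (mulr_ge0 M0 (exprn_ge0 n (sqrtr_ge0 pi))) e0.
have [I1 I2] := gauss_dominatedM x (4 * T) (@measurable_gw R n) (msmooth_meas mg) (@gw_le_hw R n) gM.
have fm : gmean g x (4 * T) \is a fin_num by exact: gmean_fin_num (msmooth_meas mg) gM.
have mle : `|(gauss2 T)%:E * gmean g x (4 * T)| <= e%:E.
  rewrite abseM gee0_abs ?lee_fin ?gauss2_ge0//.
  apply: (@le_trans _ _ ((gauss2 T)%:E * (M * Num.sqrt pi ^+ n)%:E)); last by rewrite -EFinM lee_fin.
  apply: lee_wpmul2l; first by rewrite lee_fin gauss2_ge0.
  by apply: le_trans (le_abse_integral _ _ (measurable_int _ I1)) _.
have Kle : `|\int[mu1]_(r in `[0%R, T]) ((- (4 * r * gauss2 r))%:E *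
    gmean (one_sub_laplacian g) x (4 * r))| <= K.
  have mI : measurable_fun setT (fun r : measurableTypeR R =>
     (- (4 * (r : R) * gauss2 r))%:E * gmean (one_sub_laplacian g) x (4 * r)).
    rewrite (_ : (fun _ => _) = (fun r => \int[leb n]_z (radial_derivative g x (z, r))%:E)).
      apply: (@measurable_fun_integral1 _ _ _ _ _ (leb n) (EFin \o radial_derivative g x)).
      by apply/measurable_EFinP; exact: measurable_radial_derivative.
    by apply/funext => r; rewrite integral_radial_derivative_space.
  have mD : measurable (`[0%R, T]%classic : set (measurableTypeR R)) by exact: measurable_itv.
  apply: le_trans (le_abse_integral _ mD (measurable_funTS mI)) _.
  pose B (r : measurableTypeR R) := \int[leb n]_z (F (rV_cons (z, r)))%:E.
  have B0 r : 0 <= B r by exact: integral_ge0.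
  have mB : measurable_fun setT B.
    apply: (@measurable_fun_integral1 _ _ _ _ _ (leb n) ((EFin \o F) \o @rV_cons R n)).
    exact: measurableT_comp mF (@measurable_rV_cons R n).
  rewrite /K (ge0_integral_rV_cons_sym mF F0).
  apply: (@le_trans _ _ (\int[mu1]_(r in `[0%R, T]) B r)).
    apply: ge0_le_integral => //.
    - exact: measurable_funTS (measurableT_comp _ mI).
    - exact: measurable_funTS.
    - move=> r /=; rewrite in_itv /= => /andP[r0 _].
      apply: le_trans (H x r r0) _; rewrite le_eqVlt; apply/orP; left; apply/eqP.
      apply: eq_integral => z _; rewrite /F prodw_rV_cons; congr (4 * (_ * `|k (x + _)|))%:E.
      rewrite /resolvent_shift mxE unlift_none /=; congr (_ *: _).
      by apply/rowP => i; rewrite !mxE liftK.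
  exact: ge0_subset_integral.
(* c g(x) is the boundary term minus the integral of the resolvent formula. *)
have E := resolvent_formula x T0 cE.
have -> : (c * `|g x|)%:E = `|(c * g x)%:E| by rewrite /= normrM (gtr0_norm c0).
have -> : (c * g x)%:E = (gauss2 T)%:E * gmean g x (4 * T) -
   ((gauss2 T)%:E * gmean g x (4 * T) - (c * g x)%:E).
  by rewrite -(fineK fm) -!EFinM -!EFinB; congr (_%:E); ring.
rewrite E; apply: le_trans (lee_abs_sub _ _) _; rewrite [leRHS]addeC.
exact: leeD.
Qed.

End resolvent_estimate.

Section resolvent_bounds.
Context {R : realType} {n : nat}.
Local Open Scope ereal_scope.
Notation mu1 := (@lebesgue_measure R).
Notation gw := (prodw (@gauss2 R)).
Notation hw := (prodw (@gauss_fun R)).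
Implicit Types (g h k : 'rV[R]_n -> R).

Definition bounded_partials g := forall s, exists M, forall z, (`|partials s g z| <= M)%R.

(** The two weights to which this applies are w(z) and z_i w(z). *)
Lemma weighted_mean_le (w k : 'rV[R]_n -> R) (M a r l : R) x : measurable_fun setT w ->
  measurable_fun setT k -> (forall z, `|w z| <= hw z)%R -> (forall z, `|k z| <= M)%R ->
  (`|a| <= 4 * gauss_fun r)%R ->
  `|a%:E * \int[leb n]_z (w z * k (x + l *: z))%:E| <=
  \int[leb n]_z (4 * (gauss_fun r * hw z * `|k (x + l *: z)|))%:E.
Proof.
move=> mw mk wh kM ar.
have mkx : measurable_fun setT (fun z : 'rV[R]_n => k (x + l *: z))%R.
  exact: measurableT_comp mk (measurable_affine x l).
rewrite abseM; apply: (@le_trans _ _ ((4 * gauss_fun r)%:E *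
    \int[leb n]_z (hw z * `|k (x + l *: z)|)%:E)).
  apply: lee_pmul => //.
  have mwk : measurable_fun setT (fun z => (w z * k (x + l *: z))%:E).
    by apply/measurable_EFinP; exact: measurable_funM.
  apply: le_trans (le_abse_integral _ measurableT mwk) _; apply: ge0_le_integral => //.
  - exact: measurableT_comp.
  - apply/measurable_EFinP; apply: measurable_funM; first exact: measurable_hw.
    exact: measurableT_comp.
  - by move=> z _; rewrite /= lee_fin normrM ler_pM.
rewrite -ge0_integralZl//; last 3 first.
- apply/measurable_EFinP; apply: measurable_funM; first exact: measurable_hw.
  exact: measurableT_comp.
- by move=> z _; rewrite lee_fin mulr_ge0// hw_ge0.
- by rewrite lee_fin mulr_ge0// gauss_fun_ge0.
rewrite le_eqVlt; apply/orP; left; apply/eqP; apply: eq_integral => z _.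
by rewrite -EFinM !mulrA.
Qed.

Lemma integral_gw_gt0 : exists2 c : R, (0 < c)%R & \int[leb n]_z (gw z)%:E = c%:E.
Proof.
pose I := \int[mu1]_t (gauss2 t)%:E.
have fI : I \is a fin_num.
  rewrite ge0_fin_numE; last by apply: integral_ge0 => t _; rewrite lee_fin gauss2_ge0.
  apply: (@le_lt_trans _ _ (\int[mu1]_t (gauss_fun t)%:E)); last by rewrite integralT_gauss ltry.
  apply: ge0_le_integral => //.
  - by move=> t _; rewrite lee_fin gauss2_ge0.
  - by apply/measurable_EFinP; exact: measurable_gauss2.
  - by apply/measurable_EFinP; exact: measurable_gauss_fun.
  - by move=> t _; rewrite lee_fin gauss2_le.
have I0 : (0 < fine I)%R.
  rewrite fine_gt0//; apply/andP; split; last by rewrite ltey_eq fI.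
  pose D : set (measurableTypeR R) := `[0%R, 1%R]%classic.
  have mD : measurable D by exact: measurable_itv.
  apply: (@lt_le_trans _ _ (\int[mu1]_(t in D) (cst (expR (-2))%:E t))).
    have muD : @lebesgue_measure R D = 1.
      rewrite (@lebesgue_measure_itv R (Interval (BLeft 0%R) (BRight 1%R))) /= lte_fin ltr01.
      by rewrite oppr0 adde0.
    by rewrite integral_cst// -[X in _ * X]/(@lebesgue_measure R D) muD mule1 lte_fin expR_gt0.
  apply: (@le_trans _ _ (\int[mu1]_(t in D) (gauss2 t)%:E)).
    apply: ge0_le_integral => //.
    - by move=> t _; rewrite lee_fin expR_ge0.
    - by apply: measurable_funTS; apply/measurable_EFinP; exact: measurable_gauss2.
    - move=> t; rewrite /D /= in_itv /= => /andP[t0 t1].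
      by rewrite lee_fin ler_expR lerN2 ler_piMr// expr_le1.
  apply: ge0_subset_integral => //.
  - by apply/measurable_EFinP; exact: measurable_gauss2.
  - by move=> t _; rewrite lee_fin gauss2_ge0.
exists (fine I ^+ n)%R; first exact: exprn_gt0.
apply: integral_prodw; [exact: measurable_gauss2|exact: gauss2_ge0|].
by rewrite -/I fineK.
Qed.

Lemma measurable_one_sub_laplacian g : msmooth g -> measurable_fun setT (one_sub_laplacian g).
Proof.
move=> mg; apply: measurable_funB; first exact: msmooth_meas.
by apply: measurable_sum => i; exact: msmooth_meas (msmooth_partial i (msmooth_partial i mg)).
Qed.

Lemma msmooth_one_sub_laplacian g : msmooth g -> msmooth (one_sub_laplacian g).
Proof.
move=> mg; have sg := msmooth_smooth mg; split; first exact: smooth_one_sub_laplacian.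
move=> s; rewrite partials_one_sub_laplacian//; apply: measurable_one_sub_laplacian.
split; first exact: smooth_partials.
by move=> t; rewrite partials_partials; exact: msmooth_measurable mg _.
Qed.

Lemma bounded_partials_one_sub_laplacian g : msmooth g -> bounded_partials g ->
  bounded_partials (one_sub_laplacian g).
Proof.
move=> mg bg s; have sg := msmooth_smooth mg.
rewrite partials_one_sub_laplacian//.
have [M0 h0] := bg s; have [M hM] := choice (fun i => bg [:: i, i & s]).
exists (M0 + \sum_i M i)%R => z; apply: le_trans (ler_normB _ _) _.
apply: lerD => //; apply: le_trans (ler_norm_sum _ _ _) _; apply: ler_sum => i _.
exact: hM.
Qed.

Lemma bounded_partials_partial i g : bounded_partials g -> bounded_partials (partial i g).
Proof.
by move=> bg s; rewrite -[partial i g]/(partials [:: i] g) partials_partials; exact: bg.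
Qed.

Lemma common_bound g : bounded_partials g -> exists M,
  [/\ forall z, (`|g z| <= M)%R, forall i z, (`|partial i g z| <= M)%R &
      forall i z, (`|partial i (partial i g) z| <= M)%R].
Proof.
move=> bg; have [M0 h0] := bg [::]; have [M1 h1] := choice (fun i => bg [:: i]).
have [M2 h2] := choice (fun i => bg [:: i; i]).
have le (f : 'I_n -> R) i : (f i <= \sum_j `|f j|)%R.
  by apply: le_trans (ler_norm _) _; rewrite (bigD1 i)//= lerDl sumr_ge0.
exists (`|M0| + (\sum_j `|M1 j| + \sum_j `|M2 j|))%R; split.
- by move=> z; apply: le_trans (h0 z) _; rewrite (le_trans (ler_norm _))// lerDl addr_ge0// sumr_ge0.
- move=> i z; apply: le_trans (h1 i z) _; apply: le_trans (le M1 i) _.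
  by rewrite addrCA lerDl addr_ge0// sumr_ge0.
- move=> i z; apply: le_trans (h2 i z) _; apply: le_trans (le M2 i) _.
  by rewrite addrA lerDr addr_ge0// sumr_ge0.
Qed.

(** A function is dominated by a Gaussian mean of its image under 1 - Delta: the resolvent of the
Laplacian is the mean, over a Rayleigh distributed radius, of Gaussian means. *)
Lemma resolvent_le g (c : R) : msmooth g -> bounded_partials g -> (0 < c)%R ->
  \int[leb n]_z (gw z)%:E = c%:E -> forall x,
  `|g x|%:E <= \int[leb n.+1]_y (4 / c * hw y * `|one_sub_laplacian g (x + resolvent_shift y)|)%:E.
Proof.
move=> mg bg c0 cE; have [M [M0 M1 M2]] := common_bound bg.
apply: (resolvent_bound mg M0 M1 M2) => //; first exact: measurable_one_sub_laplacian.
move=> x r r0; have [M' hM'] := bounded_partials_one_sub_laplacian mg bg [::].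
apply: (@weighted_mean_le (@prodw R gauss2 n) (one_sub_laplacian g) M') => //.
- exact: measurable_gw.
- exact: measurable_one_sub_laplacian.
- exact: gw_le_hw.
rewrite normrN -mulrA normrM ger0_norm// ler_pM2l// normrM [`|gauss2 r|%R]ger0_norm ?gauss2_ge0//.
exact: gauss2M_le.
Qed.

(** The derivative in the mean of d_i (1 - Delta) g is moved onto the weight. This costs a factor
1/r, which the factor r of the radial density absorbs. *)
Lemma resolvent_partial_le g (c : R) i : msmooth g -> bounded_partials g -> (0 < c)%R ->
  \int[leb n]_z (gw z)%:E = c%:E -> forall x,
  `|partial i g x|%:E <=
  \int[leb n.+1]_y (4 / c * hw y * `|one_sub_laplacian g (x + resolvent_shift y)|)%:E.
Proof.
move=> mg bg c0 cE; have mdg := msmooth_partial i mg.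
have [M [M0 M1 M2]] := common_bound (bounded_partials_partial i bg).
apply: (resolvent_bound mdg M0 M1 M2) => //; first exact: measurable_one_sub_laplacian.
move=> x r r0.
have mL := msmooth_one_sub_laplacian mg.
have [L [L0 L1 _]] := common_bound (bounded_partials_one_sub_laplacian mg bg).
have /= <- := partials_one_sub_laplacian [:: i] (msmooth_smooth mg).
have -> : (- (4 * r * gauss2 r))%:E * gmean (partial i (one_sub_laplacian g)) x (4 * r) =
  (- (4 * gauss2 r))%:E *
    \int[leb n]_z (z ord0 i * gw z * one_sub_laplacian g (x + (4 * r) *: z))%:E.
  have := gmean_partial (i := i) x (4 * r) mL L0 (L1 i).
  have f1 := gmean_fin_num x (4 * r) (msmooth_meas (msmooth_partial i mL)) (L1 i).
  have [I2 _] := gauss_dominatedM x (4 * r) (@measurable_zgw R n i) (msmooth_meas mL)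
    (fun z => zgw_le_hw z i) L0.
  have f2 := integrable_fin_num measurableT I2.
  move: f1 f2; set A := gmean _ _ _; set B := \int[_]_z _ => f1 f2.
  rewrite -(fineK f1) -(fineK f2) -!EFinM => -[E]; congr (_%:E).
  by move: (fine A) (fine B) (gauss2 r) E => a b d E; clear -E; nra.
apply: (@weighted_mean_le (fun z => z ord0 i * prodw gauss2 z)%R (one_sub_laplacian g) L) => //.
- exact: measurable_zgw.
- exact: measurable_one_sub_laplacian.
- by move=> z; exact: zgw_le_hw.
rewrite normrN normrM ger0_norm// ler_pM2l// ger0_norm ?gauss2_ge0//.
exact: gauss2_le.
Qed.

End resolvent_bounds.

(** * A Sobolev inequality on the unit cube *)

Section sup_bound.
Context {R : realType} {n : nat}.
Local Open Scope ereal_scope.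
Notation mu1 := (@lebesgue_measure R).
Implicit Types (g h : 'rV[R]_n -> R).

Definition unit_itv : set (measurableTypeR R) := `[0%R, 1%R]%classic.
Definition unit_indic (t : R) : R := \1_unit_itv t.

Lemma measurable_unit_itv : measurable unit_itv. Proof. exact: measurable_itv. Qed.

Lemma unit_indic_ge0 t : (0 <= unit_indic t)%R. Proof. by rewrite /unit_indic indicE. Qed.

Lemma unit_indic_le1 t : (unit_indic t <= 1)%R.
Proof. by rewrite /unit_indic indicE; case: (_ \in _). Qed.

Lemma measurable_unit_indic : measurable_fun [set: measurableTypeR R]
  (unit_indic : measurableTypeR R -> measurableTypeR R).
Proof. exact: measurable_indic measurable_unit_itv. Qed.

Lemma lebesgue_unit_itv : @lebesgue_measure R unit_itv = 1.
Proof.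
rewrite (@lebesgue_measure_itv R (Interval (BLeft 0%R) (BRight 1%R))) /= lte_fin ltr01.
by rewrite oppr0 adde0.
Qed.

Lemma integral_unit_indic : \int[mu1]_t (unit_indic t)%:E = 1.
Proof.
rewrite integral_indic//; last exact: measurable_unit_itv.
by rewrite setIT; exact: lebesgue_unit_itv.
Qed.

Lemma measurable_line h (w v : 'rV[R]_n) : measurable_fun setT h ->
  measurable_fun setT (fun t : measurableTypeR R => h (w + (t : R) *: v)%R).
Proof.
move=> mh; apply: (measurableT_comp mh); apply: measurable_rVD; first exact: measurable_cst.
by apply: measurable_rVZ => //; exact: measurable_cst.
Qed.

(** The one-dimensional Sobolev inequality: h(w) differs from h(w + t e_i) by an integral of the
derivative over [0, t]; average over t in [0, 1]. *)
Lemma line_sup_bound h i (w : 'rV[R]_n) : msmooth h ->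
  `|h w|%:E <= \int[mu1]_t (unit_indic t *
    (`|h (w + t *: delta_mx ord0 i)| + `|partial i h (w + t *: delta_mx ord0 i)|))%:E.
Proof.
move=> mh; set ei : 'rV[R]_n := delta_mx ord0 i.
have sh := msmooth_smooth mh; have mdh := msmooth_partial i mh.
have ma : measurable_fun setT (fun t : measurableTypeR R => `|h (w + (t : R) *: ei)|)%R.
  by apply: measurableT_comp => //; exact: measurable_line (msmooth_meas mh).
have mb : measurable_fun setT (fun t : measurableTypeR R => `|partial i h (w + (t : R) *: ei)|)%R.
  by apply: measurableT_comp => //; exact: measurable_line (msmooth_meas mdh).
have patch (f : R -> R) : \int[mu1]_t (unit_indic t * f t)%:E = \int[mu1]_(t in unit_itv) (f t)%:E.
  rewrite [RHS]integral_mkcond; apply: eq_integral => t _.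
  by rewrite epatch_indic /= -EFinM mulrC.
pose D := \int[mu1]_(s in unit_itv) `|partial i h (w + s *: ei)|%:E.
have cst1 (a : \bar R) : \int[mu1]_(t in unit_itv) a = a.
  rewrite integral_cst; last exact: measurable_unit_itv.
  by rewrite -[X in _ * X]/(@lebesgue_measure R unit_itv) lebesgue_unit_itv mule1.
have D0 : 0 <= D by exact: integral_ge0.
have fin t : unit_itv t -> `|h w|%:E <= `|h (w + t *: ei)|%:E + D.
  rewrite /unit_itv /= in_itv /= => /andP[t0 t1].
  have [->|tN0] := eqVneq t 0%R; first by rewrite scale0r addr0 leeDl.
  have tp : (0 < t)%R by rewrite lt0r tN0.
  have E := integral_derive_itv tp (fun s => is_derive_line i w s sh)
    (@continuous_line _ _ _ w ei (smooth_continuous (msmooth_smooth mdh))).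
  rewrite scale0r addr0 in E.
  apply: (@le_trans _ _ (`|h (w + t *: ei)%R|%:E + `|(h (w + t *: ei) - h w)%:E|)).
    rewrite -EFinD lee_fin.
    by have := ler_normB (h (w + t *: ei)%R) (h (w + t *: ei)%R - h w)%R; rewrite subKr.
  apply: leeD => //; rewrite -E.
  have mD : measurable (`[0%R, t]%classic : set (measurableTypeR R)) by exact: measurable_itv.
  apply: le_trans (le_abse_integral _ mD _) _.
    apply: measurable_funTS; apply/measurable_EFinP.
    exact: measurable_line (msmooth_meas mdh).
  apply: ge0_subset_integral => //.
  - exact: measurable_unit_itv.
  - by apply: measurable_funTS; exact/measurable_EFinP.
  - by move=> s; rewrite /unit_itv /= !in_itv /= => /andP[-> st]; exact: le_trans st t1.
rewrite patch; under eq_integral do rewrite EFinD.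
rewrite ge0_integralD//; last 3 first.
- exact: measurable_unit_itv.
- by apply: measurable_funTS; exact/measurable_EFinP.
- by apply: measurable_funTS; exact/measurable_EFinP.
rewrite -/D -[leLHS](cst1) -[X in _ <= _ + X](cst1 D).
rewrite -ge0_integralD//; last 2 first.
- exact: measurable_unit_itv.
- by apply: measurable_funTS; exact/measurable_EFinP.
apply: ge0_le_integral => //.
- exact: measurable_unit_itv.
- apply: emeasurable_funD => //.
  by apply: measurable_funTS; exact/measurable_EFinP.
Qed.

Notation cw := (prodw unit_indic).

(** The point with coordinates [y] along the directions [f]; with [f] the identity of ['I_n] it is
[y] itself, and an arbitrary [f] is what the induction on the dimension needs. *)
Definition comb k (f : 'I_k -> 'I_n) (y : 'rV[R]_k) : 'rV[R]_n :=
  (\sum_i y ord0 i *: delta_mx ord0 (f i))%R.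

Lemma measurable_comb k (f : 'I_k -> 'I_n) : measurable_fun setT (comb f).
Proof.
rewrite /comb; elim: (index_enum _) => [|i s IH].
  by under eq_fun do rewrite big_nil; exact: measurable_cst.
under eq_fun do rewrite big_cons.
apply: measurable_rVD => //; apply: measurable_rVZ; last exact: measurable_cst.
exact: measurable_coord.
Qed.

Lemma measurable_cw k : measurable_fun setT (@prodw R unit_indic k).
Proof. exact: measurable_prodw measurable_unit_indic. Qed.

Lemma cw_ge0 k (y : 'rV[R]_k) : (0 <= cw y)%R.
Proof. by apply: prodw_ge0; exact: unit_indic_ge0. Qed.

(** One direction at a time, the value at a point is bounded by a mean of derivatives over a
parallelepiped. *)
Lemma cube_sup_bound k (f : 'I_k -> 'I_n) : exists L : seq (seq 'I_n), forall g, msmooth g ->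
  forall x, `|g x|%:E <=
    \int[leb k]_y (cw y * \sum_(s <- L) `|partials s g (x + comb f y)|)%:E.
Proof.
elim: k f => [|k IH] f.
  exists [:: [::]] => g mg x.
  rewrite integral_leb integral_dirac//; last first.
    apply/measurable_EFinP; apply: measurable_funM; first exact: measurable_cw.
    under eq_fun do rewrite big_seq1; apply: measurableT_comp => //.
    apply: (measurableT_comp (msmooth_meas mg)); apply: measurable_rVD; first exact: measurable_cst.
    exact: measurable_comb.
  by rewrite diracT mul1e big_seq1 /prodw big_ord0 mul1r /comb big_ord0 addr0.
have [L HL] := IH (fun i => f (lift ord0 i)).
(* Each derivative of the previous list, with and without one more in the new direction. *)
exists (L ++ map (cons (f ord0)) L) => g mg x.
have mp s : msmooth (partials s g).
  split; first exact: smooth_partials (msmooth_smooth mg).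
  by move=> t; rewrite partials_partials; exact: msmooth_measurable.
pose S (w : 'rV[R]_n) := (\sum_(s <- L ++ map (cons (f ord0)) L) `|partials s g w|)%R.
have mS : measurable_fun setT S.
  rewrite /S; elim: (_ ++ _) => [|s l IHl].
    by under eq_fun do rewrite big_nil; exact: measurable_cst.
  under eq_fun do rewrite big_cons; apply: measurable_funD => //.
  by apply: measurableT_comp => //; exact: msmooth_meas.
have S0 w : (0 <= S w)%R by rewrite /S sumr_ge0.
pose F (y : 'rV[R]_k.+1) := (cw y * S (x + comb f y))%R.
have mF : measurable_fun setT (EFin \o F).
  apply/measurable_EFinP; apply: measurable_funM; first exact: measurable_cw.
  apply: (measurableT_comp mS); apply: measurable_rVD; first exact: measurable_cst.
  exact: measurable_comb.
have F0 y : 0 <= (F y)%:E by rewrite lee_fin mulr_ge0 ?cw_ge0.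
apply: le_trans (HL g mg x) _.
rewrite -[leRHS]/(\int[leb k.+1]_y (EFin \o F) y) (ge0_integral_rV_cons mF F0).
apply: ge0_le_integral => //.
- by move=> y _; rewrite lee_fin mulr_ge0 ?cw_ge0// sumr_ge0.
- apply/measurable_EFinP; apply: measurable_funM; first exact: measurable_cw.
  elim: L {HL S mS S0 F mF F0} => [|s l IHl].
    by under eq_fun do rewrite big_nil; exact: measurable_cst.
  under eq_fun do rewrite big_cons; apply: measurable_funD => //.
  apply: measurableT_comp => //; apply: (measurableT_comp (msmooth_meas (mp s))).
  by apply: measurable_rVD; [exact: measurable_cst|exact: measurable_comb].
- apply: (measurable_fun_fubini_tonelli_F ((EFin \o F) \o @rV_cons R k)).
    exact: measurableT_comp mF (@measurable_rV_cons R k).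
  by move=> y; exact: F0.
move=> y _.
set w := (x + comb _ y)%R.
have FE (t : R) : F (rV_cons (y, t : measurableTypeR R)) =
    (cw y * (unit_indic t * S (w + t *: delta_mx ord0 (f ord0))))%R.
  have -> : (w + t *: delta_mx ord0 (f ord0) = x + comb f (rV_cons (y, t : measurableTypeR R)))%R.
    rewrite /w /comb big_ord_recl mxE unlift_none /= -addrA; congr (_ + _)%R.
    rewrite addrC; congr (_ + _)%R; apply: eq_bigr => i _.
    by rewrite mxE liftK.
  by rewrite /F prodw_rV_cons -mulrA mulrCA.
under eq_integral => t _ do rewrite /= FE EFinM.
have mSw : measurable_fun setT (fun t : measurableTypeR R =>
    (unit_indic t * S (w + (t : R) *: delta_mx ord0 (f ord0)))%:E).
  apply/measurable_EFinP; apply: measurable_funM; first exact: measurable_unit_indic.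
  exact: measurable_line.
rewrite ge0_integralZl//; last 2 first.
- by move=> t _; rewrite lee_fin mulr_ge0// unit_indic_ge0.
- by rewrite lee_fin cw_ge0.
rewrite EFinM; apply: lee_wpmul2l; first by rewrite lee_fin cw_ge0.
rewrite -sumEFin.
apply: (@le_trans _ _ (\sum_(s <- L) \int[mu1]_t (unit_indic t *
   (`|partials s g (w + t *: delta_mx ord0 (f ord0))| +
    `|partials (f ord0 :: s) g (w + t *: delta_mx ord0 (f ord0))|))%:E)).
  by apply: lee_sum => s _; exact: line_sup_bound.
rewrite -ge0_integral_sum//; last 2 first.
- move=> s; apply/measurable_EFinP; apply: measurable_funM; first exact: measurable_unit_indic.
  apply: measurable_funD; apply: measurableT_comp => //; apply: measurable_line.
    exact: msmooth_meas.
  exact: (msmooth_meas (mp (f ord0 :: s))).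
- by move=> s t _; rewrite lee_fin mulr_ge0 ?unit_indic_ge0.
rewrite le_eqVlt; apply/orP; left; apply/eqP; apply: eq_integral => t _.
rewrite sumEFin -mulr_sumr /S big_cat big_map /=; congr (_ * _)%:E.
by rewrite big_split.
Qed.

End sup_bound.

(** * Real-valued norms on L^r *)

Section lp_norm.
Context d (T : measurableType d) (R : realType) (mu : {measure set T -> \bar R}).
Variables (r : R) (r1 : 1 <= r).
Implicit Types f g h : T -> R.

(** A real number, which is meaningful on functions of [Lfun mu r%:E]. *)
Definition lpn f : R := fine ('N[mu]_(r%:E)[EFin \o f])%E.

Let p1 : (1 <= r%:E)%E. Proof. by rewrite lee_fin. Qed.

Lemma LfunE f : (f \in Lfun mu r%:E) <->
  measurable_fun setT f /\ ('N[mu]_(r%:E)[EFin \o f] < +oo)%E.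
Proof.
split; first by rewrite inE => /andP[]; rewrite !inE.
by case=> mf nf; rewrite inE; apply/andP; split; rewrite inE.
Qed.

Lemma lpnE f : f \in Lfun mu r%:E -> (lpn f)%:E = ('N[mu]_(r%:E)[EFin \o f])%E.
Proof.
move=> /LfunE[_ fn]; rewrite fineK// ge0_fin_numE//; exact: Lnorm_ge0.
Qed.

Lemma lpn_ge0 f : 0 <= lpn f.
Proof. by apply: fine_ge0; exact: Lnorm_ge0. Qed.

Lemma LfunD f g : f \in Lfun mu r%:E -> g \in Lfun mu r%:E ->
  (fun x => f x + g x) \in Lfun mu r%:E.
Proof.
have [L0 Llin] := Lfun_submod_closed mu p1.
move=> Lf Lg; have := Llin 1 f g Lf Lg.
by rewrite scale1r.
Qed.

Lemma LfunZ (a : R) f : f \in Lfun mu r%:E -> (fun x => a * f x) \in Lfun mu r%:E.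
Proof.
have [L0 Llin] := Lfun_submod_closed mu p1.
by move=> Lf; have := Llin a f 0 Lf L0; rewrite addr0.
Qed.

Lemma lpnD f g : f \in Lfun mu r%:E -> g \in Lfun mu r%:E ->
  lpn (fun x => f x + g x) <= lpn f + lpn g.
Proof.
move=> Lf Lg; rewrite -lee_fin EFinD !lpnE//; last exact: LfunD.
by have [[mf _] [mg _]] := ((LfunE f).1 Lf, (LfunE g).1 Lg); exact: eminkowski.
Qed.

Lemma lpnZ (a : R) f : f \in Lfun mu r%:E -> lpn (fun x => a * f x) = `|a| * lpn f.
Proof.
move=> Lf; apply: EFin_inj; rewrite EFinM !lpnE//; last exact: LfunZ.
exact: (LnormZ (p1 := p1) (Lfun_Sub p1 Lf) a).
Qed.

Lemma lpn_le_powR (K : R) f h : 0 <= K -> measurable_fun setT f -> h \in Lfun mu r%:E ->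
  (\int[mu]_x (`|f x| `^ r)%:E <= (K `^ r)%:E * \int[mu]_x (`|h x| `^ r)%:E)%E ->
  f \in Lfun mu r%:E /\ lpn f <= K * lpn h.
Proof.
have r0 : 0 < r by exact: lt_le_trans r1.
move=> K0 mf Lh fh.
have NE g : ('N[mu]_(r%:E)[EFin \o g] = (\int[mu]_x (`|g x| `^ r)%:E) `^ r^-1)%E.
  by rewrite unlock; under eq_integral do rewrite poweR_EFin.
have I0 g : (0 <= \int[mu]_x (`|g x| `^ r)%:E)%E.
  by apply: integral_ge0 => x _; rewrite lee_fin powR_ge0.
have le : ('N[mu]_(r%:E)[EFin \o f] <= K%:E * 'N[mu]_(r%:E)[EFin \o h])%E.
  rewrite !NE; have -> : K%:E = ((K `^ r)%:E `^ r^-1)%E.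
    by rewrite poweR_EFin -powRrM mulfV ?gt_eqF// powRr1.
  rewrite -poweRM ?lee_fin ?powR_ge0//.
  apply: gt0_ler_poweR => //; first by rewrite invr_ge0 ltW.
    exact: in_itv0y.
  by apply: in_itv0y; rewrite mule_ge0// lee_fin powR_ge0.
have fin : (K%:E * 'N[mu]_(r%:E)[EFin \o h] < +oo)%E by rewrite -lpnE// -EFinM ltry.
have Lf : f \in Lfun mu r%:E by apply/LfunE; split => //; exact: le_lt_trans le fin.
by split => //; rewrite -lee_fin EFinM !lpnE.
Qed.

Lemma lpn_le f h : measurable_fun setT f -> h \in Lfun mu r%:E ->
  (forall x, `|f x| <= `|h x|) -> f \in Lfun mu r%:E /\ lpn f <= lpn h.
Proof.
move=> mf Lh fh; rewrite -[lpn h]mul1r; apply: lpn_le_powR => //.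
rewrite powR1 mul1e; apply: ge0_le_integral => //.
- by apply/measurable_EFinP; apply: measurable_powRl; exact: measurableT_comp.
- apply/measurable_EFinP; apply: measurable_powRl; apply: measurableT_comp => //.
  by have [] := (LfunE h).1 Lh.
- by move=> x _; rewrite lee_fin ge0_ler_powR ?nnegrE// (le_trans _ r1).
Qed.

Lemma Lfun_cst0 : (cst 0 : T -> R) \in Lfun mu r%:E.
Proof. by have [] := Lfun_submod_closed mu p1. Qed.

Lemma lpn0 : lpn (cst 0) = 0.
Proof.
have E : (fun x => 0 * (cst 0 : T -> R) x) = cst 0 by apply/funext => x; rewrite mul0r.
by rewrite -[LHS](congr1 lpn E) lpnZ ?normr0 ?mul0r//; exact: Lfun_cst0.
Qed.

Lemma Lfun_sum I (s : seq I) (F : I -> T -> R) : (forall i, F i \in Lfun mu r%:E) ->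
  (fun x => \sum_(i <- s) F i x) \in Lfun mu r%:E.
Proof.
move=> LF; elim: s => [|i s IH].
  by under eq_fun do rewrite big_nil; exact: Lfun_cst0.
by under eq_fun do rewrite big_cons; exact: LfunD.
Qed.

Lemma lpn_sum I (s : seq I) (F : I -> T -> R) : (forall i, F i \in Lfun mu r%:E) ->
  lpn (fun x => \sum_(i <- s) F i x) <= \sum_(i <- s) lpn (F i).
Proof.
move=> LF; elim: s => [|i s IH].
  by under eq_fun do rewrite big_nil; rewrite big_nil lpn0.
under eq_fun do rewrite big_cons; rewrite big_cons.
by apply: le_trans (lpnD (LF i) (Lfun_sum s LF)) _; rewrite lerD2l.
Qed.

Lemma Lfun_norm_powR f : f \in Lfun mu r%:E -> (fun x => `|f x|) \in Lfun mu r%:E.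
Proof.
move=> Lf; have [mf _] := (LfunE f).1 Lf; apply: (lpn_le _ Lf _).1.
  exact: measurableT_comp.
by move=> x; rewrite normr_id.
Qed.

Lemma lpn_norm f : f \in Lfun mu r%:E -> lpn (fun x => `|f x|) = lpn f.
Proof.
move=> Lf; have Lnf := Lfun_norm_powR Lf.
have [mf _] := (LfunE f).1 Lf; have [mnf _] := (LfunE _).1 Lnf.
apply/eqP; rewrite eq_le; apply/andP; split.
  by apply: (lpn_le mnf Lf _).2 => x; rewrite normr_id.
by apply: (lpn_le mf Lnf _).2 => x; rewrite normr_id.
Qed.

Lemma integral_powR_lpn f : f \in Lfun mu r%:E ->
  (\int[mu]_x (`|f x| `^ r)%:E = (lpn f `^ r)%:E)%E.
Proof.
move=> Lf; rewrite -poweR_EFin lpnE// poweR_Lnorm//.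
by rewrite gt_eqF// (lt_le_trans _ r1).
Qed.

End lp_norm.

(** * Sobolev norms and powers of 1 - Delta *)

Section sobolev.
Context {R : realType} {n : nat} (r : R) (r1 : 1 <= r).
Implicit Types (g h : 'rV[R]_n -> R).
Notation lp := (lpn (leb n) r).
Notation Lp := (Lfun (leb n) r%:E).

(** The real counterpart of membership in the space of test functions, with derivatives along
words instead of multi-indices. *)
Record sobolev g : Prop := Sobolev {
  sobolev_msmooth : msmooth g ;
  sobolev_Lfun : forall s, partials s g \in Lp }.

Lemma sobolev_smooth g : sobolev g -> smooth g.
Proof. by move=> /sobolev_msmooth/msmooth_smooth. Qed.

Lemma smooth_sobolev g : smooth g -> (forall s, partials s g \in Lp) -> sobolev g.
Proof.
move=> sg Lg; split => //; split=> [|s]; first exact: sg.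
by have [] := (LfunE _ _ _).1 (Lg s).
Qed.

Lemma sobolev_partials t g : sobolev g -> sobolev (partials t g).
Proof.
move=> sg; apply: smooth_sobolev; first exact: smooth_partials (sobolev_smooth sg).
by move=> s; rewrite partials_partials; exact: sobolev_Lfun.
Qed.

Lemma sobolev_lin (a : R) g h : sobolev g -> sobolev h ->
  sobolev (fun x => a * g x + h x).
Proof.
move=> sg sh; have [smg smh] := (sobolev_smooth sg, sobolev_smooth sh).
apply: smooth_sobolev; first exact: smooth_lin.
move=> s; rewrite partials_lin//.
exact: LfunD r1 _ _ (LfunZ r1 a (sobolev_Lfun sg s)) (sobolev_Lfun sh s).
Qed.

Lemma sobolev_one_sub_laplacian g : sobolev g -> sobolev (one_sub_laplacian g).
Proof.
move=> sg; have smg := sobolev_smooth sg.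
apply: smooth_sobolev; first exact: smooth_one_sub_laplacian.
move=> s; rewrite partials_one_sub_laplacian// one_sub_laplacianE.
apply: LfunD => //; apply: LfunZ => //; first exact: sobolev_Lfun.
apply: Lfun_sum => // i.
exact: (sobolev_Lfun sg [:: i, i & s]).
Qed.

Lemma sobolev_iter m g : sobolev g -> sobolev (iter m one_sub_laplacian g).
Proof.
by move=> sg; elim: m => [|m IH]; [exact: sg|exact: sobolev_one_sub_laplacian IH].
Qed.

Fixpoint words k : seq (seq 'I_n) :=
  if k is j.+1 then [::] :: [seq i :: s | i <- enum 'I_n, s <- words j] else [:: [::]].

Lemma mem_words k s : (s \in words k) = (size s <= k)%N.
Proof.
elim: k s => [|k IH] [|i s] //=; rewrite inE /=.
apply/allpairsP/idP => [[[j t] /= [_ tk [_ ->]]]|sk]; first by rewrite ltnS -IH.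
by exists (i, s); rewrite /= mem_enum IH.
Qed.

Definition sobn k g : R := \sum_(s <- words k) lp (partials s g).

Lemma sobn_ge0 k g : 0 <= sobn k g.
Proof. by apply: sumr_ge0 => s _; exact: lpn_ge0. Qed.

Lemma lp_le_sobn k s g : (size s <= k)%N -> lp (partials s g) <= sobn k g.
Proof.
rewrite -mem_words => sk; rewrite /sobn (big_rem s)//= lerDl.
by apply: sumr_ge0 => t _; exact: lpn_ge0.
Qed.

Lemma sobn_le k g (M : R) : (forall s, (size s <= k)%N -> lp (partials s g) <= M) ->
  sobn k g <= (size (words k))%:R * M.
Proof.
move=> H; rewrite /sobn big_seq; apply: (@le_trans _ _ (\sum_(s <- words k | s \in words k) M)).
  by apply: ler_sum => s; rewrite mem_words; exact: H.
by rewrite -big_seq big_const_seq iter_addr_0 count_predT mulr_natl.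
Qed.

Lemma measurable_sum_norm (L : seq (seq 'I_n)) g : sobolev g ->
  (fun x => \sum_(s <- L) `|partials s g x|) \in Lp.
Proof.
by move=> sg; apply: Lfun_sum => // s; apply: Lfun_norm_powR => //; exact: sobolev_Lfun.
Qed.

(** The Sobolev embedding into bounded functions: the mean over the unit cube that bounds |g x| is
bounded by an L^r norm, since the cube has measure 1. *)
Lemma sobolev_sup : exists k (C : R), 0 <= C /\ forall g, sobolev g ->
  forall x, `|g x| <= C * sobn k g.
Proof.
have [L HL] := @cube_sup_bound R n n id.
exists (\max_(s <- L) size s)%N, (size L)%:R; split => // g sg x.
have mg := sobolev_msmooth sg.
pose S (w : 'rV[R]_n) := \sum_(s <- L) `|partials s g w|.
have S0 w : 0 <= S w by exact: sumr_ge0.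
have LS : S \in Lp by exact: measurable_sum_norm.
have [mS _] := (LfunE _ _ _).1 LS.
have mSx : measurable_fun setT (fun y => S (x + y)).
  by apply: (measurableT_comp mS); apply: measurable_rVD => //; exact: measurable_cst.
have cw1 : (\int[leb n]_y (prodw (@unit_indic R) y)%:E = (1 ^+ n)%:E)%E.
  apply: integral_prodw; [exact: measurable_unit_indic|exact: unit_indic_ge0|].
  exact: integral_unit_indic.
rewrite expr1n in cw1.
have cwle y : prodw (@unit_indic R) y <= 1 :> R.
  apply: (@le_trans _ _ (prodw (cst 1) y)).
    by apply: prodw_le => t; rewrite unit_indic_ge0 unit_indic_le1.
  by rewrite /prodw prodr_const expr1n.
have combE y : comb id y = y :> 'rV[R]_n by rewrite [RHS]row_sum_delta.
have H : ((`|g x| `^ r)%:E <= (lp S `^ r)%:E)%E.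
  apply: le_trans (jensen_powR (t := fun y => S (x + y)) r1 (@measurable_cw R n) mSx (@cw_ge0 R n)
    (fun y => S0 _) ler01 cw1 (normr_ge0 _) _) _.
    apply: le_trans (HL g mg x) _; rewrite le_eqVlt; apply/orP; left; apply/eqP.
    by apply: eq_integral => y _; rewrite combE.
  rewrite powR1 mul1e -(integral_powR_lpn r1 LS).
  have mSr : measurable_fun setT (fun y => (S y `^ r)%:E).
    by apply/measurable_EFinP; exact: measurable_powRl.
  apply: (@le_trans _ _ (\int[leb n]_y (S (y + x) `^ r)%:E)%E).
    apply: ge0_le_integral => //.
    - by move=> y _; rewrite lee_fin mulr_ge0 ?powR_ge0// cw_ge0.
    - apply/measurable_EFinP; apply: measurable_funM; first exact: measurable_cw.
      exact: measurable_powRl.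
    - exact: measurableT_comp mSr (measurable_rV_shift x).
    - move=> y _; rewrite lee_fin [y + x]addrC -[leRHS]mul1r.
      by rewrite ler_wpM2r ?powR_ge0.
  rewrite (ge0_integral_shift x mSr); last by move=> y; rewrite lee_fin powR_ge0.
  by under [leRHS]eq_integral => y _ do rewrite ger0_norm ?S0//.
have r0 : 0 < r by exact: lt_le_trans r1.
have {}H : `|g x| <= lp S.
  have := H; rewrite lee_fin => /(ge0_ler_powR (ltW (_ : 0 < r^-1))).
  rewrite !nnegrE !powR_ge0 -!powRrM mulfV ?gt_eqF// !powRr1 ?lpn_ge0//.
  by apply => //; rewrite invr_gt0.
apply: le_trans H _; apply: le_trans (lpn_sum r1 L _) _.
  by move=> s; apply: Lfun_norm_powR => //; exact: sobolev_Lfun.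
apply: (@le_trans _ _ (\sum_(s <- L) sobn (\max_(s <- L) size s) g)).
  rewrite big_seq [leRHS]big_seq; apply: ler_sum => s sL.
  rewrite (lpn_norm r1 (sobolev_Lfun sg s)).
  by apply: lp_le_sobn; exact: leq_bigmax_seq.
by rewrite big_const_seq iter_addr_0 count_predT mulr_natl.
Qed.

End sobolev.

Section elliptic_estimate.
Context {R : realType} {n : nat} (r : R) (r1 : 1 <= r).
Implicit Types (g h : 'rV[R]_n -> R).
Notation lp := (lpn (leb n) r).
Notation sobolev := (@sobolev R n r).
Notation sobn := (@sobn R n r).

(** This is what makes the resolvent formula applicable to [g] and its derivatives. *)
Lemma sobolev_bounded_partials g : sobolev g -> bounded_partials g.
Proof.
move=> sg s; have [k [C [_ H]]] := @sobolev_sup R n r r1.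
by exists (C * sobn k (partials s g)) => z; exact: H (sobolev_partials s sg) z.
Qed.

(** The resolvent of the Laplacian and its gradient are bounded on L^r, because they are dominated
by means of translates with an integrable weight. *)
Lemma resolvent_lpn : exists2 K : R, 1 <= K & forall g, sobolev g ->
  lp g <= K * lp (one_sub_laplacian g) /\
  forall i, lp (partial i g) <= K * lp (one_sub_laplacian g).
Proof.
have [c c0 cE] := @integral_gw_gt0 R n.
pose K0 : R := 4 / c * Num.sqrt pi ^+ n.+1.
have K00 : 0 < K0.
  by rewrite mulr_gt0 ?divr_gt0// exprn_gt0// sqrtr_gt0 pi_gt0.
exists (Num.max 1 K0); first by rewrite le_max lexx.
move=> g sg; have mg := sobolev_msmooth sg.
have bg := sobolev_bounded_partials sg.
have sL := sobolev_one_sub_laplacian r1 sg.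
have LL := sobolev_Lfun sL [::].
have [mL _] := (LfunE _ _ _).1 LL.
pose k (y : 'rV[R]_n.+1) := 4 / c * prodw (@gauss_fun R) y.
have c40 : 0 <= 4 / c by rewrite divr_ge0// ltW.
have kE : (\int[leb n.+1]_y (k y)%:E = K0%:E)%E.
  under eq_integral do rewrite EFinM.
  rewrite ge0_integralZl//; last 2 first.
  - by apply/measurable_EFinP; exact: measurable_hw.
  - by move=> y _; rewrite lee_fin hw_ge0.
  by rewrite integral_prodw_gauss -EFinM.
have main (G : 'rV[R]_n -> R) : measurable_fun setT G -> (forall x, `|G x|%:E <= \int[leb n.+1]_y
    (4 / c * prodw (@gauss_fun R) y * `|one_sub_laplacian g (x + resolvent_shift y)|)%:E)%E ->
    lp G <= Num.max 1 K0 * lp (one_sub_laplacian g).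
  move=> mG HG; apply: (@le_trans _ _ (K0 * lp (one_sub_laplacian g))).
    apply: (lpn_le_powR r1 (ltW K00) mG LL _).2.
    apply: (@translates_mean_powR _ n n.+1 k (@resolvent_shift R n)) => //.
    - by apply: measurable_funM; [exact: measurable_cst|exact: measurable_hw].
    - exact: measurable_resolvent_shift.
    - by move=> y; rewrite mulr_ge0// hw_ge0.
  by rewrite ler_wpM2r ?lpn_ge0// le_max lexx orbT.
split; first by apply: main; [exact: msmooth_meas|exact: resolvent_le].
move=> i; apply: main; first exact: msmooth_meas (msmooth_partial i mg).
exact: resolvent_partial_le.
Qed.

(** Induction on the power: the resolvent gains one derivative each time. *)
Lemma lpn_partials_resolvent : exists2 K : R, 1 <= K & forall s k g, (size s <= k)%N ->
  sobolev g -> lp (partials s g) <= K ^+ k * lp (iter k one_sub_laplacian g).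
Proof.
have [K K1 HK] := resolvent_lpn; exists K => //.
have K0 : 0 <= K by exact: le_trans K1.
have up k g : sobolev g -> lp g <= K ^+ k * lp (iter k one_sub_laplacian g).
  elim: k g => [|k IH] g sg; first by rewrite expr0 mul1r.
  apply: le_trans (HK g sg).1 _; rewrite exprS -mulrA ler_wpM2l//.
  by rewrite iterSr; exact: IH (sobolev_one_sub_laplacian r1 sg).
elim=> [|i s IH] k g; first by move=> _; exact: up.
case: k => // k; rewrite /= ltnS => sk sg.
apply: le_trans ((HK _ (sobolev_partials s sg)).2 i) _.
rewrite exprS -mulrA ler_wpM2l// -(partials_one_sub_laplacian s (sobolev_smooth sg)).
rewrite -iterS iterSr.
exact: IH sk (sobolev_one_sub_laplacian r1 sg).
Qed.

(** The elliptic estimate behind the Bessel representation. *)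
Lemma sobn_resolvent k : exists2 C : R, 0 <= C & forall g, sobolev g ->
  sobn k g <= C * lp (iter k one_sub_laplacian g).
Proof.
have [K K1 HK] := lpn_partials_resolvent.
exists ((size (@words n k))%:R * K ^+ k); first by rewrite mulr_ge0// exprn_ge0// (le_trans _ K1).
by move=> g sg; rewrite -mulrA; apply: sobn_le => s sk; exact: HK.
Qed.

Lemma lpn_one_sub_laplacian s k g : (size s <= k)%N -> sobolev g ->
  lp (partials s (one_sub_laplacian g)) <= (1 + n%:R) * sobn k.+2 g.
Proof.
move=> sk sg; rewrite (partials_one_sub_laplacian s (sobolev_smooth sg)) one_sub_laplacianE.
have L0 := sobolev_Lfun sg s.
have L2 i : partial i (partial i (partials s g)) \in Lfun (leb n) r%:E.
  exact: sobolev_Lfun sg [:: i, i & s].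
apply: le_trans (lpnD r1 _ _) _.
- exact: LfunZ.
- by apply: LfunZ => //; exact: Lfun_sum.
rewrite (lpnZ r1 _ L0) (lpnZ r1 _ (Lfun_sum r1 _ L2)) normrN normr1 !mul1r.
rewrite mulrDl mul1r; apply: lerD.
  by apply: lp_le_sobn; exact: leq_trans sk (leqW (leqnSn k)).
apply: le_trans (lpn_sum r1 _ L2) _.
apply: (@le_trans _ _ (\sum_(i <- index_enum 'I_n) sobn k.+2 g)).
  by apply: ler_sum => i _; exact: (@lp_le_sobn _ _ r k.+2 [:: i, i & s]).
by rewrite sumr_const card_ord mulr_natl.
Qed.

Lemma lpn_iter_one_sub_laplacian m : exists2 C : R, 0 <= C & forall g, sobolev g ->
  lp (iter m one_sub_laplacian g) <= C * sobn m.*2 g.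
Proof.
elim: m => [|m [C C0 IH]].
  by exists 1 => // g sg; rewrite mul1r; exact: (@lp_le_sobn _ _ r 0 [::]).
exists (C * ((size (@words n m.*2))%:R * (1 + n%:R))).
  by rewrite !mulr_ge0// addr_ge0.
move=> g sg; rewrite iterSr; apply: le_trans (IH _ (sobolev_one_sub_laplacian r1 sg)) _.
rewrite -!mulrA ler_wpM2l//; apply: sobn_le => s sk; exact: lpn_one_sub_laplacian.
Qed.

Lemma sobn_lin k (a : R) g h : sobolev g -> sobolev h ->
  sobn k (fun x => a * g x + h x) <= `|a| * sobn k g + sobn k h.
Proof.
move=> sg sh; rewrite /sobn mulr_sumr -big_split /=; apply: ler_sum => s _.
rewrite (partials_lin _ _ (sobolev_smooth sg) (sobolev_smooth sh)).
have [Lg Lh] := (sobolev_Lfun sg s, sobolev_Lfun sh s).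
by apply: le_trans (lpnD r1 (LfunZ r1 a Lg) Lh) _; rewrite (lpnZ r1 a Lg).
Qed.

End elliptic_estimate.

(** * The theorem of Hahn and Banach *)

Section hahn_banach.
Context {R : realType} (V : lmodType R) (N : V -> R).
Hypotheses (ND : forall v w, N (v + w) <= N v + N w)
  (NZ : forall a v, N (a *: v) = `|a| * N v).

(** A functional given by its graph need not come with a subspace as its domain; it may be defined
on the image of a map that is not known to be injective. *)
Definition linear_graph (G : set (V * R)) := G (0, 0) /\
  forall a v s w t, G (v, s) -> G (w, t) -> G (a *: v + w, a * s + t).

Definition dominated_graph (G : set (V * R)) := forall v s, G (v, s) -> s <= N v.

Let good G := linear_graph G /\ dominated_graph G.

Let N0 : N 0 = 0. Proof. by rewrite -(scale0r (0 : V)) NZ normr0 mul0r. Qed.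

Let good_uniq G v s t : good G -> G (v, s) -> G (v, t) -> s = t.
Proof.
move=> [[G0 Gl] Gd] vs vt; apply/eqP; rewrite eq_le; apply/andP; split.
  have := Gd _ _ (Gl (-1) _ _ _ _ vt vs); rewrite scaleN1r addNr N0 mulN1r.
  by rewrite addrC subr_le0.
have := Gd _ _ (Gl (-1) _ _ _ _ vs vt); rewrite scaleN1r addNr N0 mulN1r.
by rewrite addrC subr_le0.
Qed.

Let extend G v0 : good G -> exists G', [/\ good G', G `<=` G' & exists c, G' (v0, c)].
Proof.
move=> GG; have [[G0 Gl] Gd] := GG.
have NN v : N (- v) = N v by rewrite -scaleN1r NZ normrN normr1 mul1r.
pose A := [set x | exists v s, G (v, s) /\ x = s - N (v - v0)].
have ub w t : G (w, t) -> ubound A (N (w + v0) - t).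
  move=> wt _ [v [s [vs ->]]].
  have := Gd _ _ (Gl 1 _ _ _ _ vs wt); rewrite scale1r mul1r => H.
  have := ND (v - v0) (w + v0); rewrite addrACA addNr addr0 => H'.
  by clear -H H'; lra.
have A0 : A !=set0 by exists (0 - N (0 - v0)), 0, 0.
have hs : has_sup A by split => //; exists (N (0 + v0) - 0); exact: ub.
(* The value at [v0] has to lie above A and below all the bounds of [ub]. *)
pose c := sup A.
have c1 v s : G (v, s) -> s - N (v - v0) <= c.
  by move=> vs; apply: ub_le_sup; [exact: hs.2|exists v, s].
have c2 w t : G (w, t) -> c <= N (w + v0) - t.
  by move=> wt; apply: ge_sup => //; exact: ub.
have GZ a v s : G (v, s) -> G (a *: v, a * s).
  by move=> vs; have := Gl a _ _ _ _ vs G0; rewrite !addr0.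
exists [set p | exists v s a, G (v, s) /\ p = (v + a *: v0, s + a * c)].
split.
- split.
    split; first by exists 0, 0, 0; split => //; rewrite scale0r mul0r !addr0.
    move=> a _ _ _ _ [v [s [b [vs [-> ->]]]]] [w [t [d [wt [-> ->]]]]].
    exists (a *: v + w), (a * s + t), (a * b + d); split; first exact: Gl.
    congr pair; last by ring.
    by rewrite scalerDr scalerDl scalerA addrACA.
  move=> _ _ [v [s [a [vs [-> ->]]]]].
  have [a0|a0|->] := ltgtP a 0; last by rewrite scale0r mul0r !addr0; exact: Gd.
    have b0 : 0 < - a by rewrite oppr_gt0.
    have := c1 _ _ (GZ (- a)^-1 _ _ vs).
    have -> : v + a *: v0 = (- a) *: ((- a)^-1 *: v - v0).
      by rewrite scalerBr scalerA mulfV ?gt_eqF// scale1r scaleNr opprK.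
    rewrite NZ gtr0_norm//; move: (N _) => M.
    rewrite lerBlDr -(ler_pM2l b0) mulrA mulfV ?gt_eqF// mul1r.
    by move=> H; clear -H; lra.
  have := c2 _ _ (GZ a^-1 _ _ vs).
  have -> : v + a *: v0 = a *: (a^-1 *: v + v0).
    by rewrite scalerDr scalerA mulfV ?gt_eqF// scale1r.
  rewrite NZ gtr0_norm//; move: (N _) => M.
  rewrite lerBrDr -(ler_pM2l a0) mulrDr mulrA mulfV ?gt_eqF// mul1r.
  by move=> H; clear -H; lra.
- move=> [v s] vs; exists v, s, 0; split => //.
  by rewrite scale0r mul0r !addr0.
- by exists c, 0, 0, 1; split => //; rewrite scale1r mul1r !add0r.
Qed.

(** A maximal dominated linear graph is defined everywhere, since [extend] adds any vector to the
domain. Domination makes a linear graph single-valued. *)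
Theorem hahn_banach (G : set (V * R)) : linear_graph G -> dominated_graph G ->
  exists L : V -> R, [/\ forall a v w, L (a *: v + w) = a * L v + L w,
    forall v, L v <= N v & forall v s, G (v, s) -> L v = s].
Proof.
move=> lG dG.
pose T := {H : set (V * R) | good H /\ G `<=` H}.
pose rel (H K : T) := `[< sval H `<=` sval K >].
have relP H K : rel H K = (sval H `<=` sval K) :> Prop.
  by apply/propext; split => /asboolP.
have [||||H Hmax] := @Zorn T rel.
- by move=> H; rewrite relP.
- by move=> H K M; rewrite !relP => HK KM; exact: subset_trans KM.
- move=> [H pH] [K pK]; rewrite !relP /= => HK KH.
  by apply: eq_exist => /=; apply/seteqP.
- move=> A totA; have [[H0 AH0]|A0] := pselect (exists H, A H); last first.
    have gG : good G /\ G `<=` G by split; [split|].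
    by exists (exist _ G gG) => s As; exfalso; apply: A0; exists s.
  pose U := \bigcup_(H in A) sval H.
  have gU : good U /\ G `<=` U.
    split; last by move=> p Gp; exists H0 => //; exact: (svalP H0).2.
    split; last by move=> v s [H AH]; exact: (svalP H).1.2.
    split; first by exists H0 => //; exact: (svalP H0).1.1.1.
    move=> a v s w t [H AH vs] [K AK wt].
    have [|] := totA _ _ AH AK; rewrite relP => sub.
      by exists K => //; apply: (svalP K).1.1.2 => //; exact: sub.
    by exists H => //; apply: (svalP H).1.1.2 => //; exact: sub.
  by exists (exist _ U gU) => H AH; rewrite relP => p Hp; exists H.
have gH : good (sval H) := (svalP H).1.
have dom v : exists c, sval H (v, c).
  have [K [gK HK [c Kc]]] := extend v gH.
  have pK : good K /\ G `<=` K by split => //; exact: subset_trans (svalP H).2 HK.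
  by exists c; rewrite -(Hmax (exist _ K pK) _) //= relP.
have [L HL] := choice dom.
exists L; split.
- move=> a v w; apply: (good_uniq gH (HL _) _).
  exact: gH.1.2 (HL v) (HL w).
- by move=> v; exact: gH.2.
- by move=> v s vs; apply: (good_uniq gH (HL v) _); exact: (svalP H).2.
Qed.

End hahn_banach.

(** * Dominated convergence and bounded functionals on L^r *)

(** The form of Fatou's lemma used for integrals that are bounded along a convergent sequence. *)
Lemma fatou_le d (T : measurableType d) (R : realType) (mu : {measure set T -> \bar R})
    (f : nat -> T -> \bar R) (g : T -> \bar R) (c : \bar R) :
  (forall k, measurable_fun setT (f k)) -> (forall k x, (0 <= f k x)%E) ->
  (forall x, f ^~ x @ \oo --> g x) -> (forall k, (\int[mu]_x f k x <= c)%E) ->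
  (\int[mu]_x g x <= c)%E.
Proof.
move=> mf f0 fg fc.
rewrite (eq_integral (fun x => limn_einf (f ^~ x))); last first.
  move=> x _; rewrite is_cvg_limn_einfE; first exact/esym/cvg_lim.
  exact: cvgP (fg x).
apply: le_trans (fatou mu measurableT mf (fun k x _ => f0 k x)) _.
rewrite limn_einf_lim; apply: lime_le; first exact: is_cvg_einfs.
apply: nearW => k; apply: le_trans (fc k).
by apply: ereal_inf_lbound; exists k => /=.
Qed.

Section lp_dominated_convergence.
Context d (T : measurableType d) (R : realType) (mu : {measure set T -> \bar R}).
Variables (r : R) (r1 : 1 <= r).
Implicit Types f g h : T -> R.
Notation L := (Lfun mu r%:E).

Let r0 : 0 < r. Proof. exact: lt_le_trans r1. Qed.

(** Dominated convergence for the r-th powers. *)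
Lemma lpn_cvg0 (f : nat -> T -> R) h : (forall k, measurable_fun setT (f k)) ->
  h \in L -> (forall k x, `|f k x| <= `|h x|) ->
  (forall x, f ^~ x @ \oo --> 0) -> lpn mu r (f k) @[k --> \oo] --> 0.
Proof.
move=> mf Lh fh f0.
have mh : measurable_fun setT h by have [] := (LfunE mu r h).1 Lh.
have Lf k : f k \in L by exact: (lpn_le r1 (mf k) Lh (fh k)).1.
have mp g : measurable_fun setT g -> measurable_fun setT (fun x => (`|g x| `^ r)%:E).
  by move=> mg; apply/measurable_EFinP; apply: measurable_powRl; exact: measurableT_comp.
have cv : (\int[mu]_x (`|f k x| `^ r)%:E)%E @[k --> \oo] --> (\int[mu]_x (cst 0 x))%E.
  apply: (@dominated_cvg _ _ _ mu setT measurableT (fun k x => (`|f k x| `^ r)%:E)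
    (cst 0%E) (fun x => (`|h x| `^ r)%:E)) => //.
  - by move=> k; exact: mp.
  - move=> x _; apply: cvg_EFin; first by apply: nearW => k.
    have -> : fine \o (fun k => (`|f k x| `^ r)%:E) = fun k => `|f k x| `^ r by [].
    apply/cvgrPdist_lt => e e0.
    have e1 : 0 < e `^ r^-1 by exact: powR_gt0.
    have /cvgrPdist_lt/(_ _ e1) := f0 x.
    apply: filterS => k; rewrite !sub0r !normrN => fe.
    rewrite ger0_norm ?powR_ge0//.
    have := @gt0_ltr_powR _ _ r0 `|f k x| (e `^ r^-1).
    rewrite !nnegrE => /(_ (normr_ge0 _) (powR_ge0 _ _) fe).
    by rewrite -powRrM mulVf ?gt_eqF// powRr1// ltW.
  - apply/integrableP; split; first exact: mp.
    under eq_integral do rewrite abse_EFin ger0_norm ?powR_ge0//.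
    by rewrite integral_powR_lpn// ltry.
  - move=> k x _; rewrite abse_EFin lee_fin ger0_norm ?powR_ge0//.
    by rewrite ge0_ler_powR ?nnegrE// ltW.
rewrite integral0 in cv.
have E k : (\int[mu]_x (`|f k x| `^ r)%:E = (lpn mu r (f k) `^ r)%:E)%E.
  exact: integral_powR_lpn.
rewrite (funext E : (fun k => _) = _) in cv.
move/fine_cvgP : cv => [_ /cvgrPdist_lt cv].
apply/cvgrPdist_lt => e e0; have := cv _ (powR_gt0 r e0).
apply: filterS => k /=; rewrite !sub0r !normrN.
rewrite !ger0_norm ?powR_ge0 ?lpn_ge0// => H.
rewrite ltNge; apply/negP => le; move: H; rewrite ltNge => /negP; apply.
by apply: ge0_ler_powR; rewrite ?nnegrE ?lpn_ge0// ltW.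
Qed.

(** The bound is one-sided; applied to -f it bounds the absolute value. *)
Definition bounded_functional (C : R) (F : (T -> R) -> R) :=
  (forall a f g, f \in L -> g \in L ->
     F (fun x => a * f x + g x) = a * F f + F g) /\
  (forall f, f \in L -> F f <= C * lpn mu r f).

Section functional.
Variables (C : R) (F : (T -> R) -> R).
Hypothesis bF : bounded_functional C F.

Lemma functional0 : F (cst 0) = 0.
Proof.
have L0 := Lfun_cst0 mu r1; have := bF.1 (-1) _ _ L0 L0.
under [X in F X]eq_fun do rewrite /cst mulr0 addr0.
by rewrite mulN1r addNr.
Qed.

Lemma functionalZ a f : f \in L -> F (fun x => a * f x) = a * F f.
Proof.
move=> Lf; have := bF.1 a _ _ Lf (Lfun_cst0 mu r1).
by under [X in F X]eq_fun do rewrite addr0; rewrite functional0 addr0.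
Qed.

Lemma functionalD f g : f \in L -> g \in L -> F (fun x => f x + g x) = F f + F g.
Proof.
move=> Lf Lg; have := bF.1 1 _ _ Lf Lg.
by under [X in F X]eq_fun do rewrite mul1r; rewrite mul1r.
Qed.

Lemma functionalB f g : f \in L -> g \in L -> F (fun x => f x - g x) = F f - F g.
Proof.
move=> Lf Lg; have := bF.1 (-1) _ _ Lg Lf.
by under [X in F X]eq_fun do rewrite mulN1r addrC; rewrite mulN1r addrC.
Qed.

Lemma functional_sum I (s : seq I) (G : I -> T -> R) : (forall i, G i \in L) ->
  F (fun x => \sum_(i <- s) G i x) = \sum_(i <- s) F (G i).
Proof.
move=> LG; elim: s => [|i s IH].
  by under eq_fun do rewrite big_nil; rewrite big_nil functional0.
under eq_fun do rewrite big_cons; rewrite big_cons functionalD ?IH//.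
exact: Lfun_sum.
Qed.

Lemma functional_le f : f \in L -> `|F f| <= C * lpn mu r f.
Proof.
move=> Lf; rewrite ler_norml bF.2// andbT lerNl.
rewrite -mulN1r -functionalZ//.
have := bF.2 _ (LfunZ r1 (-1) Lf).
by rewrite lpnZ// normrN normr1 mul1r.
Qed.

(** Dominated convergence is what continuity of the functional yields on pointwise limits. *)
Lemma functional_cvg (f : nat -> T -> R) g h : (forall k, measurable_fun setT (f k)) ->
  h \in L -> (forall k x, `|f k x| <= `|h x|) ->
  (forall x, f ^~ x @ \oo --> g x) -> g \in L /\ F (f k) @[k --> \oo] --> F g.
Proof.
move=> mf Lh fh fg.
have Lf k : f k \in L by exact: (lpn_le r1 (mf k) Lh (fh k)).1.
have mg : measurable_fun setT g.
  by apply: (measurable_fun_cvg mf) => x _; exact: fg.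
have gh x : `|g x| <= `|h x|.
  have cn : `|f k x| @[k --> \oo] --> `|g x|.
    exact: (@cvg_norm R R^o nat \oo _ (fun k => f k x) _ (fg x)).
  by apply: (cvgr_to_le cn); exact: nearW.
have Lg : g \in L := (lpn_le r1 mg Lh gh).1.
split=> //.
have Lh2 : (fun x => 2 * h x) \in L by exact: LfunZ.
have cv : lpn mu r (fun x => f k x - g x) @[k --> \oo] --> 0.
  apply: (@lpn_cvg0 (fun k x => f k x - g x) (fun x => 2 * h x)) => //.
  - by move=> k; exact: measurable_funB.
  - move=> k x; apply: le_trans (ler_normB _ _) _.
    rewrite normrM gtr0_norm//; have := fh k x; have := gh x.
    by move=> A B; rewrite mulrDl mul1r; exact: lerD.
  - move=> x; have : f ^~ x k - g x @[k --> \oo] --> g x - g x.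
      by apply: cvgB; [exact: fg|exact: cvg_cst].
    by rewrite subrr.
have cvC : C * lpn mu r (fun x => f k x - g x) @[k --> \oo] --> 0.
  by rewrite -[X in _ --> X](mulr0 C); apply: cvgM => //; exact: cvg_cst.
apply/cvgrPdist_lt => e e0; move/cvgrPdist_lt : cvC => /(_ _ e0).
apply: filterS => k; rewrite sub0r normrN => H.
rewrite distrC -functionalB//; apply: le_lt_trans (functional_le _) _.
  have := LfunD r1 (Lf k) (LfunZ r1 (-1) Lg).
  by under eq_fun do rewrite mulN1r.
exact: le_lt_trans (ler_norm _) H.
Qed.

End functional.
End lp_dominated_convergence.

(** * The dual of L^r *)

(** It is infinite for r = 1, so that both endpoints of the duality between L^r and its dual are
covered by one statement. *)
Definition conjugate {R : realType} (r : R) : \bar R :=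
  if r == 1 then +oo%E else (r / (r - 1))%:E.

Section hoelder_inequality.
Context d (T : measurableType d) (R : realType).
Variables (mu : {measure set T -> \bar R}) (r : R) (r1 : 1 <= r).
Notation L := (Lfun mu r%:E).

Let r0 : 0 < r. Proof. exact: lt_le_trans r1. Qed.

(** For r = 1 this is the essential bound of [g]; otherwise Hoelder's inequality. *)
Lemma ge0_hoelder (f g : T -> R) (C : R) : 0 <= C -> f \in L -> measurable_fun setT g ->
  ('N[mu]_(conjugate r)[EFin \o g] <= C%:E)%E ->
  (\int[mu]_x (`|f x * g x|)%:E <= (C * lpn mu r f)%:E)%E.
Proof.
move=> C0 Lf mg gC; have mf : measurable_fun setT f by have [] := (LfunE mu r f).1 Lf.
have mfg : measurable_fun setT (f \* g) by exact: measurable_funM.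
move: r1; rewrite le_eqVlt => /predU1P[r1'|r1'].
  have If := integral_powR_lpn r1 Lf.
  rewrite -r1' powRr1 ?lpn_ge0// in If.
  rewrite EFinM -r1' -If -ge0_integralZl//; last first.
    by apply/measurable_EFinP; apply: measurable_powRl; exact: measurableT_comp.
  apply: ae_ge0_le_integral => //.
  - by apply/measurable_EFinP; exact: measurableT_comp.
  - by move=> x _; rewrite mule_ge0 ?lee_fin// powR_ge0.
  - apply: measurable_funeM; apply/measurable_EFinP; apply: measurable_powRl.
    exact: measurableT_comp.
  rewrite /conjugate -r1' eqxx unlock in gC.
  have gCae : \forall x \ae mu, (`|g x|%:E <= C%:E)%E.
    move: gC; case: ifPn => [_ /ess_supP //|m0 _].
    exists setT; split => //; apply/eqP; rewrite eq_le measure_ge0 andbT leNgt//.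
  apply: filterS gCae => x; rewrite lee_fin => gx _.
  by rewrite -EFinM lee_fin powRr1// normrM mulrC ler_wpM2r.
rewrite /conjugate gt_eqF// in gC.
have q0 : 0 < r / (r - 1) by rewrite divr_gt0// subr_gt0.
have rq : r^-1 + (r / (r - 1))^-1 = 1.
  by rewrite invf_div -[X in X + _]mul1r -mulrDl addrC subrK divff// gt_eqF.
have := hoelder mu mf mg r0 q0 rq.
rewrite Lnorm1 -lpnE// => H; apply: le_trans H _.
by rewrite [C * _]mulrC (EFinM (lpn mu r f)) lee_wpmul2l// lee_fin lpn_ge0.
Qed.

Lemma integrable_hoelder (f g : T -> R) (C : R) : 0 <= C -> f \in L -> measurable_fun setT g ->
  ('N[mu]_(conjugate r)[EFin \o g] <= C%:E)%E ->
  mu.-integrable setT (fun x => (f x * g x)%:E).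
Proof.
move=> C0 Lf mg gC; have mf : measurable_fun setT f by have [] := (LfunE mu r f).1 Lf.
apply/integrableP; split.
  by apply/measurable_EFinP; exact: measurable_funM.
exact: le_lt_trans (ge0_hoelder C0 Lf mg gC) (ltry _).
Qed.

Lemma hoelder_le (f g : T -> R) (C : R) : 0 <= C -> f \in L -> measurable_fun setT g ->
  ('N[mu]_(conjugate r)[EFin \o g] <= C%:E)%E ->
  `|\int[mu]_x (f x * g x)| <= C * lpn mu r f.
Proof.
move=> C0 Lf mg gC; rewrite -lee_fin; apply: le_trans (ge0_hoelder C0 Lf mg gC).
have mf : measurable_fun setT f by have [] := (LfunE mu r f).1 Lf.
rewrite EFin_normr_Rintegral//; last exact: integrable_hoelder gC.
apply: le_abse_integral => //.
by apply/measurable_EFinP; exact: measurable_funM.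
Qed.

End hoelder_inequality.

Section riesz.
Context d (T : measurableType d) (R : realType).
Variables (mu : {sigma_finite_measure set T -> \bar R}) (r C : R).
Hypotheses (r1 : 1 <= r) (C0 : 0 <= C).
Variables (F : (T -> R) -> R) (w : T -> R).
Notation L := (Lfun mu r%:E).
Hypotheses (bF : bounded_functional mu r C F) (w0 : forall x, 0 < w x) (Lw : w \in L).
Implicit Types f g h : T -> R.

Let r0 : 0 < r. Proof. exact: lt_le_trans r1. Qed.

Let mw : measurable_fun setT w. Proof. by have [] := (LfunE mu r w).1 Lw. Qed.

Let nu (A : set T) : \bar R := (F (fun x => w x * \1_A x))%:E.

Let Lw1 (A : set T) : measurable A -> (fun x => w x * \1_A x) \in L.
Proof.
move=> mA; apply: (lpn_le r1 _ Lw _).1.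
  by apply: measurable_funM => //; exact: measurable_indic.
move=> x; rewrite normrM ler_piMr// indicE.
by case: (x \in A); rewrite ?normr1 ?normr0.
Qed.

Let nu0 : nu set0 = 0%E.
Proof.
rewrite /nu (_ : (fun _ => _) = cst 0) ?(functional0 r1 bF)//.
by apply/funext => x; rewrite indic0 mulr0.
Qed.

Let nu_fin A : measurable A -> nu A \is a fin_num. Proof. by []. Qed.

(** The functions w 1_(A_0 u ... u A_k) are dominated by [w] and converge pointwise. *)
Let nu_sigma_additive : semi_sigma_additive nu.
Proof.
move=> A mA tA mU; rewrite /nu.
have S1 k x : \sum_(i < k) \1_(A i) x = \1_(\big[setU/set0]_(i < k) A i) x :> R.
  apply: EFin_inj; rewrite -sumEFin.
  have mS : measurable (\big[setU/set0]_(i < k) A i) by exact: bigsetU_measurable.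
  by have := @measure_semi_additive _ _ _ (dirac x : {measure set T -> \bar R}) A k mA tA mS.
have E k : (\sum_(0 <= i < k) nu (A i))%E =
    (F (fun x => w x * \1_(\big[setU/set0]_(i < k) A i) x))%:E.
  rewrite sumEFin big_mkord -(functional_sum r1 bF (index_enum 'I_k)
    (G := fun (i : 'I_k) x => w x * \1_(A i) x)); last by move=> i; exact: Lw1.
  by congr (F _)%:E; apply/funext => x; rewrite -mulr_sumr S1.
rewrite (funext E); apply: cvg_EFin; first exact: nearW.
apply: (functional_cvg r1 bF _ Lw _ _).2.
- move=> k; apply: measurable_funM => //; apply: measurable_indic.
  exact: bigsetU_measurable.
- move=> k x; rewrite normrM ler_piMr// indicE.
  by case: (x \in _); rewrite ?normr1 ?normr0.
- move=> x; apply: cvgM; first exact: cvg_cst.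
  have := @measure_semi_sigma_additive _ _ _ (dirac x : {measure set T -> \bar R}) A mA tA mU.
  rewrite (_ : (fun k => _) = EFin \o (fun k => \1_(\big[setU/set0]_(i < k) A i) x)).
    by move/fine_cvgP => [].
  by apply/funext => k /=; rewrite -S1 sumEFin big_mkord.
Qed.

HB.instance Definition _ := isCharge.Build _ _ _ nu nu0 nu_fin nu_sigma_additive.

Let nu_mu : nu `<< mu.
Proof.
apply/null_content_dominatesP => A mA A0; rewrite /nu; congr EFin.
apply/eqP; rewrite -normr_le0.
apply: le_trans (functional_le r1 bF (Lw1 mA)) _.
rewrite (_ : lpn _ _ _ = 0) ?mulr0//.
have : ((lpn mu r (fun x => w x * \1_A x)) `^ r)%:E = 0%E.
  rewrite -(integral_powR_lpn r1 (Lw1 mA)).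
  rewrite (_ : (fun _ => _) = (fun x => (`|w x| `^ r)%:E) \_ A); last first.
    apply/funext => x; rewrite patchE indicE.
    by case: (x \in A); rewrite ?mulr1// mulr0 normr0 powR0// gt_eqF.
  rewrite -integral_mkcond; apply: null_set_integral => //.
  apply: measurable_funTS; apply/measurable_EFinP; apply: measurable_powRl.
  exact: measurableT_comp.
by move=> [/powR_eq0_eq0].
Qed.

Let phi x : R := fine (Radon_Nikodym nu mu x).

Let phiE x : (phi x)%:E = Radon_Nikodym nu mu x.
Proof. by rewrite fineK//; exact: Radon_Nikodym_fin_num. Qed.

Let phi_int : mu.-integrable setT (EFin \o phi).
Proof.
rewrite (_ : _ \o _ = Radon_Nikodym nu mu); first exact: Radon_Nikodym_integrable.
by apply/funext => x; rewrite /= phiE.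
Qed.

Let nu_phi A : measurable A ->
  (F (fun x => w x * \1_A x))%:E = (\int[mu]_(x in A) (phi x)%:E)%E.
Proof.
move=> mA; rewrite -[LHS]/(nu A) (Radon_Nikodym_integral nu_mu mA).
by apply: eq_integral => x _; rewrite phiE.
Qed.

Let g x := phi x / w x.

Let mphi : measurable_fun setT phi.
Proof. by apply/measurable_EFinP; exact: measurable_int phi_int. Qed.

Let mg : measurable_fun setT g.
Proof. 
apply: measurable_funM => //.
rewrite (_ : (fun _ => _) = (fun x => w x `^ (-1))); first exact: measurable_powRl.
by apply/funext => x; rewrite powR_inv1// ltW.
 Qed.

Import HBNNSimple.

(** On w 1_A this is the definition of the charge; extend by linearity. *)
Let simple_phi (s : {nnsfun T >-> R}) :
  (F (fun x => w x * s x))%:E = (\int[mu]_x (s x * phi x)%:E)%E.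
Proof.
pose rs : seq R := finmap.enum_fset (fset_set (range s)).
pose A y := s @^-1` [set y].
have mA y : measurable (A y) by exact: measurable_sfunP.
have sE x : s x = \sum_(y <- rs) y * \1_(A y) x.
  by rewrite fimfunE fsbig_finite.
have -> : (fun x => w x * s x) = (fun x => \sum_(y <- rs) y * (w x * \1_(A y) x)).
  by apply/funext => x; rewrite sE mulr_sumr; apply: eq_bigr => i _; rewrite mulrCA.
rewrite (functional_sum r1 bF rs (G := fun y x => y * (w x * \1_(A y) x))); last first.
  by move=> y; apply: LfunZ => //; exact: Lw1.
have iA y : mu.-integrable setT ((EFin \o phi) \* (EFin \o \1_(A y)))%E.
  have := (integrable_mkcond (EFin \o phi) (mA y)).1
    (integrableS measurableT (mA y) (@subsetT _ _) phi_int).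
  by rewrite epatch_indic.
rewrite (eq_integral (fun x => (\sum_(y <- rs)
    y%:E * ((phi x)%:E * (\1_(A y) x)%:E))%E)); last first.
  move=> x _; rewrite sE mulr_suml -sumEFin; apply: eq_bigr => i _.
  by rewrite -!EFinM mulrAC mulrA.
rewrite integral_sum//; last by move=> y; apply: integrableZl => //; exact: iA.
rewrite -sumEFin; apply: eq_bigr => y _.
rewrite integralZl//; last exact: iA.
rewrite (functionalZ r1 bF) ?Lw1// EFinM nu_phi//; congr (_ * _)%E.
by rewrite [LHS]integral_mkcond epatch_indic.
Qed.

(** Approximate f / w from below by simple functions s_k, and use dominated convergence on both
sides of F (w s_k) = integral of s_k phi. *)
Let ge0_phi f : f \in L -> (forall x, 0 <= f x) ->
  mu.-integrable setT (fun x => (f x * g x)%:E) ->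
  (F f)%:E = (\int[mu]_x (f x * g x)%:E)%E.
Proof.
move=> Lf f0 ifg; have mf : measurable_fun setT f by have [] := (LfunE mu r f).1 Lf.
have mfw : measurable_fun setT (fun x => (f x / w x)%:E).
  apply/measurable_EFinP; apply: measurable_funM => //.
  rewrite (_ : (fun _ => _) = (fun x => w x `^ (-1))); first exact: measurable_powRl.
  by apply/funext => x; rewrite powR_inv1// ltW.
have fw0 x : (0 <= (f x / w x)%:E)%E by rewrite lee_fin divr_ge0// ltW.
pose s := nnsfun_approx measurableT mfw.
have sfw k x : s k x <= f x / w x.
  rewrite -lee_fin nnsfun_approxE; exact: le_approx.
have s_cvg x : s k x @[k --> \oo] --> f x / w x.
  have := cvg_nnsfun_approx measurableT mfw (fun x _ => fw0 x) (I : setT x).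
  by move/fine_cvgP => [].
have wsf k x : w x * s k x <= f x by rewrite mulrC -ler_pdivlMr.
have cv1 : F (fun x => w x * s k x) @[k --> \oo] --> F f.
  apply: (functional_cvg r1 bF _ Lf _ _).2.
  - by move=> k; exact: measurable_funM.
  - by move=> k x; rewrite !ger0_norm// mulr_ge0// ltW.
  - move=> x; rewrite -[X in _ --> X](divfK (lt0r_neq0 (w0 x))) mulrC.
    by apply: cvgM => //; exact: cvg_cst.
have cv2 : (\int[mu]_x (s k x * phi x)%:E)%E @[k --> \oo] --> (\int[mu]_x (f x * g x)%:E)%E.
  apply: (@dominated_cvg _ _ _ mu setT measurableT (fun k x => (s k x * phi x)%:E)
    (fun x => (f x * g x)%:E) (fun x => `|(f x * g x)%:E|%E)) => //.
  - by move=> k; apply/measurable_EFinP; exact: measurable_funM.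
  - move=> x _; apply: cvg_EFin; first by apply: nearW => k.
    rewrite /g mulrA mulrAC; apply: cvgM => //; exact: cvg_cst.
  - exact: integrable_abse.
  - move=> k x _; have H : `|s k x * phi x| <= `|f x * g x|.
      rewrite /g mulrA [f x * _]mulrC [phi x * f x / _]mulrAC -mulrA.
      rewrite normrM [X in _ <= X]normrM mulrC ler_wpM2l//.
      rewrite [_^-1 * _]mulrC (ger0_norm (divr_ge0 (f0 x) (ltW (w0 x)))) ger0_norm//.
    by rewrite lee_fin.
apply: (@cvg_unique _ (@ereal_hausdorff R) ((F (fun x => w x * s k x))%:E @[k --> \oo])).
  by apply: cvg_EFin; [exact: nearW|].
by rewrite (funext (fun k => simple_phi (s k))).
Qed.

Let dominated_fg f f' : measurable_fun setT f' -> (forall x, `|f' x| <= `|f x|) ->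
  mu.-integrable setT (fun x => (f x * g x)%:E) ->
  mu.-integrable setT (fun x => (f' x * g x)%:E).
Proof.
move=> mf' le; apply: le_integrable => //.
  by apply/measurable_EFinP; exact: measurable_funM.
move=> x _; have H : `|f' x * g x| <= `|f x * g x| by rewrite !normrM ler_wpM2r.
by rewrite lee_fin.
Qed.

(** Positive and negative parts reduce to the case of a nonnegative function. *)
Let represented f : f \in L -> mu.-integrable setT (fun x => (f x * g x)%:E) ->
  (F f)%:E = (\int[mu]_x (f x * g x)%:E)%E.
Proof.
move=> Lf ifg; have mf : measurable_fun setT f by have [] := (LfunE mu r f).1 Lf.
pose fp x := Num.max (f x) 0; pose fm x := Num.max (- f x) 0.
have mfp : measurable_fun setT fp by exact: measurable_maxr.
have mfm : measurable_fun setT fm by apply: measurable_maxr => //; exact: measurable_funN.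
have fp0 x : 0 <= fp x by rewrite le_max lexx orbT.
have fm0 x : 0 <= fm x by rewrite le_max lexx orbT.
have fpf x : `|fp x| <= `|f x|.
  by rewrite ger0_norm// ge_max ler_norm normr_ge0.
have fmf x : `|fm x| <= `|f x|.
  by rewrite ger0_norm// ge_max normr_ge0 andbT -normrN ler_norm.
have fE : f = (fun x => fp x - fm x).
  apply/funext => x; rewrite /fp /fm; case: (leP 0 (f x)) => f0.
    by rewrite max_r ?subr0// oppr_le0.
  by rewrite max_l ?oppr_ge0 ?(ltW f0)// sub0r opprK.
have Lfp : fp \in L := (lpn_le r1 mfp Lf fpf).1.
have Lfm : fm \in L := (lpn_le r1 mfm Lf fmf).1.
have -> : F f = F fp - F fm := etrans (congr1 F fE) (functionalB bF Lfp Lfm).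
rewrite EFinB !ge0_phi//; last 2 first.
- exact: dominated_fg ifg.
- exact: dominated_fg ifg.
rewrite -integralB//; last 2 first.
- exact: dominated_fg ifg.
- exact: dominated_fg ifg.
by apply: eq_integral => x _; rewrite -EFinB -mulrBl; congr (_ * _)%:E; rewrite [in RHS]fE.
Qed.

(** Take sgn(g) h as argument of the functional. The bound by a multiple of [w] places the test
function in L^r and keeps its product with [g] integrable before anything is known on [g]. *)
Let test h k : measurable_fun setT h -> (forall x, 0 <= h x <= k * w x) ->
  h \in L /\ (\int[mu]_x (h x * `|g x|)%:E <= (C * lpn mu r h)%:E)%E.
Proof.
move=> mh hk.
have h0 x : 0 <= h x by have /andP[] := hk x.
have hkw x : h x <= k * w x by have /andP[] := hk x.
have Lh : h \in L.
  apply: (lpn_le r1 mh (LfunZ r1 k Lw) _).1 => x.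
  by rewrite ger0_norm// (le_trans (hkw x))// ler_norm.
split=> //.
pose f x := if 0 <= g x then h x else - h x.
have mf : measurable_fun setT f.
  apply: measurable_fun_ifT => //; last exact: measurable_funN.
  exact: measurable_fun_ler.
have fh x : `|f x| = h x by rewrite /f; case: ifP; rewrite ?normrN ger0_norm.
have fh' x : `|f x| <= `|h x| by rewrite fh ger0_norm.
have Lf : f \in L := (lpn_le r1 mf Lh fh').1.
have -> : (fun x => (h x * `|g x|)%:E) = (fun x => (f x * g x)%:E).
  apply/funext => x; rewrite /f; case: (leP 0 (g x)) => g0.
    by rewrite ger0_norm.
  by rewrite ltr0_norm// mulrN mulNr.
rewrite -represented//.
  rewrite lee_fin; apply: le_trans (bF.2 _ Lf) _.
  by rewrite ler_wpM2l//; exact: (lpn_le r1 mf Lh fh').2.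
have := integrableZl measurableT k phi_int.
apply: le_integrable => //.
  by apply/measurable_EFinP; exact: measurable_funM.
move=> x _; have H : `|f x * g x| <= `|k * phi x|.
  rewrite normrM fh.
  have -> : phi x = w x * g x by rewrite /g mulrC divfK// gt_eqF.
  rewrite [k * _]mulrA [X in _ <= X]normrM ler_wpM2r//.
  exact: le_trans (hkw x) (ler_norm _).
by rewrite lee_fin.
Qed.

Let wcut k x := k%:R^-1 <= w x.

Let mwcut k : measurable_fun setT (wcut k).
Proof. exact: measurable_fun_ler. Qed.

Let wcut_le k x : (0 < k)%N -> wcut k x -> 1 <= k%:R * w x.
Proof.
move=> k0; rewrite /wcut -(@ler_pM2l _ k%:R) ?ltr0n// mulfV//.
by rewrite pnatr_eq0 -lt0n.
Qed.

Let wcut_near x : \forall k \near \oo, wcut k x.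
Proof.
have iw0 : 0 < (w x)^-1 by rewrite invr_gt0.
near=> k; rewrite /wcut -[w x]invrK lef_pV2 ?posrE//; last first.
  by rewrite ltr0n; near: k; exact: nbhs_infty_gt.
by apply: ltW; near: k; exact: nbhs_infty_gtr.
Unshelve. all: by end_near. Qed.

(** Testing with |g|^(q-1), cut off where [g] is large or [w] is small, gives I <= C I^(1/r) for the
integral I of |g|^q over the remaining set; let the cut-off tend to infinity. *)
Let Lq_bound : 1 < r ->
  ('N[mu]_((r / (r - 1))%:E)[EFin \o g] <= C%:E)%E.
Proof.
move=> r1'; set q := r / (r - 1).
have r1p : 0 < r - 1 by rewrite subr_gt0.
have q0 : 0 < q by rewrite divr_gt0.
have qm : q - 1 = (r - 1)^-1.
  by rewrite /q -{2}(divff (lt0r_neq0 r1p)) -mulrBl opprB addrC subrK mul1r.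
have qm0 : 0 < q - 1 by rewrite qm invr_gt0.
have qr : (q - 1) * r = q by rewrite qm /q mulrC.
pose b k x := (`|g x| <= k%:R) && wcut k x.
have mb k : measurable_fun setT (b k).
  by apply: measurable_and => //; apply: measurable_fun_ler => //; exact: measurableT_comp.
pose h k x := if b k x then `|g x| `^ (q - 1) else 0.
have mh k : measurable_fun setT (h k).
  apply: measurable_fun_ifT => //; apply: measurable_powRl; exact: measurableT_comp.
have hg k x : h k x * `|g x| = if b k x then `|g x| `^ q else 0.
  rewrite /h; case: ifP => _; last by rewrite mul0r.
  have [->|g0] := eqVneq (g x) 0; first by rewrite normr0 mulr0 powR0// gt_eqF.
  rewrite -[X in _ * X]powRr1// -powRD ?subrK//.
  by apply/implyP; rewrite normr_eq0.
have hr k x : `|h k x| `^ r = if b k x then `|g x| `^ q else 0.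
  rewrite /h; case: ifP => _; last by rewrite normr0 powR0// gt_eqF.
  by rewrite ger0_norm ?powR_ge0// -powRrM qr.
have key k : (0 < k)%N -> (\int[mu]_x (if b k x then `|g x| `^ q else 0)%:E <= (C `^ q)%:E)%E.
  move=> k0.
  have [|Lh] := @test (h k) (k%:R `^ (q - 1) * k%:R) (mh k).
    move=> x; rewrite /h; case: ifP => [/andP[gk wk]|_]; last first.
      by rewrite lexx !mulr_ge0 ?powR_ge0// ltW.
    rewrite powR_ge0 /= -mulrA; apply: (@le_trans _ _ (k%:R `^ (q - 1) * 1)).
      by rewrite mulr1 ge0_ler_powR ?nnegrE// ltW.
    by rewrite ler_wpM2l ?powR_ge0//; exact: wcut_le.
  under eq_integral do rewrite hg.
  have := integral_powR_lpn r1 Lh.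
  under eq_integral do rewrite hr.
  move=> ->; rewrite !lee_fin; have := lpn_ge0 mu r (h k).
  move: (lpn mu r (h k)) => I; rewrite le_eqVlt => /predU1P[<- _|I0].
    by rewrite powR0 ?powR_ge0// gt_eqF.
  have -> : I `^ r = I `^ (r - 1) * I.
    rewrite -[X in _ * X]powRr1 ?(ltW I0)// -powRD ?subrK//.
    by apply/implyP; rewrite gt_eqF.
  rewrite ler_pM2r// => IC.
  have -> : I `^ (r - 1) * I = (I `^ (r - 1)) `^ q.
    rewrite -powRrM /q mulrCA mulfV ?gt_eqF// mulr1.
    rewrite -[X in _ * X]powRr1 ?(ltW I0)// -powRD ?subrK//.
    by apply/implyP; rewrite gt_eqF.
  by apply: ge0_ler_powR; rewrite ?nnegrE ?powR_ge0// ltW.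
have le : (\int[mu]_x (`|g x| `^ q)%:E <= (C `^ q)%:E)%E.
  apply: (@fatou_le _ _ _ mu (fun k x => (if b k.+1 x then `|g x| `^ q else 0)%:E)).
  - move=> k; apply/measurable_EFinP; apply: measurable_fun_ifT => //.
    by apply: measurable_powRl; exact: measurableT_comp.
  - by move=> k x; rewrite lee_fin; case: ifP; rewrite ?powR_ge0.
  - move=> x; apply: cvg_near_cst.
    have H : \forall k \near \oo, b k x.
      near=> k; apply/andP; split; near: k; last exact: wcut_near.
      by apply: filterS (nbhs_infty_gtr `|g x|) => k /ltW.
    by case: H => N _ H; exists N => // k /= Nk; rewrite H//=; exact: leqW.
  - by move=> k; exact: key.
rewrite unlock; under eq_integral do rewrite poweR_EFin.
have -> : C%:E = ((C `^ q)%:E `^ q^-1)%E.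
  by rewrite poweR_EFin -powRrM mulfV ?gt_eqF// powRr1.
apply: gt0_ler_poweR => //; first by rewrite invr_ge0 ltW.
  by apply: in_itv0y; apply: integral_ge0 => x _; rewrite lee_fin powR_ge0.
by apply: in_itv0y; rewrite lee_fin powR_ge0.
Unshelve. all: by end_near. Qed.

(** Testing with the indicator of a set on which |g| >= C + 1/k shows that this set is null. *)
Let Ly_bound : r = 1 -> ('N[mu]_+oo[EFin \o g] <= C%:E)%E.
Proof.
move=> r1'.
pose b k x := (C + k%:R^-1 <= `|g x|) && wcut k x.
have mb k : measurable_fun setT (b k).
  by apply: measurable_and => //; apply: measurable_fun_ler => //; exact: measurableT_comp.
pose A k := [set x | b k x].
have mA k : measurable (A k) by rewrite -[X in measurable X]setTI; exact: mb.
have A0 k : (0 < k)%N -> mu (A k) = 0%E.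
  move=> k0; have m1 : measurable_fun setT (\1_(A k) : T -> R) by exact: measurable_indic.
  have h1 x : 0 <= (\1_(A k) x : R) <= k%:R * w x.
    rewrite indicE; have [|_] := boolP (x \in A k); last by rewrite lexx mulr_ge0// ltW.
    by rewrite inE ler01 => /andP[_ /wcut_le ->].
  have [Lh le] := test m1 h1.
  have I := integral_powR_lpn r1 Lh.
  have E : (\int[mu]_x (\1_(A k) x)%:E = (lpn mu r \1_(A k))%:E)%E.
    have P : lpn mu r (\1_(A k)) `^ r = lpn mu r (\1_(A k)).
      by rewrite [X in _ `^ X]r1' powRr1// lpn_ge0.
    rewrite -P -I; by apply: eq_integral => x _; rewrite r1' powRr1// ger0_norm.
  have E' := E; rewrite integral_indic// setIT in E'; rewrite E'; congr EFin.
  have le' : (((C + k%:R^-1) * lpn mu r \1_(A k))%:E <= (C * lpn mu r \1_(A k))%:E)%E.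
    apply: le_trans le; rewrite EFinM -E.
    rewrite -ge0_integralZl//; last 2 first.
      by apply/measurable_EFinP; exact: measurable_indic.
      by rewrite lee_fin addr_ge0.
    apply: ge0_le_integral => //.
    - by move=> x _; rewrite mule_ge0// lee_fin addr_ge0.
    - by apply: measurable_funeM; apply/measurable_EFinP; exact: measurable_indic.
    - apply/measurable_EFinP; apply: measurable_funM; last exact: measurableT_comp.
      exact: measurable_indic.
    - move=> x _; rewrite -EFinM lee_fin mulrC indicE.
      have [|_] := boolP (x \in A k); last by rewrite !mul0r.
      by rewrite inE => /andP[H _]; rewrite !mul1r.
  move: le'; rewrite lee_fin mulrDl gerDl pmulr_rle0 ?invr_gt0 ?ltr0n// => H.
  by apply/eqP; rewrite eq_le H lpn_ge0.
rewrite unlock; case: ifPn => // _; apply/ess_supP.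
have : mu.-negligible (\bigcup_k A k.+1).
  apply: negligible_bigcup => k; apply/negligibleP => //; exact: A0.
apply: negligibleS => x /= /negP; rewrite -ltNge lte_fin => gC.
have e0 : 0 < `|g x| - C by rewrite subr_gt0.
have H : \forall k \near \oo, b k x.
  near=> k; apply/andP; split; last by near: k; exact: wcut_near.
  rewrite addrC -lerBrDr -[X in _ <= X]invrK lef_pV2 ?posrE ?invr_gt0//.
    by apply: ltW; near: k; exact: nbhs_infty_gtr.
  by rewrite ltr0n; near: k; exact: nbhs_infty_gt.
by case: H => N _ H; exists N => //; apply: H => /=.
Unshelve. all: by end_near. Qed.

(** The set function A |-> F (w 1_A) is a charge, finite because the weight [w] is in L^r even
when the measure is not finite. Its density with respect to [mu], divided by [w], represents F on
simple multiples of [w], then on all functions whose product with it is integrable; testing on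
suitable functions places it in the conjugate space, and Hoelder's inequality removes the
integrability condition. *)
Theorem riesz_representation : exists g : T -> R,
  [/\ measurable_fun setT g, ('N[mu]_(conjugate r)[EFin \o g] <= C%:E)%E &
    forall f, f \in L -> F f = \int[mu]_x (f x * g x)].
Proof.
have gC : ('N[mu]_(conjugate r)[EFin \o g] <= C%:E)%E.
  rewrite /conjugate; have [e1|ne1] := eqVneq r 1; first exact: Ly_bound.
  by apply: Lq_bound; rewrite lt_neqAle eq_sym ne1.
exists g; split => // f Lf; apply: EFin_inj.
have ifg := integrable_hoelder r1 C0 Lf mg gC.
by rewrite represented// /Rintegral fineK//; exact: integrable_fin_num.
Qed.

End riesz.

(** * Smooth functions with derivatives in L^r, through real and imaginary parts *)

(** The word in which the letters of [s] are sorted, as in the definition of [mpartial]. *)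
Lemma count_words_perm n (s : seq 'I_n) :
  perm_eq (flatten [seq nseq (count_mem i s) i | i <- enum 'I_n]) s.
Proof.
rewrite /perm_eq; apply/allP => x _ /=; apply/eqP.
rewrite count_flatten -map_comp sumnE big_map big_enum /=.
rewrite (bigD1 x)//= big1 => [|i ix]; last by rewrite count_nseq /= (negbTE ix).
by rewrite count_nseq /= eqxx mul1n addn0.
Qed.

Lemma sum_count_mem n (s : seq 'I_n) : (\sum_i count_mem i s = size s)%N.
Proof.
rewrite -(perm_size (count_words_perm s)) size_flatten /shape -map_comp sumnE big_map.
by rewrite big_enum; apply: eq_bigr => i _; rewrite /= size_nseq.
Qed.

Lemma uniq_words n k : uniq (@words n k).
Proof.
elim: k => [//|k IH] /=; apply/andP; split.
  by apply/negP => /allpairsP[[i s] []].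
by apply: allpairs_uniq => //; [exact: enum_uniq|move=> [i s] [j t] _ _ /= [-> ->]].
Qed.

Lemma sobn_mono (R : realType) n (r : R) k m (g : 'rV[R]_n -> R) :
  (k <= m)%N -> sobn r k g <= sobn r m g.
Proof.
move=> km; rewrite /sobn.
have sub : {subset @words n k <= @words n m}.
  by move=> s; rewrite !mem_words => sk; exact: leq_trans km.
elim: (@words n k) (@words n m) (uniq_words n k) sub => [|s L IH] M /= uL sub.
  by rewrite big_nil sumr_ge0// => s _; exact: lpn_ge0.
have sM : s \in M by apply: sub; rewrite inE eqxx.
move: uL => /andP[sL uL]; rewrite big_cons (big_rem s sM) /= lerD2l; apply: IH => // t tL.
have ts : t != s by apply: contraNneq sL => <-.
have := sub t; rewrite inE tL orbT => /(_ isT) tM.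
by have := perm_mem (perm_to_rem sM) t; rewrite tM inE (negbTE ts).
Qed.

Section modulus.
Context {R : realType}.
Implicit Types z : R[i].

Lemma normr_Re_le z : `|complex.Re z| <= cmodulus z.
Proof.
case: z => a b; rewrite /cmodulus /= -sqrtr_sqr; apply: ler_wsqrtr.
by rewrite lerDl sqr_ge0.
Qed.

Lemma normr_Im_le z : `|complex.Im z| <= cmodulus z.
Proof.
case: z => a b; rewrite /cmodulus /= -sqrtr_sqr; apply: ler_wsqrtr.
by rewrite lerDr sqr_ge0.
Qed.

Lemma cmodulus_le z : cmodulus z <= `|complex.Re z| + `|complex.Im z|.
Proof.
case: z => a b; rewrite /cmodulus /=.
rewrite -[X in _ <= X]ger0_norm ?addr_ge0// -sqrtr_sqr; apply: ler_wsqrtr.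
by rewrite sqrrD !real_normK ?num_real// lerD2r lerDl mulrn_wge0// mulr_ge0.
Qed.

End modulus.

Section components.
Context {R : realType} {n : nat} (r : R) (r1 : 1 <= r).
Notation lp := (lpn (leb n) r).
Notation Lp := (Lfun (leb n) r%:E).
Implicit Types f : 'rV[R]_n -> R[i].
Local Notation re f := (fun x => complex.Re (f x)).
Local Notation im f := (fun x => complex.Im (f x)).

Lemma cLnorm_leb (q : \bar R) f :
  cLnorm q f = 'N[leb n]_q[EFin \o (fun x => cmodulus (f x))]%E.
Proof. by rewrite /cLnorm lebE. Qed.

Lemma cLfun_modulus f : cLfun r%:E f -> (fun x => cmodulus (f x)) \in Lp.
Proof.
by move=> [mf fy]; apply/LfunE; rewrite -cLnorm_leb; split=> //; exact: measurable_cmodulus.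
Qed.

(** |Re z| and |Im z| are at most |z|, which is at most |Re z| + |Im z|. *)
Lemma cLfun_components f : cLfun r%:E f ->
  [/\ re f \in Lp, im f \in Lp, ((lp (re f))%:E <= cLnorm r%:E f)%E &
    ((lp (im f))%:E <= cLnorm r%:E f)%E].
Proof.
move=> cf; have LM := cLfun_modulus cf; have [[mre mim] _] := cf.
have [x|Lre lre] := lpn_le r1 mre LM; first by apply: le_trans (normr_Re_le _) (ler_norm _).
have [x|Lim lim] := lpn_le r1 mim LM; first by apply: le_trans (normr_Im_le _) (ler_norm _).
by split=> //; rewrite cLnorm_leb -lpnE// lee_fin.
Qed.

Lemma components_cLfun f : re f \in Lp -> im f \in Lp ->
  cLfun r%:E f /\ (cLnorm r%:E f <= (lp (re f) + lp (im f))%:E)%E.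
Proof.
move=> Lre Lim; have [mre _] := (LfunE _ _ _).1 Lre; have [mim _] := (LfunE _ _ _).1 Lim.
have cm : cmeasurable f by [].
have LS := LfunD r1 (Lfun_norm_powR r1 Lre) (Lfun_norm_powR r1 Lim).
have [x|LM le] := lpn_le r1 (measurable_cmodulus cm) LS.
  rewrite [X in _ <= X]ger0_norm ?addr_ge0// ger0_norm ?cmodulus_ge0//; exact: cmodulus_le.
have le' : (cLnorm r%:E f <= (lp (re f) + lp (im f))%:E)%E.
  rewrite cLnorm_leb -lpnE// lee_fin; apply: le_trans le _.
  apply: le_trans (lpnD r1 (Lfun_norm_powR r1 Lre) (Lfun_norm_powR r1 Lim)) _.
  by rewrite !lpn_norm.
by split=> //; split=> //; exact: le_lt_trans le' (ltry _).
Qed.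

End components.

Section DLp_components.
Context {R : realType} {n : nat} (r : R) (p1 : (1 <= r%:E)%E).
Notation lp := (lpn (leb n) r).
Notation Lp := (Lfun (leb n) r%:E).
Notation D := (DLp n p1).
Implicit Types phi psi : D.

Let r1 : 1 <= r. Proof. by move: p1; rewrite lee_fin. Qed.

Definition Dre phi : 'rV[R]_n -> R := fun x => complex.Re (phi x).
Definition Dim phi : 'rV[R]_n -> R := fun x => complex.Im (phi x).

Let DLpP phi : csmooth phi /\ forall a, cLfun r%:E (cmpartial a phi).
Proof. by have := DLp_valP phi; rewrite inE. Qed.

Lemma partials_mpartial s (g : 'rV[R]_n -> R) : smooth g ->
  partials s g = mpartial [ffun i => count_mem i s] g.
Proof.
move=> sg; rewrite mpartialE; apply: perm_partials => //.
rewrite perm_sym; have := count_words_perm s.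
by congr (perm_eq (flatten _) _); apply: eq_map => i; rewrite ffunE.
Qed.

Let lp_seminorm phi s :
  [/\ partials s (Dre phi) \in Lp, partials s (Dim phi) \in Lp,
   ((lp (partials s (Dre phi)))%:E <= DLp_seminorm (size s) phi)%E &
   ((lp (partials s (Dim phi)))%:E <= DLp_seminorm (size s) phi)%E].
Proof.
have [[sre sim] /(_ [ffun i => count_mem i s]) cf] := DLpP phi.
rewrite (partials_mpartial s sre) (partials_mpartial s sim).
have [Lre Lim le le'] := cLfun_components r1 cf.
have le2 : (cLnorm r%:E (cmpartial [ffun i => count_mem i s] phi) <=
    DLp_seminorm (size s) phi)%E.
  apply: ereal_sup_ubound; exists [ffun i => count_mem i s] => //=.
  rewrite (eq_bigr (fun i => count_mem i s)) => [|i _]; last by rewrite ffunE.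
  by rewrite sum_count_mem.
by split=> //; exact: le_trans le2.
Qed.

Lemma sobolev_Dre phi : sobolev r (Dre phi).
Proof.
have [[sre _] _] := DLpP phi; apply: smooth_sobolev => // s.
by have [] := lp_seminorm phi s.
Qed.

Lemma sobolev_Dim phi : sobolev r (Dim phi).
Proof.
have [[_ sim] _] := DLpP phi; apply: smooth_sobolev => // s.
by have [] := lp_seminorm phi s.
Qed.

Lemma sobolev_DLp (g h : 'rV[R]_n -> R) : sobolev r g -> sobolev r h ->
  {phi : D | Dre phi = g /\ Dim phi = h}.
Proof.
move=> sg sh; pose f : 'rV[R]_n -> R[i]^o := fun x => Complex (g x) (h x).
suff Df : f \in DLp_pred r%:E by exists (MkDLp p1 Df).
rewrite inE; split; first by split; [exact: (sobolev_smooth sg)|exact: (sobolev_smooth sh)].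
move=> a; apply: (components_cLfun r1 (f := cmpartial a f) _ _).1.
  rewrite (_ : (fun x => _) = mpartial a g) // mpartialE; exact: sobolev_Lfun.
rewrite (_ : (fun x => _) = mpartial a h) // mpartialE; exact: sobolev_Lfun.
Qed.

(** These norms are equivalent to the seminorms [DLp_seminorm]
([DLp_seminorm_le], [Dnorm_le_seminorm]) and replace them from here on. *)
Definition Dnorm k phi : R := sobn r k (Dre phi) + sobn r k (Dim phi).

Lemma DLp_seminorm_le k phi : (DLp_seminorm k phi <= (Dnorm k phi)%:E)%E.
Proof.
apply: ge_ereal_sup => _ [a ak <-].
pose s := flatten [seq nseq (a i) i | i <- enum 'I_n].
have sk : (size s <= k)%N.
  apply: leq_trans ak; rewrite size_flatten /shape -map_comp sumnE big_map big_enum.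
  by rewrite leq_eqVlt; apply/orP; left; apply/eqP; apply: eq_bigr => i _; rewrite /= size_nseq.
have E1 : (fun x => complex.Re (cmpartial a phi x)) = partials s (Dre phi).
  by rewrite -mpartialE.
have E2 : (fun x => complex.Im (cmpartial a phi x)) = partials s (Dim phi).
  by rewrite -mpartialE.
have := (components_cLfun r1 (f := cmpartial a phi) _ _).2.
rewrite E1 E2 => H; apply: le_trans (H _ _) _.
- exact: sobolev_Lfun (sobolev_Dre phi) s.
- exact: sobolev_Lfun (sobolev_Dim phi) s.
by rewrite lee_fin /Dnorm; apply: lerD; exact: lp_le_sobn.
Qed.

Lemma DLp_seminorm_ge0 k phi : (0 <= DLp_seminorm k phi)%E.
Proof.
have [_ _ + _] := lp_seminorm phi [::] => /= le0.
apply: le_trans (DLp_seminorm_mono phi (leq0n k)); apply: le_trans le0.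
by rewrite lee_fin lpn_ge0.
Qed.

Lemma DLp_seminorm_fin k phi : DLp_seminorm k phi \is a fin_num.
Proof.
rewrite ge0_fin_numE ?DLp_seminorm_ge0//.
exact: le_lt_trans (DLp_seminorm_le k phi) (ltry _).
Qed.

Lemma Dnorm_le_seminorm k phi :
  ((Dnorm k phi)%:E <= ((size (@words n k)).*2%:R)%:E * DLp_seminorm k phi)%E.
Proof.
rewrite -(fineK (DLp_seminorm_fin k phi)) -EFinM lee_fin -addnn natrD mulrDl.
have H s : (size s <= k)%N -> (lp (partials s (Dre phi)) <= fine (DLp_seminorm k phi)) /\
    (lp (partials s (Dim phi)) <= fine (DLp_seminorm k phi)).
  move=> sk; rewrite -!lee_fin (fineK (DLp_seminorm_fin k phi)).
  have [_ _ a b] := lp_seminorm phi s.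
  by split; [apply: le_trans a _|apply: le_trans b _]; exact: DLp_seminorm_mono.
by apply: lerD; apply: sobn_le => s /H[].
Qed.

Lemma Dnorm_ge0 k phi : 0 <= Dnorm k phi.
Proof. by rewrite addr_ge0// sobn_ge0. Qed.

Lemma DreZD (c : R[i]) phi psi : Dre (c *: phi + psi) =
  fun x => complex.Re c * Dre phi x + (- complex.Im c * Dim phi x + Dre psi x).
Proof. by apply/funext => x; rewrite /Dre /Dim /= -ReZD. Qed.

Lemma DimZD (c : R[i]) phi psi : Dim (c *: phi + psi) =
  fun x => complex.Re c * Dim phi x + (complex.Im c * Dre phi x + Dim psi x).
Proof. by apply/funext => x; rewrite /Dre /Dim /= -ImZD. Qed.

Lemma Dnorm_ZD k (c : R[i]) phi psi : Dnorm k (c *: phi + psi) <=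
  (`|complex.Re c| + `|complex.Im c|) * Dnorm k phi + Dnorm k psi.
Proof.
have [sr si] := (sobolev_Dre phi, sobolev_Dim phi).
have [sr' si'] := (sobolev_Dre psi, sobolev_Dim psi).
rewrite /Dnorm DreZD DimZD.
have A := sobn_lin r1 k (complex.Re c) sr (sobolev_lin r1 (- complex.Im c) si sr').
have B := sobn_lin r1 k (- complex.Im c) si sr'; rewrite normrN in B.
have A' := sobn_lin r1 k (complex.Re c) si (sobolev_lin r1 (complex.Im c) sr si').
have B' := sobn_lin r1 k (complex.Im c) sr si'.
apply: le_trans (lerD A A') _; apply: le_trans (lerD (lerD (lexx _) B) (lerD (lexx _) B')) _.
rewrite le_eqVlt; apply/orP; left; apply/eqP.
move: (sobn r k (Dre phi)) (sobn r k (Dim phi)) => a b.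
move: (sobn r k (Dre psi)) (sobn r k (Dim psi)) => a' b'.
by ring.
Qed.

Lemma DnormD k phi psi : Dnorm k (phi + psi) <= Dnorm k phi + Dnorm k psi.
Proof.
have := Dnorm_ZD k 1 phi psi; rewrite scale1r /= normr1 normr0 addr0 mul1r.
exact.
Qed.

Lemma Dnorm0 k : Dnorm k 0 = 0.
Proof.
apply/eqP; rewrite eq_le Dnorm_ge0 andbT -lee_fin.
by apply: le_trans (Dnorm_le_seminorm k 0) _; rewrite DLp_seminorm0 mule0.
Qed.

Lemma DnormZ_le k (c : R[i]) phi : Dnorm k (c *: phi) <= 2 * cmodulus c * Dnorm k phi.
Proof.
have := Dnorm_ZD k c phi 0; rewrite !addr0 Dnorm0 addr0 => H; apply: le_trans H _.
rewrite ler_wpM2r ?Dnorm_ge0// mulrDl mul1r.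
by apply: lerD; [exact: normr_Re_le|exact: normr_Im_le].
Qed.

Lemma DnormZR k (c : R) phi : Dnorm k (c%:C%C *: phi) <= `|c| * Dnorm k phi.
Proof. by have := Dnorm_ZD k c%:C%C phi 0; rewrite !addr0 Dnorm0 addr0 /= normr0 addr0. Qed.

Lemma DnormN k phi : Dnorm k (- phi) = Dnorm k phi.
Proof.
have H psi : Dnorm k (- psi) <= Dnorm k psi.
  have := DnormZR k (-1) psi; rewrite rmorphN rmorph1 scaleN1r normrN normr1 mul1r.
  exact.
by apply/eqP; rewrite eq_le H /= -{1}(opprK phi) H.
Qed.

Lemma Dnorm_mono k m phi : (k <= m)%N -> Dnorm k phi <= Dnorm m phi.
Proof. by move=> km; apply: lerD; exact: sobn_mono. Qed.

End DLp_components.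

(** * Completeness *)

(** At a positive limit write b^r as exp (r ln b); at 0 argue with the inverse function. *)
Lemma cvg_powR (R : realType) (u : nat -> R) (b r : R) : 0 < r -> (forall k, 0 <= u k) ->
  u @ \oo --> b -> u k `^ r @[k --> \oo] --> b `^ r.
Proof.
move=> r0 u0 ub; have : 0 <= b by apply: (cvgr_to_ge ub); exact: nearW.
rewrite le_eqVlt => /predU1P[b0|b0].
  rewrite -b0 powR0 ?gt_eqF//; rewrite -b0 in ub.
  apply/cvgrPdist_lt => e e0; have e1 : 0 < e `^ r^-1 by exact: powR_gt0.
  have /cvgrPdist_lt/(_ _ e1) := ub.
  apply: filterS => k; rewrite !sub0r !normrN !ger0_norm ?powR_ge0// => ue.
  have := @gt0_ltr_powR _ _ r0 (u k) (e `^ r^-1).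
  rewrite !nnegrE => /(_ (u0 k) (powR_ge0 _ _) ue).
  by rewrite -powRrM mulVf ?gt_eqF// powRr1// ltW.
have E : \forall k \near \oo, expR (r * ln (u k)) = u k `^ r.
  near=> k; rewrite /powR ifF//; apply/negbTE; rewrite gt_eqF//.
  by near: k; exact: (cvgr_gt _ ub).
have -> : b `^ r = expR (r * ln b) by rewrite /powR gt_eqF.
apply: cvg_trans (near_eq_cvg E) _.
apply: (cvg_comp (fun k => r * ln (u k)) expR _ (@continuous_expR R (r * ln b))).
apply: cvgM; first exact: cvg_cst.
exact: (cvg_comp u (@ln R) ub (continuous_ln b0)).
Unshelve. all: by end_near. Qed.

Lemma cauchy_limit (R : realType) (u : nat -> R) :
  (forall e, 0 < e -> exists N, forall k l, (N <= k)%N -> (N <= l)%N -> `|u k - u l| <= e) ->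
  exists l : R, u @ \oo --> l.
Proof.
move=> H; suff : cvg (u @ \oo) by move=> /cvg_ex.
apply/cauchy_cvgP; apply/cauchy_ballP => e e0.
have [N HN] := H (e / 2) ltac:(by rewrite divr_gt0).
pose A := u @` [set k | (N <= k)%N].
have uA : (u @ \oo) A by exists N => // k Nk; exists k.
exists (A, A) => // -[_ _] /= [[k Nk <-] [l Nl <-]].
rewrite -ball_normE /=; apply: le_lt_trans (HN _ _ Nk Nl) _.
by rewrite ltr_pdivrMr// mulrDr mulr1 ltrDl.
Qed.

Section lpn_const.
Context d (T : measurableType d) (R : realType) (mu : {measure set T -> \bar R}).

Lemma lpn_le_const (r : R) (f : T -> R) (e : R) : 1 <= r -> 0 <= e ->
  measurable_fun setT f -> (\int[mu]_x (`|f x| `^ r)%:E <= (e `^ r)%:E)%E ->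
  f \in Lfun mu r%:E /\ lpn mu r f <= e.
Proof.
move=> r1 e0 mf fe; have r0 : 0 < r by exact: lt_le_trans r1.
have le : ('N[mu]_(r%:E)[EFin \o f] <= e%:E)%E.
  rewrite unlock; under eq_integral do rewrite poweR_EFin.
  have -> : e%:E = ((e `^ r)%:E `^ r^-1)%E.
    by rewrite poweR_EFin -powRrM mulfV ?gt_eqF// powRr1.
  apply: gt0_ler_poweR => //; first by rewrite invr_ge0 ltW.
    by apply: in_itv0y; apply: integral_ge0 => x _; rewrite lee_fin powR_ge0.
  by apply: in_itv0y; rewrite lee_fin powR_ge0.
have Lf : f \in Lfun mu r%:E by apply/LfunE; split => //; exact: le_lt_trans le (ltry _).
by split => //; rewrite -lee_fin lpnE.
Qed.

End lpn_const.

Section sobolev_complete.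
Context {R : realType} {n : nat} (r : R) (r1 : 1 <= r).
Notation lp := (lpn (leb n) r).
Notation Lp := (Lfun (leb n) r%:E).
Implicit Types g h : 'rV[R]_n -> R.

Lemma sobn_partials k s g : sobolev r g ->
  sobn r k (partials s g) <= (size (@words n k))%:R * sobn r (k + size s) g.
Proof.
move=> sg; apply: sobn_le => t tk; rewrite partials_partials.
by apply: lp_le_sobn; rewrite size_cat leq_add2r.
Qed.

Lemma sobolevB g h : sobolev r g -> sobolev r h -> sobolev r (fun x => g x - h x).
Proof.
move=> sg sh; have := sobolev_lin r1 (-1) sh sg.
by under eq_fun do rewrite mulN1r addrC.
Qed.

Lemma partialsB s g h : smooth g -> smooth h ->
  partials s (fun x => g x - h x) = fun x => partials s g x - partials s h x.
Proof.
move=> sg sh; have := partials_lin (-1) s sh sg.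
under [X in partials s X]eq_fun do rewrite mulN1r addrC.
by move=> ->; apply/funext => x; rewrite mulN1r addrC.
Qed.

(** Sobolev's inequality applied to a derivative. *)
Lemma partials_sup s : exists k (C : R), 0 <= C /\ forall g, sobolev r g ->
  forall x, `|partials s g x| <= C * sobn r k g.
Proof.
have [k [C [C0 H]]] := @sobolev_sup R n r r1.
exists (k + size s)%N, (C * (size (@words n k))%:R); split; first by rewrite mulr_ge0.
move=> g sg x; apply: le_trans (H _ (sobolev_partials s sg) x) _.
by rewrite -mulrA ler_wpM2l//; exact: sobn_partials.
Qed.

(** By Sobolev's inequality all the derivatives converge uniformly, so the limit is smooth and may
be differentiated termwise; by Fatou's lemma the convergence also holds in every Sobolev norm. *)
Theorem sobolev_complete (g : nat -> 'rV[R]_n -> R) : (forall k, sobolev r (g k)) ->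
  (forall m e, 0 < e -> exists N, forall k l, (N <= k)%N -> (N <= l)%N ->
     sobn r m (fun x => g k x - g l x) <= e) ->
  exists2 h, sobolev r h & forall m e, 0 < e -> exists N, forall k, (N <= k)%N ->
     sobn r m (fun x => g k x - h x) <= e.
Proof.
move=> sg cg; have smg k := sobolev_smooth (sg k).
have cau s : forall e, 0 < e -> exists N, forall k l, (N <= k)%N -> (N <= l)%N ->
    forall x, `|partials s (g k) x - partials s (g l) x| <= e.
  move=> e e0; have [m [C [C0 HC]]] := partials_sup s.
  have C1 : 0 < C + 1 by rewrite ltr_wpDl.
  have [N HN] := cg m (e / (C + 1)) ltac:(by rewrite divr_gt0).
  exists N => k l Nk Nl x.
  have := HC _ (sobolevB (sg k) (sg l)) x; rewrite partialsB// => le.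
  apply: le_trans le _; apply: (@le_trans _ _ (C * (e / (C + 1)))).
    by rewrite ler_wpM2l//; exact: HN.
  by rewrite mulrCA -[X in _ <= X]mulr1 ler_wpM2l ?(ltW e0)// ler_pdivrMr// mul1r lerDl.
have lims s x : exists l : R, partials s (g k) x @[k --> \oo] --> l.
  apply: cauchy_limit => e /(cau s)[N HN]; exists N => k l Nk Nl; exact: HN.
pose G s x := sval (cid (lims s x)).
have GE s x : partials s (g k) x @[k --> \oo] --> G s x := svalP (cid (lims s x)).
have closeG s e : 0 < e -> exists N, forall k x, (N <= k)%N -> `|partials s (g k) x - G s x| <= e.
  move=> /(cau s)[N HN]; exists N => k x Nk.
  have cv : `|partials s (g k) x - partials s (g l) x| @[l --> \oo] -->
      `|partials s (g k) x - G s x|.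
    apply: (@cvg_norm R R^o nat \oo _ (fun l => partials s (g k) x - partials s (g l) x)).
    by apply: cvgB; [exact: cvg_cst|exact: GE].
  by apply: (cvgr_to_le cv); exists N => // l Nl; exact: HN.
have [smG dG] := unif_lim_smooth smg closeG.
have mG s : measurable_fun setT (G s).
  apply: (@measurable_fun_cvg _ _ _ setT (fun k => partials s (g k))).
    by move=> k; exact: msmooth_measurable (sobolev_msmooth (sg k)) s.
  by move=> x _; exact: GE.
have fat s e : 0 < e -> exists N, forall k, (N <= k)%N ->
    (fun x => partials s (g k) x - G s x) \in Lp /\
    lp (fun x => partials s (g k) x - G s x) <= e.
  move=> e0; have [N HN] := cg (size s) e e0; exists N => k Nk.
  have r0 : 0 < r by exact: lt_le_trans r1.
  have mD : measurable_fun setT (fun x => partials s (g k) x - G s x).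
    by apply: measurable_funB => //; exact: msmooth_measurable (sobolev_msmooth (sg k)) s.
  have Lkl l := sobolev_Lfun (sobolevB (sg k) (sg l)) s.
  have cvg_g x : `|partials s (g k) x - partials s (g (l + N)%N) x| `^ r @[l --> \oo] -->
      `|partials s (g k) x - G s x| `^ r.
    apply: cvg_powR => //; apply: (@cvg_norm R R^o nat \oo _
      (fun l => partials s (g k) x - partials s (g (l + N)%N) x)).
    by apply: cvgB; [exact: cvg_cst|rewrite (cvg_shiftn N (fun l => partials s (g l) x)); exact: GE].
  have le : (\int[leb n]_x (`|partials s (g k) x - G s x| `^ r)%:E <= (e `^ r)%:E)%E.
    apply: (@fatou_le _ _ _ (leb n)
      (fun l x => (`|partials s (g k) x - partials s (g (l + N)%N) x| `^ r)%:E)).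
    - move=> l; apply/measurable_EFinP; apply: measurable_powRl; apply: measurableT_comp => //.
      apply: measurable_funB; exact: msmooth_measurable (sobolev_msmooth (sg _)) s.
    - by move=> l x; rewrite lee_fin powR_ge0.
    - by move=> x; apply: cvg_EFin; [exact: nearW|exact: cvg_g].
    - move=> l; have le := HN _ _ Nk (leq_addl l N).
      have := integral_powR_lpn r1 (Lkl (l + N)%N).
      rewrite (partialsB s (smg k) (smg _)) => ->.
      rewrite lee_fin ge0_ler_powR ?nnegrE ?lpn_ge0 ?(ltW e0) ?(ltW r0)//.
      apply: le_trans le; rewrite -(partialsB s (smg k) (smg _)); exact: lp_le_sobn.
  exact: lpn_le_const (ltW e0) mD le.
have LG s : G s \in Lp.
  have [N HN] := fat s 1 ltr01; have [LD _] := HN N (leqnn N).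
  have := LfunD r1 (sobolev_Lfun (sg N) s) (LfunZ r1 (-1) LD).
  by under eq_fun do rewrite mulN1r opprB addrC subrK.
have sG : sobolev r (G [::]).
  by apply: smooth_sobolev => // s; rewrite dG.
exists (G [::]) => // m e e0.
pose W := size (@words n m); have W1 : 0 < W%:R + 1 :> R by rewrite ltr_wpDl.
have [N HN] : exists N, forall k, (N <= k)%N -> forall s, (size s <= m)%N ->
    lp (partials s (fun x => g k x - G [::] x)) <= e / (W%:R + 1).
  have e1 : 0 < e / (W%:R + 1) by rewrite divr_gt0.
  have [N HN] := choice (fun s => fat s _ e1).
  exists (\max_(s <- @words n m) N s)%N => k Nk s sm.
  rewrite (partialsB s (smg k) smG) dG; apply: (HN s k _).2; apply: leq_trans Nk.
  by apply: leq_bigmax_seq => //; rewrite mem_words.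
exists N => k Nk; apply: le_trans (sobn_le (HN k Nk)) _.
rewrite mulrCA -[X in _ <= X]mulr1 ler_wpM2l ?(ltW e0)// ler_pdivrMr// mul1r lerDl//.
Qed.

End sobolev_complete.

Section DLp_topology.
Context {R : realType} {n : nat} (r : R) (p1 : (1 <= r%:E)%E).
Notation D := (DLp n p1).
Implicit Types phi psi : D.

Let r1 : 1 <= r. Proof. by move: p1; rewrite lee_fin. Qed.

Lemma DreB phi psi : Dre (phi - psi) = fun x => Dre phi x - Dre psi x.
Proof.
apply/funext => x; change (complex.Re ((phi x : R[i]) - psi x) = complex.Re (phi x) - complex.Re (psi x)).
by case: (phi x : R[i]) (psi x : R[i]) => [? ?] [? ?].
Qed.

Lemma DimB phi psi : Dim (phi - psi) = fun x => Dim phi x - Dim psi x.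
Proof.
apply/funext => x; change (complex.Im ((phi x : R[i]) - psi x) = complex.Im (phi x) - complex.Im (psi x)).
by case: (phi x : R[i]) (psi x : R[i]) => [? ?] [? ?].
Qed.

(** Completeness of the two components. *)
Theorem DLp_complete (phi : nat -> D) :
  (forall m e, 0 < e -> exists N, forall k l, (N <= k)%N -> (N <= l)%N ->
     Dnorm m (phi k - phi l) <= e) ->
  exists psi, forall m e, 0 < e -> exists N, forall k, (N <= k)%N -> Dnorm m (phi k - psi) <= e.
Proof.
move=> cau.
have [||g sg Hg] := @sobolev_complete R n r r1 (fun k => Dre (phi k)).
- by move=> k; exact: sobolev_Dre.
- move=> m e /(cau m)[N HN]; exists N => k l Nk Nl; apply: le_trans (HN _ _ Nk Nl).
  by rewrite /Dnorm DreB lerDl sobn_ge0.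
have [||h sh Hh] := @sobolev_complete R n r r1 (fun k => Dim (phi k)).
- by move=> k; exact: sobolev_Dim.
- move=> m e /(cau m)[N HN]; exists N => k l Nk Nl; apply: le_trans (HN _ _ Nk Nl).
  by rewrite /Dnorm DimB lerDr sobn_ge0.
have [psi [E1 E2]] := sobolev_DLp p1 sg sh.
exists psi => m e e0; have e2 : 0 < e / 2 by rewrite divr_gt0.
have [N HN] := Hg m _ e2; have [N' HN'] := Hh m _ e2.
exists (maxn N N') => k; rewrite geq_max => /andP[Nk N'k].
by rewrite /Dnorm DreB DimB E1 E2 [e]splitr; apply: lerD; [exact: HN|exact: HN'].
Qed.

Lemma DLp_nbhsP phi (U : set D) : nbhs phi U <->
  exists k (e : R), 0 < e /\ forall psi, Dnorm k (psi - phi) < e -> U psi.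
Proof.
split=> [[[k e] /= e0 H]|[k [e [e0 H]]]].
  exists k, e; split=> // psi lt; apply: H; rewrite /DLp_ball /=.
  by apply: le_lt_trans (DLp_seminorm_le _ _) _; rewrite lte_fin.
pose W : R := (size (@words n k)).*2%:R + 1.
have W0 : 0 < W by rewrite ltr_wpDl.
exists (k, e / W) => /=; first by rewrite divr_gt0.
move=> psi; rewrite /DLp_ball /= => lt; apply: H; rewrite -lte_fin.
apply: le_lt_trans (Dnorm_le_seminorm _ _) _.
apply: (@le_lt_trans _ _ (W%:E * DLp_seminorm k (psi - phi)%R)%E).
  by apply: lee_wpmul2r; [exact: DLp_seminorm_ge0|rewrite lee_fin lerDl].
have := lt; rewrite -(fineK (DLp_seminorm_fin k (psi - phi))) !lte_fin.
by rewrite ltr_pdivlMr// mulrC.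
Qed.

Lemma cmodulus_real (c : R) : cmodulus c%:C%C = `|c|.
Proof. by rewrite /cmodulus /= expr0n addr0 sqrtr_sqr. Qed.

Lemma DLp_bounded (A : set D) :
  tvs_bounded A <-> forall k, exists M : R, forall phi, A phi -> Dnorm k phi <= M.
Proof.
split=> [bA k|bA U].
  have nU : nbhs (0 : D) [set phi | Dnorm k phi < 1].
    by apply/DLp_nbhsP; exists k, 1; split => // psi; rewrite subr0.
  have [c c0 H] := bA _ nU; have sub := H c (real_ler_norm (gtr0_real c0)).
  exists (2 * cmodulus c) => phi /sub[psi /= lt <-].
  apply: le_trans (DnormZ_le _ _ _) _; rewrite -[X in _ <= X]mulr1.
  by rewrite ler_wpM2l ?(ltW lt)// mulr_ge0// cmodulus_ge0.
move=> /DLp_nbhsP[k [e [e0 HU]]]; have [M HM] := bA k.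
pose N := 2 * (`|M| + 1) / e; have N0 : 0 < N by rewrite divr_gt0// mulr_gt0// ltr_wpDl.
exists N%:C%C; first by rewrite ltcR.
move=> t; rewrite cmodulusE lecR => Nt phi Aphi.
have t0 : 0 < cmodulus t by exact: lt_le_trans Nt.
have tn : t != 0.
  by apply: contraTneq t0 => ->; rewrite /cmodulus ComplexField.Normc.normc0 ltxx.
exists (t^-1 *: phi); last by rewrite scalerA mulfV// scale1r.
apply: HU; rewrite subr0; apply: le_lt_trans (DnormZ_le _ _ _) _.
have -> : cmodulus t^-1 = (cmodulus t)^-1.
  exact: ComplexField.Normc.normcV.
rewrite mulrAC ltr_pdivrMr//.
apply: (@lt_le_trans _ _ (e * N)); last by rewrite ler_wpM2l// ltW.
rewrite /N mulrCA mulfV ?gt_eqF// mulr1 ltr_pM2l//.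
apply: le_lt_trans (HM _ Aphi) _; apply: le_lt_trans (ler_norm _) _.
by rewrite ltrDl.
Qed.

End DLp_topology.

(** * Ultrafilters with bounded complex values *)

Lemma cmodulusN (R : realType) (z : R[i]) : cmodulus (- z) = cmodulus z.
Proof. by case: z => a b; rewrite /cmodulus /= !sqrrN. Qed.

Lemma fmap_ultra T U (f : T -> U) (F : set_system T) :
  UltraFilter F -> UltraFilter (f @ F).
Proof.
move=> FU; split; first exact: fmap_proper_filter.
move=> G GG FG; apply/seteqP; split=> [A GA|]; last exact: FG.
have [//|FA] := in_ultra_setVsetC (f @^-1` A) FU.
have : G (~` A) by exact: FG.
by move=> /(filterI GA); rewrite setICr => /filter_not_empty.
Qed.

Section disc_ultrafilters.
Context {R : realType} (T : Type) (F : set_system T) {FU : UltraFilter F}.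

Lemma ultra_interval (f : T -> R) (M : R) : F [set x | `|f x| <= M] ->
  exists l : R, f @ F --> l.
Proof.
move=> FM; have cK := @segment_compact R (- M) M.
have UfF : UltraFilter (f @ F) by exact: fmap_ultra.
have FfK : F [set x | f x \in `[- M, M]].
  by apply: filterS FM => x; rewrite /= in_itv /= -ler_norml.
rewrite compact_ultra in cK; have [l [_ cl]] := cK _ UfF FfK.
by exists l.
Qed.

(** Closed discs are compact; the real and imaginary parts reduce this to bounded intervals. *)
Lemma ultra_disc (f : T -> R[i]) (M : R) : F [set x | cmodulus (f x) <= M] ->
  exists2 l : R[i], cmodulus l <= M & forall e, 0 < e -> F [set x | cmodulus (f x - l) < e].
Proof.
move=> FM.
have [a fa] : exists l : R, (fun x => complex.Re (f x)) @ F --> l.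
  by apply: (@ultra_interval _ M); apply: filterS FM => x; exact: le_trans (normr_Re_le _).
have [b fb] : exists l : R, (fun x => complex.Im (f x)) @ F --> l.
  by apply: (@ultra_interval _ M); apply: filterS FM => x; exact: le_trans (normr_Im_le _).
have cl e : 0 < e -> F [set x | cmodulus (f x - Complex a b) < e].
  move=> e0; have e2 : 0 < e / 2 by rewrite divr_gt0.
  move/cvgrPdist_lt : fa => /(_ _ e2) Fa; move/cvgrPdist_lt : fb => /(_ _ e2) Fb.
  apply: filterS2 Fa Fb => x xa xb /=; apply: le_lt_trans (cmodulus_le _) _.
  rewrite [e]splitr; apply: ltrD; first by case: (f x) xa => u v /=; rewrite distrC.
  by case: (f x) xb => u v /=; rewrite distrC.
exists (Complex a b) => //; apply/ler_addgt0Pr => e e0.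
have [x [xM xe]] := filter_ex (filterI FM (cl e e0)).
have -> : Complex a b = f x + (Complex a b - f x) by rewrite addrC subrK.
apply: le_trans (ler_cmodulusD _ _) _; apply: lerD => //; apply: ltW; apply: le_lt_trans xe.
by rewrite -opprB cmodulusN.
Qed.

End disc_ultrafilters.

(** * Topologies of uniform convergence on the dual *)

Lemma gt0_complex (R : realType) (e : R[i]) : 0 < e -> exists2 r : R, e = r%:C%C & 0 < r.
Proof.
case: e => a b; rewrite ltcE /= => /andP[/eqP b0 a0].
by exists a => //; rewrite b0.
Qed.

Section dual_topology.
Context {R : realType} (E : preTopologicalLmodType R[i]) (S : set (set E)).
Notation dualS := (dual_with_convergence_on S).
Implicit Types u v : topological_dual E.

Lemma dual_linear u : linear (u : E -> R[i]^o).
Proof. by have := valP u; rewrite inE => -[]. Qed.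

Lemma dual_continuous u : continuous (u : E -> R[i]^o).
Proof. by have := valP u; rewrite inE => -[]. Qed.

Lemma cmodulusB_lt (z w : R[i]) (e : R) : (`|z - w| < e%:C%C) = (cmodulus (w - z) < e).
Proof. by rewrite -cmodulusN opprB cmodulusE ltcR. Qed.

(** Proofs of compactness and continuity use the topology through its convergent filters only. *)
Lemma dual_cvgP (F : set_system (topological_dual E)) u : Filter F ->
  ((F : set_system dualS) --> (u : dualS)) <->
  forall A, S A -> forall e : R, 0 < e ->
    F [set v | forall x, A x -> cmodulus (v x - u x) < e].
Proof.
move=> FF.
pose f := fun u : topological_dual E => (u : {family S, E -> R[i]^o}).
have H : ((F : set_system dualS) --> (u : dualS)) <-> (f @ F --> f u).
  split=> [Fu U nU|fF U [W [[C oC <-] /= Cfu] sub]].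
    exact: Fu _ (initial_continuous nU).
  by apply: filterS sub _; apply: fF; apply: open_nbhs_nbhs.
rewrite H; split.
  move=> /fam_cvgP Fu A SA e e0.
  have nU : nbhs (f u : {uniform` A -> R[i]^o})
      [set h | forall y, A y -> `|f u y - h y| < e%:C%C].
    apply/uniform_nbhs; exists [set zw : R[i]^o * R[i]^o | `|zw.1 - zw.2| < e%:C%C].
    split=> //; rewrite -entourage_ballE; exists e%:C%C; first by rewrite /= ltcR.
    by move=> [z w] /=; rewrite -ball_normE.
  have := Fu _ SA _ nU; apply: filterS => v /= vu x /vu.
  by rewrite cmodulusB_lt.
move=> Fu; apply/fam_cvgP => A SA U /uniform_nbhs[W [eW sub]].
move: eW; rewrite -entourage_ballE => -[e /= e0 We].
have [r e_r r0] := gt0_complex e0.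
apply: filterS (Fu _ SA r r0) => v vu; apply: sub => x Ax; apply: We => /=.
by rewrite -ball_normE /= e_r cmodulusB_lt; exact: vu.
Qed.

Definition bounded_on (B : set (topological_dual E)) := forall A, S A ->
  exists M : R, forall u x, B u -> A x -> cmodulus (u x) <= M.

(** If [B] is uniformly bounded on each member of [S], the multiples t^-1 u with u in [B] tend to 0
uniformly on the members of [S] as |t| grows; this says that every neighbourhood of 0 absorbs
[B]. *)
Lemma dual_bounded (B : set (topological_dual E)) :
  tvs_bounded (B : set dualS) <-> bounded_on B.
Proof.
split=> [bB A SA|bB U nU].
  have nU : nbhs (0 : dualS) [set v : dualS | forall x, A x -> cmodulus (v x - 0) < 1].
    have := (@dual_cvgP (nbhs (0 : dualS)) 0 _).1 _ A SA 1 ltr01; apply.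
    exact: cvg_id.
  have [c c0 H] := bB _ nU; have sub := H c (real_ler_norm (gtr0_real c0)).
  exists (cmodulus c) => u x /sub[v vx <-] Ax.
  have -> : (c *: v : topological_dual E) x = c * v x by [].
  rewrite cmodulusM -[X in _ <= X]mulr1 ler_wpM2l ?cmodulus_ge0//.
  by have := vx _ Ax; rewrite subr0 => /ltW.
pose G : set_system (topological_dual E) := [set W |
  exists r : R, 0 < r /\ forall t : R[i], r <= cmodulus t -> forall u, B u -> W (t^-1 *: u)].
have FG : Filter G.
  split; first by exists 1.
    move=> V W [r1 [r10 HV]] [r2 [r20 HW]]; exists (Num.max r1 r2).
    split=> [|t]; first by rewrite lt_max r10.
    by rewrite ge_max => /andP[t1 t2] u Bu; split; [exact: HV|exact: HW].
  by move=> V W VW [r1 [r10 HV]]; exists r1; split=> // t rt u Bu; apply/VW/HV.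
have : (G : set_system dualS) --> (0 : dualS).
  apply/dual_cvgP => A SA e e0; have [M HM] := bB A SA.
  exists ((`|M| + 1) / e); split=> [|t rt u Bu x Ax]; first by rewrite divr_gt0// ltr_wpDl.
  have t0 : 0 < cmodulus t by apply: lt_le_trans rt; rewrite divr_gt0// ltr_wpDl.
  have -> : (t^-1 *: u : topological_dual E) x - (0 : topological_dual E) x = t^-1 * u x.
    by rewrite /= subr0.
  rewrite cmodulusM /cmodulus ComplexField.Normc.normcV -/(cmodulus _) -/(cmodulus _).
  rewrite mulrC ltr_pdivrMr//; apply: (@lt_le_trans _ _ (e * ((`|M| + 1) / e))).
    rewrite mulrCA mulfV ?gt_eqF// mulr1; apply: le_lt_trans (HM _ _ Bu Ax) _.
    by apply: le_lt_trans (ler_norm _) _; rewrite ltrDl.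
  by rewrite ler_wpM2l// ltW.
move=> /(_ U nU)[r [r0 HU]]; exists r%:C%C; first by rewrite ltcR.
move=> t; rewrite cmodulusE lecR => rt u Bu.
have tn : t != 0.
  apply: contraTneq rt => ->; rewrite /cmodulus ComplexField.Normc.normc0 -ltNge//.
exists (t^-1 *: u); first exact: HU.
by rewrite scalerA mulfV// scale1r.
Qed.

End dual_topology.

(** * Equicontinuous sets of functionals *)

Section equicontinuity.
Context {R : realType} {n : nat} (r : R) (p1 : (1 <= r%:E)%E).
Notation D := (DLp n p1).
Notation dual := (topological_dual D).
Implicit Types (phi psi : D) (u v : dual) (B : set dual).

Definition bounded_by m (C : R) : set dual :=
  [set u | forall phi, cmodulus (u phi) <= C * Dnorm m phi].

Definition equicontinuous B := exists m C, 0 <= C /\ B `<=` bounded_by m C.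

Lemma dualZD u (c : R[i]) phi psi : u (c *: phi + psi) = c * u phi + u psi.
Proof. exact: dual_linear. Qed.

Lemma dualB u phi psi : u (phi - psi) = u phi - u psi.
Proof. by rewrite addrC -scaleN1r dualZD mulN1r addrC. Qed.

Lemma dual0 u : u 0 = 0.
Proof. by rewrite -(subrr (0 : D)) dualB subrr. Qed.

Lemma dualZ u (c : R[i]) phi : u (c *: phi) = c * u phi.
Proof. by have := dualZD u c phi 0; rewrite !addr0 dual0 addr0. Qed.

(** A functional that is small on a ball is bounded there, by homogeneity. *)
Lemma dual_bound u : exists m C, 0 <= C /\ bounded_by m C u.
Proof.
have nU : nbhs (0 : D) [set phi | cmodulus (u phi) < 1].
  have nb : nbhs (u 0 : R[i]^o) [set z | `|u 0 - z| < 1%:C%C].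
    apply/(@nbhs_ballP _ R[i]^o); exists 1%:C%C; first by rewrite /= ltcR.
    by move=> z; rewrite -ball_normE.
  have nb' : nbhs (0 : D) (u @^-1` [set z | `|u 0 - z| < 1%:C%C]) := @dual_continuous _ _ u 0 _ nb.
  apply: filterS nb' => phi /=.
  by rewrite cmodulusB_lt dual0 subr0.
have [k [e [e0 H]]] := (DLp_nbhsP _ _).1 nU.
exists k, e^-1; split=> [|phi]; first by rewrite invr_ge0 ltW.
apply/ler_addgt0Pr => d d0.
(* The norm of [phi] may vanish; [t] is a positive upper bound of it. *)
pose t := Dnorm k phi + e * d.
have t0 : 0 < t by rewrite ltr_wpDl ?Dnorm_ge0// mulr_gt0.
have lt : cmodulus (u ((e / t)%:C%C *: phi)) < 1.
  apply: H; rewrite subr0; apply: le_lt_trans (DnormZR _ _ _) _.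
  rewrite ger0_norm ?divr_ge0 ?(ltW e0) ?(ltW t0)// mulrAC ltr_pdivrMr// ltr_pM2l//.
  by rewrite ltrDl mulr_gt0.
move: lt; rewrite dualZ cmodulusM cmodulus_real ger0_norm ?divr_ge0 ?(ltW e0) ?(ltW t0)//.
rewrite mulrAC ltr_pdivrMr// mul1r -ltr_pdivlMl// => /ltW le.
by apply: le_trans le _; rewrite /t mulrDr mulKf ?gt_eqF.
Qed.

Lemma dual_of_bound (L : D -> R[i]^o) m (C : R) : linear L -> 0 <= C ->
  (forall phi, cmodulus (L phi) <= C * Dnorm m phi) -> {u : dual | u = L :> (D -> R[i]^o)}.
Proof.
move=> lL C0 LC; suff P : L \in @Defs.linear_continuous _ D by exists (TopologicalDual P).
rewrite inE; split=> // phi U /(@nbhs_ballP _ R[i]^o)[e /= e0 eU].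
have [d e_d d0] := gt0_complex e0.
have C1 : 0 < C + 1 by rewrite ltr_wpDl.
apply/DLp_nbhsP; exists m, (d / (C + 1)); split=> [|psi lt]; first by rewrite divr_gt0.
apply: eU; rewrite -ball_normE /= e_d cmodulusB_lt.
have -> : L psi - L phi = L (psi - phi).
  have E : L (-1 *: phi + psi) = -1 * L phi + L psi := lL (-1) phi psi.
  by rewrite [psi - phi]addrC -[- phi]scaleN1r E mulN1r addrC.
apply: le_lt_trans (LC _) _.
move: lt; rewrite ltr_pdivlMr// => lt; apply: le_lt_trans lt.
by rewrite mulrC ler_wpM2l ?Dnorm_ge0// lerDl.
Qed.

Lemma equicontinuous_bounded B A : equicontinuous B ->
  (forall k, exists M : R, forall phi, A phi -> Dnorm k phi <= M) ->
  exists M : R, forall u phi, B u -> A phi -> cmodulus (u phi) <= M.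
Proof.
move=> [m [C [C0 BC]]] /(_ m)[M HM]; exists (C * M) => u phi Bu Aphi.
by apply: le_trans (BC _ Bu phi) _; rewrite ler_wpM2l//; exact: HM.
Qed.

(** The norm is locally bounded, hence bounded on compact sets. *)
Lemma compact_Dnorm (A : set D) k : compact A -> exists M : R, forall phi, A phi -> Dnorm k phi <= M.
Proof.
move=> /compact_near_coveringP cA.
have : \forall M \near (+oo : set_system R), A `<=` [set phi | Dnorm k phi <= M].
  apply: cA => phi _.
  exists ([set psi | Dnorm k (psi - phi) < 1], [set M | Dnorm k phi + 1 <= M]).
    split; first by apply/DLp_nbhsP; exists k, 1.
    by apply: nbhs_pinfty_ge; rewrite num_real.
  move=> [psi M] /= [lt le]; apply: le_trans le; rewrite -[psi](subrK phi) addrC.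
  by apply: le_trans (DnormD _ _ _) _; rewrite lerD2l ltW.
by move=> /filter_ex[M HM]; exists M.
Qed.

End equicontinuity.

(** * The compact disc spanned by a rapidly decreasing sequence *)

Lemma half_expn_small (R : realType) (e : R) m : 0 < e -> exists2 N, (m <= N)%N & 2^-1 ^+ N < e.
Proof.
move=> e0; have : (fun N => 2^-1 ^+ N : R) @ \oo --> 0.
  by apply: cvg_expr; rewrite ger0_norm// invf_lt1// ltr1n.
move=> /cvgrPdist_lt /(_ _ e0)[N _ HN]; exists (maxn m N); first exact: leq_maxl.
have := HN (maxn m N) (leq_maxr _ _).
by rewrite sub0r normrN ger0_norm// exprn_ge0.
Qed.

Lemma ultra_disc_ex (R : realType) (T : Type) (F : set_system T) {FU : UltraFilter F}
    (f : T -> R[i]) (M : R) : F [set x | cmodulus (f x) <= M] ->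
  exists l : R[i], cmodulus l <= M /\
    forall e, 0 < e -> F [set x | cmodulus (f x - l) < e].
Proof. by move=> /ultra_disc[l lM Hl]; exists l. Qed.

Section compact_disc.
Context {R : realType} {n : nat} (r : R) (p1 : (1 <= r%:E)%E).
Notation D := (DLp n p1).
Variable phi : nat -> D.
Hypothesis phi_small : forall k, Dnorm k (phi k) <= 2^-1 ^+ k.
Implicit Types (psi : D) (a b : nat -> R[i]).

Definition partial_sum a N : D := \sum_(i < N) a i *: phi i.

Definition has_sum a psi := forall m e, 0 < e ->
  exists N, forall M, (N <= M)%N -> Dnorm m (psi - partial_sum a M) <= e.

Definition unit_seq a := forall k, cmodulus (a k) <= 1.

(** With coefficients in the unit disc of the supremum norm, rather than with summable
coefficients, compactness reduces to that of the disc, one coefficient at a time. *)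
Definition disc_hull : set D := [set psi | exists2 a, unit_seq a & has_sum a psi].

Lemma partial_sumS a N : partial_sum a N.+1 = partial_sum a N + a N *: phi N.
Proof. by rewrite /partial_sum big_ord_recr. Qed.

Lemma partial_sumZD (c d : R[i]) a b N :
  partial_sum (fun k => c * a k + d * b k) N = c *: partial_sum a N + d *: partial_sum b N.
Proof.
rewrite /partial_sum !scaler_sumr -big_split /=; apply: eq_bigr => i _.
by rewrite scalerDl !scalerA.
Qed.

Lemma Dnorm_triangle k (x y z : D) : Dnorm k (x - z) <= Dnorm k (x - y) + Dnorm k (y - z).
Proof. by rewrite -[x - z](subrKA y); exact: DnormD. Qed.

(** Exactly telescoping, as 2 * 2^-i = 4 (2^-i - 2^-(i+1)); the factor 2 is lost by [DnormZ_le]. *)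
Lemma partial_sum_tail a m N j : unit_seq a -> (m <= N)%N ->
  Dnorm m (partial_sum a (N + j) - partial_sum a N) <= 4 * (2^-1 ^+ N - 2^-1 ^+ (N + j)).
Proof.
move=> a1 mN; elim: j => [|j IH]; first by rewrite addn0 !subrr mulr0 Dnorm0.
rewrite addnS partial_sumS addrAC; apply: le_trans (DnormD _ _ _) _.
have le1 : Dnorm m (phi (N + j)) <= 2^-1 ^+ (N + j).
  by apply: le_trans (phi_small _); apply: Dnorm_mono; exact: leq_trans (leq_addr _ _).
have le2 : Dnorm m (a (N + j)%N *: phi (N + j)) <= 2 * 2^-1 ^+ (N + j).
  apply: le_trans (DnormZ_le _ _ _) _; rewrite -mulrA ler_wpM2l//.
  apply: le_trans le1; rewrite -[X in _ <= X]mul1r ler_wpM2r ?Dnorm_ge0//; exact: a1.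
apply: le_trans (lerD IH le2) _; rewrite exprS.
move: (2^-1 ^+ N) (2^-1 ^+ (N + j)) => x y.
by rewrite le_eqVlt; apply/orP; left; apply/eqP; field.
Qed.

Lemma partial_sum_tail_le a m N M : unit_seq a -> (m <= N)%N -> (N <= M)%N ->
  Dnorm m (partial_sum a M - partial_sum a N) <= 4 * 2^-1 ^+ N.
Proof.
move=> a1 mN NM; rewrite -(subnKC NM); apply: le_trans (partial_sum_tail _ a1 mN) _.
by rewrite ler_wpM2l// lerBlDr lerDl exprn_ge0.
Qed.

Lemma has_sum_ex a : unit_seq a -> exists psi, has_sum a psi.
Proof.
move=> a1; have [m e e0|psi Hpsi] := DLp_complete (phi := partial_sum a).
  have [N mN Ne] := half_expn_small m (divr_gt0 e0 (ltr0Sn R 7)).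
  exists N => k l Nk Nl; apply: le_trans (Dnorm_triangle _ _ (partial_sum a N) _) _.
  rewrite -[partial_sum a N - _]opprB DnormN.
  apply: le_trans (lerD (partial_sum_tail_le a1 mN Nk) (partial_sum_tail_le a1 mN Nl)) _.
  move: Ne; rewrite ltr_pdivlMr//; move: (2^-1 ^+ N) => x.
  by rewrite -mulrDl -natrD mulrC => /ltW.
exists psi => m e /(Hpsi m)[N HN]; exists N => M NM.
by rewrite -DnormN opprB; exact: HN.
Qed.

Lemma has_sum_tail a psi m N : unit_seq a -> has_sum a psi -> (m <= N)%N ->
  Dnorm m (psi - partial_sum a N) <= 4 * 2^-1 ^+ N.
Proof.
move=> a1 sa mN; apply/ler_addgt0Pr => e e0; have [M HM] := sa m e e0.
apply: le_trans (Dnorm_triangle _ _ (partial_sum a (maxn M N)) _) _.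
rewrite addrC; apply: lerD; first exact: partial_sum_tail_le (leq_maxr _ _).
exact: HM (leq_maxl _ _).
Qed.

Lemma disc_hull_absolutely_convex : absolutely_convex disc_hull.
Proof.
move=> c d x y [a a1 ax] [b b1 bx] cd.
have {}cd : cmodulus c + cmodulus d <= 1.
  by move: cd; rewrite !cmodulusE -rmorphD -[1](rmorph1 (real_complex R)) lecR.
exists (fun k => c * a k + d * b k).
  move=> k; apply: le_trans (ler_cmodulusD _ _) _; rewrite !cmodulusM.
  apply: le_trans cd; apply: lerD; rewrite -[X in _ <= X]mulr1 ler_wpM2l ?cmodulus_ge0//.
move=> m e e0; pose K := 2 * cmodulus c + 2 * cmodulus d + 1.
have K0 : 0 < K by rewrite ltr_wpDl// addr_ge0// mulr_ge0// cmodulus_ge0.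
have e1 : 0 < e / K by rewrite divr_gt0.
have [N HN] := ax m _ e1; have [N' HN'] := bx m _ e1.
exists (maxn N N') => M; rewrite geq_max => /andP[NM N'M].
rewrite partial_sumZD.
have -> : c *: x + d *: y - (c *: partial_sum a M + d *: partial_sum b M) =
    c *: (x - partial_sum a M) + d *: (y - partial_sum b M).
  by rewrite !scalerBr opprD addrACA.
apply: le_trans (DnormD _ _ _) _.
apply: le_trans (lerD (DnormZ_le _ _ _) (DnormZ_le _ _ _)) _.
apply: (@le_trans _ _ (2 * cmodulus c * (e / K) + 2 * cmodulus d * (e / K))).
  apply: lerD; apply: ler_wpM2l; rewrite ?mulr_ge0 ?cmodulus_ge0//.
    exact: HN.
  exact: HN'.
rewrite -mulrDl mulrCA -[X in _ <= X]mulr1 ler_wpM2l ?(ltW e0)//.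
by rewrite ler_pdivrMr// mul1r /K lerDl.
Qed.

Lemma disc_hull_mem k : disc_hull (phi k).
Proof.
exists (fun i => (i == k)%:R).
  move=> i; case: (i == k) => /=.
    by rewrite expr1n expr0n addr0 sqrtr1.
  by rewrite expr0n addr0 sqrtr0 ler01.
move=> m e e0; exists k.+1 => M kM.
rewrite /partial_sum (bigD1 (Ordinal kM))//= eqxx scale1r big1 => [|i ik].
  by rewrite addr0 subrr Dnorm0 ltW.
rewrite (_ : (i == k :> nat) = false) ?scale0r//.
by apply/negbTE; apply: contraNneq ik => ik; apply/eqP/val_inj.
Qed.

(** An ultrafilter on the disc makes each coefficient converge. The tails are uniformly small, so
the sums converge to the sum with the limit coefficients. *)
Lemma disc_hull_compact : compact disc_hull.
Proof.
rewrite compact_ultra => F FU FK.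
have /choice[co Hco] : forall psi, exists a, disc_hull psi -> unit_seq a /\ has_sum a psi.
  move=> psi.
  have [[a a1 apsi]|N] := pselect (disc_hull psi); first by exists a.
  by exists (fun=> 0).
have Fco k : F [set psi | cmodulus (co psi k) <= 1].
  by apply: filterS FK => psi /Hco[a1 _]; exact: a1.
have [b Hb] := choice (fun k => ultra_disc_ex (Fco k)).
have b1 : unit_seq b by move=> k; have [] := Hb k.
have Fb k e : 0 < e -> F [set psi | cmodulus (co psi k - b k) < e].
  by have [_] := Hb k; exact.
have [psi0 sb] := has_sum_ex b1.
exists psi0; split; first by exists b.
move=> U /DLp_nbhsP[m [e [e0 HU]]].
have Fsum N : forall d, 0 < d ->
    F [set psi | Dnorm m (partial_sum (co psi) N - partial_sum b N) < d].
  elim: N => [|N IH] d d0.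
    apply: filterS filterT => psi _ /=.
    by rewrite /partial_sum !big_ord0 subrr Dnorm0.
  have d2 : 0 < d / 2 by rewrite divr_gt0.
  pose C := 2 * Dnorm m (phi N) + 1.
  have C0 : 0 < C by rewrite ltr_wpDl// mulr_ge0// Dnorm_ge0.
  have := Fb N (d / 2 / C) (divr_gt0 d2 C0).
  apply: filterS2 (IH _ d2) => psi /= lt1 lt2.
  rewrite !partial_sumS opprD addrACA -scalerBl; apply: le_lt_trans (DnormD _ _ _) _.
  rewrite [d]splitr; apply: ltrD => //; apply: le_lt_trans (DnormZ_le _ _ _) _.
  move: lt2; rewrite ltr_pdivlMr// => lt2; apply: le_lt_trans lt2.
  rewrite mulrC mulrA mulrC [Dnorm m _ * 2]mulrC ler_wpM2l ?cmodulus_ge0//.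
  by rewrite lerDl.
have [N mN Ne] := half_expn_small m (divr_gt0 e0 (ltr0Sn R 15)).
have e2 : 0 < e / 2 by rewrite divr_gt0.
apply: filterS2 FK (Fsum N _ e2) => psi Kpsi lt.
have [a1 sa] := Hco _ Kpsi; apply: HU.
apply: le_lt_trans (Dnorm_triangle _ _ (partial_sum (co psi) N) _) _.
apply: le_lt_trans (lerD (has_sum_tail a1 sa mN) (Dnorm_triangle _ _ (partial_sum b N) _)) _.
have := has_sum_tail b1 sb mN; rewrite -DnormN opprB => H.
move: lt Ne H => /=; rewrite ltr_pdivlMr//.
move: (Dnorm _ _) (Dnorm _ _) (2^-1 ^+ N) => u v x lt Ne H.
by lra.
Qed.

End compact_disc.

(** * Bounded and relatively compact sets of functionals *)

Lemma cmodulus_eq (R : realType) (z w : R[i]) : (forall e, 0 < e -> cmodulus (z - w) <= e) -> z = w.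
Proof.
move=> H; apply/eqP; rewrite -subr_eq0 -normr_eq0 cmodulusE.
have : cmodulus (z - w) <= 0 by apply/ler_addgt0Pr => e e0; rewrite add0r; exact: H.
by rewrite le_eqVlt ltNge cmodulus_ge0 orbF => /eqP ->.
Qed.

Section bounded_sets.
Context {R : realType} {n : nat} (r : R) (p1 : (1 <= r%:E)%E).
Notation D := (DLp n p1).
Notation dual := (topological_dual D).
Notation discs := [set A : set D | absolutely_convex A /\ compact A].
Implicit Types (phi psi : D) (u v : dual) (B : set dual).

(** A set that is not equicontinuous is unbounded along a rapidly decreasing sequence, hence on
the compact disc that the sequence spans. *)
Lemma bounded_on_discs_equicontinuous B : bounded_on discs B -> equicontinuous B.
Proof.
move=> bB; apply: contrapT => NE.
have H k : exists uphi : dual * D, [/\ B uphi.1, Dnorm k uphi.2 <= 2^-1 ^+ k &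
    cmodulus (uphi.1 uphi.2) = k%:R].
  (* With this constant, scaling [phi] so that |u phi| = k brings its norm below 2^-k. *)
  pose C : R := k%:R * 2 ^+ k.
  have C0 : 0 <= C by rewrite mulr_ge0// exprn_ge0.
  have [u [Bu [phi lt]]] : exists u, B u /\ exists phi, C * Dnorm k phi < cmodulus (u phi).
    apply: contrapT => N; apply: NE; exists k, C; split=> // u Bu phi.
    by rewrite leNgt; apply/negP => lt; apply: N; exists u; split=> //; exists phi.
  set x := cmodulus (u phi) in lt.
  have x0 : 0 < x by apply: le_lt_trans lt; rewrite mulr_ge0// Dnorm_ge0.
  exists (u, (k%:R / x)%:C%C *: phi); split=> //=.
    apply: le_trans (DnormZR _ _ _) _; rewrite ger0_norm ?divr_ge0 ?(ltW x0)//.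
    rewrite mulrAC ler_pdivrMr// exprVn ler_pdivlMl ?exprn_gt0//.
    by apply: le_trans (ltW lt); rewrite /C mulrA [_ ^+ k * _]mulrC.
  by rewrite dualZ cmodulusM cmodulus_real ger0_norm ?divr_ge0 ?(ltW x0)// divfK// gt_eqF.
have [f Hf] := choice H.
have small k : Dnorm k (f k).2 <= 2^-1 ^+ k by have [] := Hf k.
have [|M HM] := bB (disc_hull (fun k => (f k).2)).
  by split; [exact: disc_hull_absolutely_convex|exact: disc_hull_compact].
have [k Mk] : exists k : nat, M < k%:R.
  by exists (Num.bound `|M|); apply: le_lt_trans (ler_norm _) _; rewrite archi_boundP.
have [Bk _ ek] := Hf k.
have := HM _ _ Bk (disc_hull_mem (fun k => (f k).2) k).
by rewrite ek leNgt Mk.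
Qed.

(** A sequence with one nonzero term already spans a disc; it makes point evaluations continuous
on the dual. *)
Lemma disc_through phi : exists2 A, discs A & exists2 t : R, 0 < t & A (t%:C%C *: phi).
Proof.
(* Only the norm with index 0 constrains the first term of the sequence. *)
pose t := (Dnorm 0 phi + 1)^-1.
have d0 : 0 < Dnorm 0 phi + 1 by rewrite ltr_wpDl ?Dnorm_ge0 ?ltr01.
have t0 : 0 < t by rewrite invr_gt0.
pose f k := if k is 0%N then t%:C%C *: phi else 0.
have small k : Dnorm k (f k) <= 2^-1 ^+ k.
  case: k => [|k] /=; last by rewrite Dnorm0 exprn_ge0.
  apply: le_trans (DnormZR _ _ _) _; rewrite expr0 gtr0_norm// /t mulrC.
  by rewrite (ler_pdivrMr _ _ d0) mul1r lerDl ler01.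
exists (disc_hull f); last by exists t => //; exact: (disc_hull_mem f 0%N).
by split; [exact: disc_hull_absolutely_convex|exact: disc_hull_compact].
Qed.

Lemma closure_bounded_by m (C : R) B : B `<=` bounded_by m C ->
  closure (B : set (kappa_dual D)) `<=` (bounded_by m C : set dual).
Proof.
move=> BC u clu phi; apply/ler_addgt0Pr => e e0.
have [A SA [t t0 At]] := disc_through phi.
have nu : nbhs (u : kappa_dual D) [set v : kappa_dual D |
    forall x, A x -> cmodulus ((v : dual) x - u x) < t * e].
  have := (@dual_cvgP _ _ discs (nbhs (u : kappa_dual D)) u _).1 _ A SA (t * e) (mulr_gt0 t0 e0).
  by apply; exact: cvg_id.
have [v [Bv vu]] := clu _ nu.
have lt : cmodulus (v phi - u phi) < e.
  have := vu _ At; rewrite !dualZ -mulrBr cmodulusM cmodulus_real gtr0_norm//.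
  by rewrite ltr_pM2l.
have -> : u phi = v phi - (v phi - u phi) by rewrite opprB addrC subrK.
apply: le_trans (ler_cmodulusD _ _) _; rewrite cmodulusN.
by apply: lerD; [exact: BC|exact: ltW].
Qed.

(** The theorem of Alaoglu and Bourbaki: on an equicontinuous set pointwise limits of ultrafilters
exist, and pointwise convergence is uniform on compact sets. *)
Lemma equicontinuous_relatively_compact B : equicontinuous B ->
  relatively_compact (B : set (kappa_dual D)).
Proof.
move=> [m [C [C0 BC]]]; rewrite /relatively_compact compact_ultra => F FU FB.
have FH : F (bounded_by m C) by apply: filterS FB; exact: closure_bounded_by.
have FP phi : F [set u | cmodulus ((u : dual) phi) <= C * Dnorm m phi].
  by apply: filterS FH => u Hu; exact: Hu.
have [L HL] := choice (fun phi => ultra_disc_ex (FP phi)).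
have LC phi : cmodulus (L phi) <= C * Dnorm m phi by have [] := HL phi.
have FL phi e : 0 < e -> F [set u | cmodulus ((u : dual) phi - L phi) < e].
  by have [_] := HL phi; exact.
have linL : linear (L : D -> R[i]^o).
  move=> c phi psi; apply: (@cmodulus_eq R) => e e0.
  pose K := cmodulus c + 2; have K0 : 0 < K by rewrite ltr_wpDl ?cmodulus_ge0.
  have d0 : 0 < e / K by rewrite divr_gt0.
  have [u [[u1 u2] u3]] := filter_ex (filterI (filterI (FL (c *: phi + psi) _ d0) (FL phi _ d0))
    (FL psi _ d0)).
  have -> : L (c *: phi + psi) - (c * L phi + L psi) =
      - ((u : dual) (c *: phi + psi) - L (c *: phi + psi)) + c * ((u : dual) phi - L phi) +
      ((u : dual) psi - L psi) by rewrite dualZD; ring.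
  apply: le_trans (ler_cmodulusD _ _) _; apply: le_trans (lerD (ler_cmodulusD _ _) (lexx _)) _.
  rewrite cmodulusN cmodulusM.
  have := ler_wpM2l (cmodulus_ge0 c) (ltW u2).
  move: u1 u3 => /= /ltW u1 /ltW u3 u2'.
  apply: le_trans (lerD (lerD u1 u2') u3) _.
  by rewrite le_eqVlt; apply/orP; left; apply/eqP; rewrite /K; field; rewrite gt_eqF.
have [u0 u0L] := dual_of_bound linL C0 LC.
have Hu0 : bounded_by m C u0 by move=> phi; rewrite u0L.
have Fu0 : (F : set_system (kappa_dual D)) --> (u0 : kappa_dual D).
  apply/(@dual_cvgP R D discs F u0 _) => A [_ /compact_near_coveringP cA] e e0.
  have e3 : 0 < e / 3 by rewrite divr_gt0.
  have C1 : 0 < C + 1 by rewrite ltr_wpDl.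
  have d0 : 0 < e / 3 / (C + 1) by rewrite divr_gt0.
  apply: (cA _ F (fun u phi => cmodulus ((u : dual) phi - u0 phi) < e)) => phi _.
  exists ([set psi | Dnorm m (psi - phi) < e / 3 / (C + 1)],
      [set u | bounded_by m C u /\ cmodulus ((u : dual) phi - u0 phi) < e / 3]).
    split; first by apply/DLp_nbhsP; exists m, (e / 3 / (C + 1)).
    by apply: filterI FH _; rewrite u0L; exact: FL.
  move=> [psi u] /= [lt [Hu lt2]].
  have small v : bounded_by m C v -> cmodulus (v (psi - phi)) <= e / 3.
    move=> Hv; apply: le_trans (Hv _) _; move: lt; rewrite ltr_pdivlMr// => /ltW lt.
    by apply: le_trans lt; rewrite mulrC ler_wpM2l ?Dnorm_ge0// lerDl.
  have -> : (u : dual) psi - u0 psi = (u : dual) (psi - phi) + ((u : dual) phi - u0 phi)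
      - u0 (psi - phi) by rewrite !dualB; ring.
  apply: le_lt_trans (ler_cmodulusD _ _) _; rewrite cmodulusN.
  apply: le_lt_trans (lerD (ler_cmodulusD _ _) (small _ Hu0)) _.
  have := small _ Hu; move: lt2.
  move: (cmodulus _) (cmodulus _) => a b; clear -R e3; lra.
exists u0; split=> //.
apply: (@closed_closure (kappa_dual D)) => U nU.
by have [u [cu Uu]] := filter_ex (filterI FB (Fu0 _ nU)); exists u.
Qed.

(** Each functional is bounded on the compact set [A], and the bound increases by at most 1 on a
neighbourhood of the functional; cover the compact closure of [B]. *)
Lemma relatively_compact_bounded_on B :
  relatively_compact (B : set (kappa_dual D)) -> bounded_on discs B.
Proof.
move=> /compact_near_coveringP cB A SA.
have : \forall M \near (+oo : set_system R), closure (B : set (kappa_dual D)) `<=`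
    [set u | forall phi, A phi -> cmodulus ((u : dual) phi) <= M].
  apply: cB => u _.
  have [m [C [C0 uC]]] := dual_bound u.
  have eu : equicontinuous [set u] by exists m, C; split=> // _ ->.
  have [M HM] := equicontinuous_bounded eu (fun k => compact_Dnorm k SA.2).
  exists ([set v : kappa_dual D | forall phi, A phi -> cmodulus ((v : dual) phi - (u : dual) phi) < 1],
      [set N | M + 1 <= N]).
    split; last by apply: nbhs_pinfty_ge; rewrite num_real.
    have := (@dual_cvgP _ _ discs (nbhs (u : kappa_dual D)) u _).1 _ A SA 1 ltr01.
    by apply; exact: cvg_id.
  move=> [v N] /= [lt le] phi Aphi; apply: le_trans le.
  rewrite -[(v : dual) phi](subrK ((u : dual) phi)) addrC.
  apply: le_trans (ler_cmodulusD _ _) _; apply: lerD; first exact: HM.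
  exact: ltW (lt _ Aphi).
move=> /filter_ex[M HM]; exists M => u phi Bu; apply: HM.
exact: subset_closure.
Qed.

Lemma bounded_strong B : tvs_bounded (B : set (strong_dual D)) <-> equicontinuous B.
Proof.
rewrite dual_bounded; split=> [bB|eB A /DLp_bounded bA].
  apply: bounded_on_discs_equicontinuous => A [_ cA]; apply: bB.
  by apply/DLp_bounded => k; exact: compact_Dnorm.
exact: equicontinuous_bounded.
Qed.

Lemma bounded_kappa B : tvs_bounded (B : set (kappa_dual D)) <-> equicontinuous B.
Proof.
rewrite dual_bounded; split; first exact: bounded_on_discs_equicontinuous.
by move=> eB A [_ cA]; apply: equicontinuous_bounded eB _ => k; exact: compact_Dnorm.
Qed.

Lemma relatively_compact_kappa B :
  relatively_compact (B : set (kappa_dual D)) <-> equicontinuous B.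
Proof.
split; last exact: equicontinuous_relatively_compact.
by move=> /relatively_compact_bounded_on /bounded_on_discs_equicontinuous.
Qed.

End bounded_sets.

(** * Functionals of the form (1 - Delta)^m f *)

Section bessel_bound.
Context {R : realType} {n : nat} (r : R) (p1 : (1 <= r%:E)%E).
Notation D := (DLp n p1).
Notation dual := (topological_dual D).
Notation lp := (lpn (leb n) r).
Notation Lp := (Lfun (leb n) r%:E).
Notation q := (conjugate r).
Implicit Types (phi psi : D) (u v : dual) (B : set dual) (g h : 'rV[R]_n -> R).

Let r1 : 1 <= r. Proof. by move: p1; rewrite lee_fin. Qed.

Definition helmholtz m g := iter m one_sub_laplacian g.

Lemma conjugate_ge1 : (1 <= q)%E.
Proof.
rewrite /conjugate; case: eqVneq => [_|rn1]; first by rewrite leey.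
have r1' : 1 < r by rewrite lt_neqAle eq_sym rn1.
by rewrite lee_fin ler_pdivlMr ?subr_gt0// mul1r lerBlDr lerDl.
Qed.

Lemma helmholtz_Lp m g : sobolev r g -> helmholtz m g \in Lp.
Proof. by move=> sg; exact: sobolev_Lfun (sobolev_iter r1 m sg) [::]. Qed.

Lemma Rintegral_leb g : \int[lebesgue_rV n]_x g x = \int[leb n]_x g x.
Proof. by rewrite /Rintegral integral_leb. Qed.

(** Multiplying out (Re f + i Im f) (psi_1 + i psi_2); the bounds on the components of [f] give the
integrability that allows the integrals to be split. *)
Lemma bessel_convE m (f : 'rV[R]_n -> R[i]) (C : R) phi : 0 <= C ->
  cmeasurable f ->
  ('N[leb n]_q[EFin \o (fun x => complex.Re (f x))] <= C%:E)%E ->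
  ('N[leb n]_q[EFin \o (fun x => complex.Im (f x))] <= C%:E)%E ->
  bessel_conv m f phi = Complex
    (\int[leb n]_x (helmholtz m (Dre phi) x * complex.Re (f x)) -
     \int[leb n]_x (helmholtz m (Dim phi) x * complex.Im (f x)))
    (\int[leb n]_x (helmholtz m (Dim phi) x * complex.Re (f x)) +
     \int[leb n]_x (helmholtz m (Dre phi) x * complex.Im (f x))).
Proof.
move=> C0 [mre mim] Nre Nim.
have L1 := helmholtz_Lp m (sobolev_Dre phi); have L2 := helmholtz_Lp m (sobolev_Dim phi).
have I1 := integrable_hoelder r1 C0 L1 mre Nre; have I2 := integrable_hoelder r1 C0 L2 mim Nim.
have I3 := integrable_hoelder r1 C0 L2 mre Nre; have I4 := integrable_hoelder r1 C0 L1 mim Nim.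
rewrite /bessel_conv /cintegral !Rintegral_leb; congr Complex.
  rewrite -RintegralB//.
  apply: eq_Rintegral => x _; rewrite /bessel_operator; case: (f x) => a b /=.
  by rewrite [a * _]mulrC [b * _]mulrC.
rewrite -RintegralD//.
apply: eq_Rintegral => x _; rewrite /bessel_operator; case: (f x) => a b /=.
by rewrite [a * _]mulrC [b * _]mulrC.
Qed.

Lemma Lnorm_components (f : 'rV[R]_n -> R[i]) (C : R) : cmeasurable f ->
  (cLnorm q f <= C%:E)%E ->
  ('N[leb n]_q[EFin \o (fun x => complex.Re (f x))] <= C%:E)%E /\
  ('N[leb n]_q[EFin \o (fun x => complex.Im (f x))] <= C%:E)%E.
Proof.
move=> mf; have [mre mim] := mf; rewrite /cLnorm !lebE => NC.
have mM := measurable_cmodulus mf.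
have Nabs g : ('N[lebesgue_rV n]_q[EFin \o g] = 'N[lebesgue_rV n]_q[EFin \o (fun x => `|g x|%R)])%E.
  by rewrite -Lnorm_abse.
rewrite [X in (X <= _)%E /\ _]Nabs [X in _ /\ (X <= _)%E]Nabs.
split; apply: le_trans NC; apply: le_Lnorm conjugate_ge1 _ mM _.
- exact: measurableT_comp.
- by move=> x; rewrite normr_ge0 /=; exact: normr_Re_le.
- exact: measurableT_comp.
- by move=> x; rewrite normr_ge0 /=; exact: normr_Im_le.
Qed.

Lemma bessel_ball_bounded m : exists2 C : R, 0 <= C &
  (bessel_conv_ball m q : set dual) `<=` bounded_by m.*2 C.
Proof.
have [C C0 HC] := lpn_iter_one_sub_laplacian (n := n) r1 m.
exists (2 * C); first by rewrite mulr_ge0.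
move=> u [f [mf f1] uE] phi; have [Nre Nim] := Lnorm_components mf f1.
have [mre mim] := mf.
have L1 := helmholtz_Lp m (sobolev_Dre phi); have L2 := helmholtz_Lp m (sobolev_Dim phi).
have -> : u phi = bessel_conv m f phi by rewrite uE.
rewrite (bessel_convE m phi ler01 mf Nre Nim).
have H1 := hoelder_le r1 ler01 L1 mre Nre; have H2 := hoelder_le r1 ler01 L2 mim Nim.
have H3 := hoelder_le r1 ler01 L2 mre Nre; have H4 := hoelder_le r1 ler01 L1 mim Nim.
apply: le_trans (cmodulus_le _) _ => /=.
apply: le_trans (lerD (ler_normB _ _) (ler_normD _ _)) _.
apply: le_trans (lerD (lerD H1 H2) (lerD H3 H4)) _.
have K1 := HC _ (sobolev_Dre phi); have K2 := HC _ (sobolev_Dim phi).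
rewrite /Dnorm !mul1r; move: K1 K2; rewrite -/(helmholtz m _) -/(helmholtz m _).
move: (lp _) (lp _) (sobn _ _ _) (sobn _ _ _) => a b c d.
by clear -r; lra.
Qed.

End bessel_bound.

Section bessel_representation.
Context {R : realType} {n : nat} (r : R) (p1 : (1 <= r%:E)%E).
Notation D := (DLp n p1).
Notation dual := (topological_dual D).
Notation lp := (lpn (leb n) r).
Notation Lp := (Lfun (leb n) r%:E).
Notation q := (conjugate r).
Notation LT := (LfunType (leb n) p1).
Implicit Types (phi psi : D) (u v : dual) (B : set dual) (g h : 'rV[R]_n -> R).

Let r1 : 1 <= r. Proof. by move: p1; rewrite lee_fin. Qed.

Let N (K : R) (v : LT * LT) : R := K * (lp v.1 + lp v.2).

Let ND K : 0 <= K -> forall v w : LT * LT, N K (v + w) <= N K v + N K w.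
Proof.
move=> K0 [v1 v2] [w1 w2]; rewrite /N /= -mulrDr ler_wpM2l//.
have H1 := lpnD r1 (LfunP v1) (LfunP w1); have H2 := lpnD r1 (LfunP v2) (LfunP w2).
by apply: le_trans (lerD H1 H2) _; rewrite addrACA.
Qed.

Let NZ K a (v : LT * LT) : N K (a *: v) = `|a| * N K v.
Proof.
rewrite /N /= (lpnZ r1 a (LfunP v.1)) (lpnZ r1 a (LfunP v.2)).
by rewrite -mulrDr mulrCA.
Qed.

(** Extend to the product of two copies of L^r, then restrict to each factor. The functionals are
handed over as functions on all functions, with an arbitrary value outside L^r. *)
Lemma pair_functional (K : R) (G : set ((LT * LT) * R)) : 0 <= K ->
  linear_graph G -> dominated_graph (N K) G ->
  exists F1 F2, [/\ bounded_functional (leb n) r K F1, bounded_functional (leb n) r K F2 &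
    forall (v : LT * LT) s, G (v, s) -> s = F1 v.1 + F2 v.2].
Proof.
move=> K0 lG dG; have [L [lL LN LG]] := hahn_banach (ND K0) (NZ K) lG dG.
have L0 : L 0 = 0.
  have := lL (-1) 0 0; rewrite scaler0 addr0 mulN1r addNr; exact.
have LD (v w : LT * LT) : L (v + w) = L v + L w by have := lL 1 v w; rewrite scale1r mul1r.
pose sub (f : 'rV[R]_n -> R) : LT := if pselect (f \in Lp) is left H then Lfun_Sub p1 H else 0.
have subE f : f \in Lp -> (sub f : 'rV[R]_n -> R) = f.
  by rewrite /sub; case: pselect => // H _; exact: Lfun_valP.
have subv (v : LT) : sub v = v by apply/LfuneqP => x; rewrite subE//; exact: LfunP.
have sublin a f g : f \in Lp -> g \in Lp -> sub (fun x => a * f x + g x) = a *: sub f + sub g.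
  move=> Lf Lg; apply/LfuneqP => x /=.
  by rewrite !subE//; apply: LfunD => //; exact: LfunZ.
have lp0 : lp (0 : LT) = 0 by exact: lpn0.
exists (fun f => L (sub f, 0)), (fun f => L (0, sub f)); split.
- split=> [a f g Lf Lg|f Lf].
    rewrite sublin// -lL; congr L; apply/eqP.
    by rewrite -pair_eqE /= /pair_eq /= scaler0 addr0 !eqxx.
  by apply: le_trans (LN _) _; rewrite /N /= lp0 addr0 subE.
- split=> [a f g Lf Lg|f Lf].
    rewrite sublin// -lL; congr L; apply/eqP.
    by rewrite -pair_eqE /= /pair_eq /= scaler0 addr0 !eqxx.
  by apply: le_trans (LN _) _; rewrite /N /= lp0 add0r subE.
- move=> [v1 v2] s /LG <- /=; rewrite !subv -LD; congr L; apply/eqP.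
  by rewrite -pair_eqE /= /pair_eq /= addr0 add0r !eqxx.
Qed.

End bessel_representation.

Section bessel_characterisation.
Context {R : realType} {n : nat} (r : R) (p1 : (1 <= r%:E)%E).
Notation D := (DLp n p1).
Notation dual := (topological_dual D).
Notation lp := (lpn (leb n) r).
Notation Lp := (Lfun (leb n) r%:E).
Notation q := (conjugate r).
Notation LT := (LfunType (leb n) p1).
Implicit Types (phi psi : D) (u : dual) (B : set dual) (g h : 'rV[R]_n -> R).

Let r1 : 1 <= r. Proof. by move: p1; rewrite lee_fin. Qed.

(** A product of Gaussians; its values are at most 1, so that raising it to the power r decreases
it. *)
Lemma positive_weight : exists2 w : 'rV[R]_n -> R, forall x, 0 < w x & w \in Lp.
Proof.
exists (@prodw R (@gauss_fun R) n); first by move=> x; apply: prodr_gt0 => i _; exact: expR_gt0.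
have pi0 : 0 <= Num.sqrt (pi : R) ^+ n by rewrite exprn_ge0 ?sqrtr_ge0.
have r0 : 0 < r by exact: lt_le_trans r1.
apply: (lpn_le_const (e := (Num.sqrt pi ^+ n) `^ r^-1) r1 _ _ _).1.
- exact: powR_ge0.
- exact: measurable_hw.
rewrite -powRrM mulVf ?gt_eqF// powRr1// -integral_prodw_gauss.
apply: ge0_le_integral => //.
- apply/measurable_EFinP; apply: measurable_powRl; apply: measurableT_comp => //.
  exact: measurable_hw.
- by apply/measurable_EFinP; exact: measurable_hw.
move=> x _; rewrite lee_fin ger0_norm ?hw_ge0//.
have w1 : prodw (@gauss_fun R) x <= 1.
  apply: (@le_trans _ _ (\prod_(i < n) 1)); last by rewrite prodr_const expr1n.
  by apply: ler_prod => i _; rewrite gauss_fun_ge0 gauss_fun_le1.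
have := hw_ge0 x; rewrite le_eqVlt => /predU1P[<-|w0].
  by rewrite powR0// gt_eqF.
rewrite -[X in _ <= X]powRr1 ?(ltW w0)//.
by apply: ger_powR => //; rewrite w0 w1.
Qed.

Lemma helmholtz_lin m (a : R) g h : sobolev r g -> sobolev r h ->
  helmholtz m (fun x => a * g x + h x) = fun x => a * helmholtz m g x + helmholtz m h x.
Proof.
by move=> sg sh; apply: iter_one_sub_laplacian_lin; [exact: sobolev_smooth sg|exact: sobolev_smooth sh].
Qed.

(** The real part of [u phi] as a multivalued function of the components of (1 - Delta)^m phi. *)
Let graph m u : set ((LT * LT) * R) := [set p : (LT * LT) * R | exists phi,
  [/\ p.1.1 = helmholtz m (Dre phi) :> (_ -> _),
      p.1.2 = helmholtz m (Dim phi) :> (_ -> _) & p.2 = complex.Re (u phi)]].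

Let graph_mem m u phi : exists v : LT * LT, [/\ graph m u (v, complex.Re (u phi)),
  v.1 = helmholtz m (Dre phi) :> (_ -> _) & v.2 = helmholtz m (Dim phi) :> (_ -> _)].
Proof.
exists (Lfun_Sub p1 (helmholtz_Lp p1 m (sobolev_Dre phi)),
  Lfun_Sub p1 (helmholtz_Lp p1 m (sobolev_Dim phi))).
split => //; first by exists phi.
Qed.

Let graph_linear m u : linear_graph (graph m u).
Proof.
have step a phi psi : helmholtz m (Dre (a%:C%C *: phi + psi)) =
    (fun x => a * helmholtz m (Dre phi) x + helmholtz m (Dre psi) x) /\
  helmholtz m (Dim (a%:C%C *: phi + psi)) =
    (fun x => a * helmholtz m (Dim phi) x + helmholtz m (Dim psi) x).
  rewrite DreZD DimZD /= oppr0.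
  have [s1 s2] := (sobolev_Dre phi, sobolev_Dim phi).
  have [s3 s4] := (sobolev_Dre psi, sobolev_Dim psi).
  split.
    by rewrite -helmholtz_lin//; congr (helmholtz m _); apply/funext => x; rewrite mul0r add0r.
  by rewrite -helmholtz_lin//; congr (helmholtz m _); apply/funext => x; rewrite mul0r add0r.
split.
  have [E1 E2] := step (-1) 0 0.
  have E0 : (-1)%:C%C *: (0 : D) + 0 = 0 by rewrite scaler0 addr0.
  exists 0; rewrite dual0; split=> //=; rewrite -E0 ?E1 ?E2.
    by apply/funext => x; rewrite mulN1r addNr.
  by apply/funext => x; rewrite mulN1r addNr.
move=> a [v1 v2] s [w1 w2] t [phi /= [e1 e2 e3]] [psi /= [f1 f2 f3]].
have [E1 E2] := step a phi psi.
exists (a%:C%C *: phi + psi); rewrite dualZD; split=> /=.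
- by rewrite E1 -e1 -f1.
- by rewrite E2 -e2 -f2.
- by rewrite e3 f3 ReZD /= oppr0 mul0r add0r.
Qed.

Lemma helmholtzN m g : sobolev r g -> helmholtz m (fun x => - g x) = fun x => - helmholtz m g x.
Proof.
move=> sg; have := helmholtz_lin m (-2) sg sg.
rewrite (_ : (fun x => -2 * g x + g x) = (fun x => - g x)); last by apply/funext => x; ring.
by move=> ->; apply/funext => x; ring.
Qed.

(** The value of [u] on [i phi] gives the imaginary part of [u phi], so the real part, which
Hahn-Banach and Riesz represent, determines everything. The bound 1/2 leaves room for the two
components of the representing function. *)
Lemma bounded_by_bessel_ball m (C C' : R) u : 0 <= C -> 0 <= C' -> C * C' <= 2^-1 ->
  (forall g, sobolev r g -> sobn r m g <= C' * lp (helmholtz m g)) ->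
  bounded_by m C u -> bessel_conv_ball m q u.
Proof.
move=> C0 C'0 CC' HC uC; set K := C * C' in CC'.
have K0 : 0 <= K by rewrite mulr_ge0.
have dG : dominated_graph (fun v : LT * LT => K * (lp v.1 + lp v.2)) (graph m u).
  move=> [v1 v2] s [phi /= [-> -> ->]].
  apply: le_trans (ler_norm _) _; apply: le_trans (normr_Re_le _) _; apply: le_trans (uC phi) _.
  by rewrite -mulrA ler_wpM2l// mulrDr; apply: lerD; apply: HC;
    [exact: sobolev_Dre|exact: sobolev_Dim].
have [F1 [F2 [b1 b2 HF]]] := pair_functional K0 (graph_linear m u) dG.
have [w w0 Lw] := positive_weight.
have [f1 [mf1 N1 R1]] := riesz_representation r1 K0 b1 w0 Lw.
have [f2 [mf2 N2 R2]] := riesz_representation r1 K0 b2 w0 Lw.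
have ReE phi : complex.Re (u phi) = \int[leb n]_x (helmholtz m (Dre phi) x * f1 x) +
    \int[leb n]_x (helmholtz m (Dim phi) x * f2 x).
  have [v [Gv v1 v2]] := graph_mem m u phi; rewrite (HF _ _ Gv).
  rewrite v1 v2 (R1 _ (helmholtz_Lp p1 m (sobolev_Dre phi))).
  by rewrite (R2 _ (helmholtz_Lp p1 m (sobolev_Dim phi))).
pose f x := Complex (f1 x) (- f2 x).
have mf : cmeasurable f by split=> //; exact: measurable_funN.
have K1 : (K%:E <= (2^-1)%:E)%E by rewrite lee_fin.
have Nf1 := le_trans N1 K1; have Nf2 := le_trans N2 K1.
have N2' : ('N[leb n]_q[EFin \o (fun x => - f2 x)%R] = 'N[leb n]_q[EFin \o f2])%E.
  rewrite -Lnorm_abse -[RHS]Lnorm_abse; congr (Lnorm _ _ _).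
  by apply/funext => x /=; rewrite normrN.
exists f.
  split=> //; rewrite /cLnorm.
  have mab g : measurable_fun setT g -> measurable_fun setT (fun x => `|g x|).
    by move=> mg; exact: measurableT_comp.
  have Nab g : ('N[lebesgue_rV n]_q[EFin \o (fun x => `|g x|%R)] = 'N[leb n]_q[EFin \o g])%E.
    by rewrite lebE -[RHS]Lnorm_abse.
  apply: le_trans (le_Lnorm (g := fun x => `|f1 x| + `|f2 x|) (@conjugate_ge1 R r p1)
    (measurable_cmodulus mf) _ _) _.
  - by apply: measurable_funD; exact: mab.
  - by move=> x; rewrite cmodulus_ge0 /=; have := cmodulus_le (f x); rewrite /= normrN.
  apply: le_trans (eminkowski _ (mab _ mf1) (mab _ mf2) (@conjugate_ge1 R r p1)) _.
  rewrite !Nab; apply: le_trans (leeD Nf1 Nf2) _.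
  by rewrite -EFinD lee_fin -[2^-1]mul1r -splitr.
apply/funext => phi.
rewrite (bessel_convE (C := 2^-1) m phi _ mf)//; last by rewrite N2'.
have [s1 s2] := (sobolev_Dre phi, sobolev_Dim phi).
have L1 := helmholtz_Lp p1 m s1; have L2 := helmholtz_Lp p1 m s2.
have half0 : 0 <= 2^-1 :> R by [].
have RN g : g \in Lp -> \int[leb n]_x (g x * (- f2 x)) = - \int[leb n]_x (g x * f2 x).
  move=> Lg; rewrite -[RHS]mulN1r -RintegralZl//; last exact: (integrable_hoelder r1 half0 Lg mf2 Nf2).
  by apply: eq_Rintegral => x _; rewrite mulN1r mulrN.
have RN1 g : g \in Lp -> \int[leb n]_x (- g x * f1 x) = - \int[leb n]_x (g x * f1 x).
  move=> Lg; rewrite -[RHS]mulN1r -RintegralZl//; last exact: (integrable_hoelder r1 half0 Lg mf1 Nf1).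
  by apply: eq_Rintegral => x _; rewrite mulN1r mulNr.
have iphi : complex.Im (u phi) = - complex.Re (u ('i%C *: phi)).
  by rewrite dualZ; case: (u phi) => a b /=; rewrite mul0r mul1r sub0r opprK.
have Dri : Dre ('i%C *: phi) = fun x => - Dim phi x.
  apply/funext => x; change (complex.Re ('i%C * (phi x : R[i])) = - complex.Im (phi x)).
  by case: (phi x : R[i]) => a b /=; ring.
have Dii : Dim ('i%C *: phi) = Dre phi.
  apply/funext => x; change (complex.Im ('i%C * (phi x : R[i])) = complex.Re (phi x)).
  by case: (phi x : R[i]) => a b /=; ring.
have ImE : complex.Im (u phi) = \int[leb n]_x (helmholtz m (Dim phi) x * f1 x) -
    \int[leb n]_x (helmholtz m (Dre phi) x * f2 x).
  by rewrite iphi ReE Dri Dii helmholtzN// RN1// opprD opprK.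
have -> : u phi = Complex (complex.Re (u phi)) (complex.Im (u phi)) by case: (u phi).
by rewrite ReE ImE /= !RN// opprK.
Qed.

(** Scaling [u] so that the bound of the preceding lemma holds yields the constant C. *)
Theorem equicontinuous_bessel B : equicontinuous B <-> exists (m : nat) (C : R), 0 < C /\
  B `<=` [set C%:C%C *: u | u in bessel_conv_ball m q].
Proof.
split=> [[m [C [C0 BC]]]|[m [C [C0 BC]]]].
  have [C' C'0 HC] := sobn_resolvent (n := n) r1 m.
  have c0 : 0 < 2 * (C * C') + 1 by rewrite ltr_wpDl// mulr_ge0// mulr_ge0.
(* C C' / (2 C C' + 1) <= 1/2. *)
  exists m, (2 * (C * C') + 1); split=> // u Bu; set c := 2 * _ + 1 in c0 *.
  have cn0 : c%:C%C != 0 by rewrite fmorph_eq0 gt_eqF.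
  exists (c^-1%:C%C *: u); last by rewrite scalerA -rmorphM mulfV ?gt_eqF// scale1r.
  apply: (bounded_by_bessel_ball (C := C / c) (C' := C')) => //.
  - by rewrite divr_ge0// ltW.
  - by rewrite mulrAC ler_pdivrMr// /c mulrDr mulKf// mulr1 lerDl.
  move=> phi; have -> : (c^-1%:C%C *: u : dual) phi = c^-1%:C%C * u phi by [].
  rewrite cmodulusM cmodulus_real gtr0_norm ?invr_gt0// mulrC mulrAC.
  by rewrite ler_wpM2r ?invr_ge0 ?(ltW c0)//; exact: BC.
have [C' C'0 HC] := bessel_ball_bounded (n := n) p1 m.
exists m.*2, (C * C'); split=> [|u Bu]; first by rewrite mulr_ge0// ltW.
move=> phi; have [v Hv <-] := BC _ Bu.
have -> : (C%:C%C *: v : dual) phi = C%:C%C * v phi by [].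
rewrite cmodulusM cmodulus_real gtr0_norm// -mulrA ler_wpM2l ?(ltW C0)//.
exact: HC.
Qed.

End bessel_characterisation.

(** The hypothesis 1 < q excludes p = +oo. *)
Lemma conjugate_exponent (R : realType) (p q : \bar R) : (1 <= p)%E -> (1 < q)%E ->
  (p^-1 + q^-1 = 1)%E -> exists2 r : R, p = r%:E & q = conjugate r.
Proof.
move=> p1 q1 pq; have pn0 : p != 0%E by rewrite gt_eqF// (lt_le_trans _ p1)// lte01.
have pNy : (-oo < p)%E by rewrite (lt_le_trans _ p1)// ltNyr.
have qE := (hoelder_conjugateP q pNy pn0).1 pq.
case: p p1 pn0 pNy pq qE => [r| |] //= r1 rn0 _ _ qE; last first.
  by move: q1; rewrite qE hoelder_conjugatey ltxx.
exists r => //; rewrite qE /hoelder_conjugate /conjugate eqe /=.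
move: rn0; rewrite eqe => /negbTE ->; rewrite -EFinB inver subr_eq0.
by case: (r == 1) => //; rewrite mulry gtr0_sg ?mul1e// (lt_le_trans ltr01).
Qed.

Theorem proposition4p5 (R : realType) (n : nat) (n_gt0 : (0 < n)%N)
    (p q : \bar R) (p1 : (1 <= p)%E) (q1 : (1 < q)%E)
    (pq : (p^-1 + q^-1 = 1)%E) :
  (forall B : set (topological_dual (DLp n p1)),
     (tvs_bounded (B : set (strong_dual (DLp n p1))) <->
        relatively_compact (B : set (kappa_dual (DLp n p1)))) /\
     (tvs_bounded (B : set (kappa_dual (DLp n p1))) <->
        relatively_compact (B : set (kappa_dual (DLp n p1))))) /\
  (forall B : set (topological_dual (DLp n p1)),
     tvs_bounded (B : set (strong_dual (DLp n p1))) <->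
     exists (m : nat) (C : R), 0 < C /\
       B `<=` [set (C%:C)%C *: u | u in bessel_conv_ball m q]).
Proof.
have [r pr qr] := conjugate_exponent p1 q1 pq; subst p q.
split=> B; last by rewrite bounded_strong equicontinuous_bessel.
by rewrite bounded_strong bounded_kappa relatively_compact_kappa.
Qed.
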